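(* The following Hopf algebras over $\mathbb{C}$ are canonically endowed with modular pairs in involution: ribbon algebras, coribbon algebras and their tensor products (that is, tensor products of ribbon and coribbon algebras), and compact quantum groups in the sense of Woronowicz (that is, their coordinate Hopf algebras).
   Context: All Hopf algebras are over $\mathbb{C}$, with coproduct $\Delta h=\sum h_{(1)}\otimes h_{(2)}$, counit $\varepsilon$ and antipode $S$. Modular pair in involution: a character $\delta:H\to\mathbb{C}$ (unital algebra homomorphism) and a group-like $\sigma\in H$ with $\delta(\sigma)=1$ such that, with $\widetilde S(h)=\sum\delta(h_{(1)})S(h_{(2)})$, the map $h\mapsto\sigma^{-1}\widetilde S(h)$ has square the identity of $H$. ''Canonically endowed'' means that such a pair is determined by the given structure (ribbon, coribbon, or compact quantum group structure) of the Hopf algebra. Ribbon algebra: a quasitriangular Hopf algebra $(H,R)$, i.e. $R=\sum R^{(1)}\otimes R^{(2)}\in H\otimes H$ is invertible with $R\,\Delta(h)=\Delta^{op}(h)\,R$, $(\Delta\otimes\mathrm{id})R=R_{13}R_{23}$, $(\mathrm{id}\otimes\Delta)R=R_{13}R_{12}$, together with a central element $\theta\in H$ such that $\theta^2=u\,S(u)$, $\Delta(\theta)=(R_{21}R)^{-1}(\theta\otimes\theta)$, $\varepsilon(\theta)=1$, $S(\theta)=\theta$, where $u=\sum S(R^{(2)})R^{(1)}$. Coribbon algebra (the dual notion): a coquasitriangular Hopf algebra $(H,r)$, i.e. $r:H\otimes H\to\mathbb{C}$ is convolution invertible with $\sum r(a_{(1)},b_{(1)})\,a_{(2)}b_{(2)}=\sum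 b_{(1)}a_{(1)}\,r(a_{(2)},b_{(2)})$, $r(ab,c)=\sum r(a,c_{(1)})r(b,c_{(2)})$, $r(a,bc)=\sum r(a_{(1)},c)r(a_{(2)},b)$, together with a linear functional $\theta\in H^*$ which is central for the convolution product $*$ of $H^*$ and satisfies $\theta*\theta=u*(u\circ S)$, $\theta(1)=1$, $\theta\circ S=\theta$, and $\theta(ab)=\sum (r_{21}*r)^{-1}(a_{(1)},b_{(1)})\,\theta(a_{(2)})\theta(b_{(2)})$. Here $r_{21}(a,b)=r(b,a)$ and $u(h)=\sum r(h_{(2)},S(h_{(1)}))$. The coordinate Hopf algebra of a compact quantum group in the sense of Woronowicz is the Hopf $*$-algebra spanned by the matrix coefficients of its finite-dimensional unitary (co)representations. *)

(* Defs.v *)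
From HB Require Import structures.
From mathcomp Require Import all_boot all_order all_algebra.
From mathcomp Require Import boolp reals.
From mathcomp Require Import complex.

Set Implicit Arguments.
Unset Strict Implicit.
Unset Printing Implicit Defensive.

Import GRing.Theory.
Local Open Scope ring_scope.

Reserved Notation "u '⊗' v" (at level 35, right associativity).

(* A formal sum \sum_i u_i ⊗ v_i is a sequence of pairs; two formal sums are
   identified when no bilinear map distinguishes them, so that the quotient has
   the universal property of the tensor product by construction. *)
Section Tensor.
Variables (k : comNzRingType) (U V : lmodType k).

Definition fsum (W : lmodType k) (f : U -> V -> W) (s : seq (U * V)) : W :=
  \sum_(p <- s) f p.1 p.2.

Definition tensor_eq (s t : seq (U * V)) : bool :=
  `[< forall (W : lmodType k) (f : U -> V -> W),
        bilinear_for *:%R *:%R f -> fsum f s = fsum f t >].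

Lemma tensor_eq_refl : reflexive tensor_eq.
Proof. by move=> s; apply/asboolP. Qed.

Lemma tensor_eq_sym : symmetric tensor_eq.
Proof.
by move=> s t; apply/asboolP/asboolP => e W f bf; rewrite (e W f bf).
Qed.

Lemma tensor_eq_trans : transitive tensor_eq.
Proof.
move=> t s r /asboolP e1 /asboolP e2; apply/asboolP => W f bf.
by rewrite (e1 W f bf) (e2 W f bf).
Qed.

Canonical tensor_equiv :=
  EquivRel tensor_eq tensor_eq_refl tensor_eq_sym tensor_eq_trans.

Definition tensor : Type := {eq_quot tensor_equiv}%qT.

HB.instance Definition _ := Choice.on tensor.
HB.instance Definition _ := EqQuotient.on tensor.

Definition pure (u : U) (v : V) : tensor := \pi_tensor%qT [:: (u, v)].

(* The linear map induced by f on the tensor product; it is meaningful when f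
   is bilinear. *)
Definition tlift (W : lmodType k) (f : U -> V -> W) (t : tensor) : W :=
  fsum f (repr t)%qT.

Lemma tlift_pi (W : lmodType k) (f : U -> V -> W) s :
  bilinear_for *:%R *:%R f -> tlift f (\pi_tensor%qT s) = fsum f s.
Proof.
move=> bf; rewrite /tlift; have /eqmodP/asboolP e := reprK (\pi_tensor%qT s).
exact: e.
Qed.

Lemma tensor_eqP (s t : tensor) :
  (forall (W : lmodType k) (f : U -> V -> W),
     bilinear_for *:%R *:%R f -> tlift f s = tlift f t) -> s = t.
Proof.
move=> e; rewrite -[s]reprK -[t]reprK; apply/eqmodP/asboolP => W f bf.
exact: e.
Qed.

Definition tzero : tensor := \pi_tensor%qT [::].
Definition tadd (s t : tensor) : tensor := \pi_tensor%qT (repr s ++ repr t)%qT.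
Definition tscale (a : k) (t : tensor) : tensor :=
  \pi_tensor%qT [seq (a *: p.1, p.2) | p <- (repr t)%qT].
Definition topp (t : tensor) : tensor := tscale (-1) t.

Section TliftOps.
Variables (W : lmodType k) (f : U -> V -> W).
Hypothesis bf : bilinear_for *:%R *:%R f.

Lemma bilDl u u' v : f (u + u') v = f u v + f u' v.
Proof. by have /= := bf.1 v 1 u u'; rewrite !scale1r. Qed.
Lemma bilDr u v v' : f u (v + v') = f u v + f u v'.
Proof. by have /= := bf.2 u 1 v v'; rewrite !scale1r. Qed.
Lemma bilZl a u v : f (a *: u) v = a *: f u v.
Proof. exact: (scalable_linear (bf.1 v)). Qed.
Lemma bilZr a u v : f u (a *: v) = a *: f u v.
Proof. exact: (scalable_linear (bf.2 u)). Qed.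

Lemma tlift0 : tlift f tzero = 0.
Proof. by rewrite tlift_pi // /fsum big_nil. Qed.

Lemma tliftD s t : tlift f (tadd s t) = tlift f s + tlift f t.
Proof. by rewrite tlift_pi // /fsum big_cat. Qed.

Lemma tliftZ a t : tlift f (tscale a t) = a *: tlift f t.
Proof.
rewrite tlift_pi // /tlift /fsum big_map scaler_sumr.
by apply: eq_bigr => p _; rewrite bilZl.
Qed.

Lemma tlift_pure u v : tlift f (pure u v) = f u v.
Proof. by rewrite tlift_pi // /fsum big_seq1. Qed.

End TliftOps.

Lemma taddA : associative tadd.
Proof. by move=> s t r; apply: tensor_eqP => W f bf; rewrite !tliftD // addrA. Qed.
Lemma taddC : commutative tadd.
Proof. by move=> s t; apply: tensor_eqP => W f bf; rewrite !tliftD // addrC. Qed.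
Lemma tadd0 : left_id tzero tadd.
Proof.
by move=> s; apply: tensor_eqP => W f bf; rewrite tliftD // tlift0 // add0r.
Qed.
Lemma taddN : left_inverse tzero topp tadd.
Proof.
move=> s; apply: tensor_eqP => W f bf.
by rewrite tliftD // tliftZ // scaleN1r addNr tlift0.
Qed.

HB.instance Definition _ := GRing.isZmodule.Build tensor taddA taddC tadd0 taddN.

Lemma tscaleA a b t : tscale a (tscale b t) = tscale (a * b) t.
Proof. by apply: tensor_eqP => W f bf; rewrite !tliftZ // scalerA. Qed.
Lemma tscale1 : left_id 1 tscale.
Proof. by move=> t; apply: tensor_eqP => W f bf; rewrite tliftZ // scale1r. Qed.
Lemma tscaleDr : right_distributive tscale +%R.
Proof.
move=> a s t; apply: tensor_eqP => W f bf.
by rewrite !(tliftZ, tliftD) // scalerDr.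
Qed.
Lemma tscaleDl t : {morph tscale^~ t : a b / a + b}.
Proof.
move=> a b; apply: tensor_eqP => W f bf.
by rewrite !(tliftZ, tliftD) // scalerDl.
Qed.

HB.instance Definition _ :=
  GRing.Zmodule_isLmodule.Build k tensor tscaleA tscale1 tscaleDr tscaleDl.

Lemma tlift_linear (W : lmodType k) (f : U -> V -> W) :
  bilinear_for *:%R *:%R f -> linear (tlift f).
Proof. by move=> bf a s t; rewrite tliftD // tliftZ. Qed.

Lemma pure_bilinear : bilinear_for *:%R *:%R pure.
Proof.
split=> [v a u u'|u a v v']; apply: tensor_eqP => W f bf;
  rewrite tlift_linear // !tlift_pure //.
  exact: (bf.1 v).
exact: (bf.2 u).
Qed.

Lemma pure_linearl v : linear (fun u => pure u v).
Proof. exact: pure_bilinear.1. Qed.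

Lemma pure_linearr u : linear (pure u).
Proof. exact: pure_bilinear.2. Qed.

Lemma tensor_sum (t : tensor) : t = \sum_(p <- (repr t)%qT) pure p.1 p.2.
Proof.
apply: tensor_eqP => W f bf.
have [h hE] : exists h : {linear tensor -> W}, h =1 tlift f.
  pose m := GRing.isLinear.Build _ _ _ _ (tlift f) (tlift_linear bf).
  pose h : {linear tensor -> W} := HB.pack (tlift f) m.
  by exists h.
rewrite -!hE [in RHS]linear_sum hE; apply: eq_bigr => p _.
by rewrite hE tlift_pure.
Qed.

Lemma tensor_ext (W : lmodType k) (f g : tensor -> W) :
  linear f -> linear g -> (forall u v, f (pure u v) = g (pure u v)) -> f =1 g.
Proof.
move=> lf lg e t; rewrite [t]tensor_sum; elim: (repr t)%qT => [|p s IH].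
  rewrite !big_nil; have /= := scalable_linear lf 0 0.
  by have /= := scalable_linear lg 0 0; rewrite !scale0r => -> ->.
rewrite !big_cons -[pure _ _]scale1r.
by rewrite lf lg /= e IH.
Qed.

End Tensor.

Notation "U '⊗' V" := (tensor U%type V%type) : type_scope.
Notation "u '⊗' v" := (pure u v) : ring_scope.

(* tlift is a finite sum over a fixed representative, hence linear in f. *)
Lemma tlift_linearf (k : comNzRingType) (U V W X : lmodType k)
    (F : X -> U -> V -> W) (t : U ⊗ V) :
  (forall u v, linear (fun x => F x u v)) -> linear (fun x => tlift (F x) t).
Proof.
move=> lF a x y; rewrite /tlift /fsum scaler_sumr -big_split /=.
by apply: eq_bigr => p _; rewrite lF.
Qed.

Lemma linear_id (k : comNzRingType) (U : lmodType k) : linear (fun x : U => x).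
Proof. by []. Qed.

Lemma linear_comp (k : comNzRingType) (U V W : lmodType k) (f : V -> W)
  (g : U -> V) : linear f -> linear g -> linear (fun x => f (g x)).
Proof. by move=> lf lg a x y; rewrite lg lf. Qed.

Lemma linear_scaler (k : comNzRingType) (U V : lmodType k) a (g : U -> V) :
  linear g -> linear (fun x => a *: g x).
Proof. by move=> lg b x y; rewrite lg scalerDr !scalerA mulrC. Qed.

Lemma linear_scalel (k : comNzRingType) (U V : lmodType k) (g : U -> k) (v : V) :
  scalar g -> linear (fun x => g x *: v).
Proof. by move=> lg b x y; rewrite lg scalerDl scalerA. Qed.

Lemma linear_mulr (k : comNzRingType) (U : lmodType k) (A : algType k)
  (g : U -> A) b : linear g -> linear (fun x => g x * b).
Proof. by move=> lg c x y; rewrite lg mulrDl scalerAl. Qed.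

Lemma linear_mull (k : comNzRingType) (U : lmodType k) (A : algType k)
  (g : U -> A) b : linear g -> linear (fun x => b * g x).
Proof. by move=> lg c x y; rewrite lg mulrDr scalerAr. Qed.

Ltac lin :=
  match goal with
  | |- bilinear_for _ _ _ =>
      first [ by apply: pure_bilinear | split; let x := fresh "x" in move=> x /=; lin ]
  | |- GRing.linear_for _ (fun x => x) => apply: linear_id
  | |- GRing.linear_for _ (fun x => tlift (fun a b => @?F x a b) ?t) =>
      apply: tlift_linearf => ? ? /=; lin
  | |- GRing.linear_for _ (fun x => tlift ?F (@?g x)) =>
      apply: (@linear_comp _ _ _ _ (tlift F) g);
      [ apply: tlift_linear; lin | lin ]
  | |- GRing.linear_for _ (fun x => pure (@?g x) ?v) =>
      apply: (@linear_comp _ _ _ _ (fun u => pure u v) g);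
      [ exact: pure_linearl | lin ]
  | |- GRing.linear_for _ (fun x => pure ?v (@?g x)) =>
      apply: (@linear_comp _ _ _ _ (pure v) g);
      [ exact: pure_linearr | lin ]
  | |- GRing.linear_for _ (fun x => ?a *: (@?g x)) => apply: linear_scaler; lin
  | |- GRing.linear_for _ (fun x => (@?g x) *: ?v) => apply: linear_scalel; lin
  | |- GRing.linear_for _ (fun x => (@?g x) * ?v) => apply: linear_mulr; lin
  | |- GRing.linear_for _ (fun x => ?v * (@?g x)) => apply: linear_mull; lin
  | H : GRing.linear_for _ ?f |- GRing.linear_for _ (fun x => ?f (@?g x)) =>
      apply: (linear_comp H); lin
  | H : GRing.linear_for _ ?f |- GRing.linear_for _ ?f => exact: H
  | H : forall _, GRing.linear_for _ _ |- GRing.linear_for _ _ => exact: H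
  | |- _ => idtac
  end.

Definition tmap (k : comNzRingType) (U U' V V' : lmodType k)
    (f : U -> U') (g : V -> V') : U ⊗ V -> U' ⊗ V' :=
  tlift (fun u v => f u ⊗ g v).

Definition tassoc (k : comNzRingType) (U V W : lmodType k) :
    (U ⊗ V) ⊗ W -> U ⊗ (V ⊗ W) :=
  tlift (fun t w => tlift (fun u v => u ⊗ (v ⊗ w)) t).

Definition tflip (k : comNzRingType) (U V : lmodType k) : U ⊗ V -> V ⊗ U :=
  tlift (fun u v => v ⊗ u).

Section TensorLinear.
Variables (k : comNzRingType) (U U' V V' W : lmodType k).

Lemma tmap_linear (f : U -> U') (g : V -> V') :
  linear f -> linear g -> linear (tmap f g).
Proof. by move=> lf lg; apply: tlift_linear; lin. Qed.

Lemma tmap_pure (f : U -> U') (g : V -> V') u v :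
  linear f -> linear g -> tmap f g (u ⊗ v) = f u ⊗ g v.
Proof. by move=> lf lg; rewrite /tmap tlift_pure //; lin. Qed.

Lemma tassoc_linear : linear (@tassoc k U V W).
Proof. by apply: tlift_linear; lin. Qed.

Lemma tassoc_pure (u : U) (v : V) (w : W) : tassoc ((u ⊗ v) ⊗ w) = u ⊗ (v ⊗ w).
Proof. by rewrite /tassoc tlift_pure; [rewrite tlift_pure|]; lin. Qed.

Lemma tflip_linear : linear (@tflip k U V).
Proof. by apply: tlift_linear; lin. Qed.

Lemma tflip_pure (u : U) (v : V) : tflip (u ⊗ v) = v ⊗ u.
Proof. by rewrite /tflip tlift_pure //; lin. Qed.

End TensorLinear.

Section TensorAlgebra.
Variables (k : comNzRingType) (A B : algType k).

Definition tmul (s t : A ⊗ B) : A ⊗ B :=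
  tlift (fun a b => tlift (fun a' b' => (a * a') ⊗ (b * b')) t) s.

Lemma tmul_linearl t : linear (tmul^~ t).
Proof. by apply: tlift_linear; lin. Qed.

Lemma tmul_linearr s : linear (tmul s).
Proof. by rewrite /tmul; lin. Qed.

Lemma tmul_pure a b a' b' : tmul (a ⊗ b) (a' ⊗ b') = (a * a') ⊗ (b * b').
Proof. by rewrite /tmul tlift_pure; [rewrite tlift_pure|]; lin. Qed.

Lemma tmulA : associative tmul.
Proof.
move=> s t r; move: s; apply: tensor_ext => [||a b].
- exact: tmul_linearl.
- apply: (linear_comp (f := tmul^~ r)); exact: tmul_linearl.
move: t; apply: tensor_ext => [||a' b'].
- apply: (linear_comp (f := tmul (a ⊗ b))); [exact: tmul_linearr|exact: tmul_linearl].
- apply: (linear_comp (f := tmul^~ r)); [exact: tmul_linearl|exact: tmul_linearr].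
move: r; apply: tensor_ext => [||a2 b2].
- by apply: (linear_comp (f := tmul (a ⊗ b))); exact: tmul_linearr.
- exact: tmul_linearr.
by rewrite !tmul_pure !mulrA.
Qed.

Lemma tmul1l : left_id (1 ⊗ 1) tmul.
Proof.
by apply: tensor_ext => [|//|a b]; [exact: tmul_linearr|rewrite tmul_pure !mul1r].
Qed.

Lemma tmul1r : right_id (1 ⊗ 1) tmul.
Proof.
by apply: tensor_ext => [|//|a b]; [exact: tmul_linearl|rewrite tmul_pure !mulr1].
Qed.

Lemma tmulDl : left_distributive tmul +%R.
Proof. by move=> s t r; have := tmul_linearl r 1 s t; rewrite !scale1r. Qed.

Lemma tmulDr : right_distributive tmul +%R.
Proof. by move=> r s t; have := tmul_linearr r 1 s t; rewrite !scale1r. Qed.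

HB.instance Definition _ := GRing.Zmodule_isPzRing.Build (A ⊗ B)%type
  tmulA tmul1l tmul1r tmulDl tmulDr.

Lemma tmulE (a a' : A) (b b' : B) : (a ⊗ b) * (a' ⊗ b') = (a * a') ⊗ (b * b').
Proof. exact: tmul_pure. Qed.

Lemma tscaleAl (c : k) (s t : A ⊗ B) : c *: (s * t) = (c *: s) * t.
Proof. by rewrite [RHS](scalable_linear (tmul_linearl t)). Qed.

Lemma tscaleAr (c : k) (s t : A ⊗ B) : c *: (s * t) = s * (c *: t).
Proof. by rewrite [RHS](scalable_linear (tmul_linearr s)). Qed.

End TensorAlgebra.

HB.mixin Record isHopfAlgebra (k : comNzRingType) H of GRing.Algebra k H := {
  comul : H -> H ⊗ H;
  counit : H -> k;
  antipode : H -> H;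
  comul_linear : linear comul;
  counit_linear : scalar counit;
  antipode_linear : linear antipode;
  comul1 : comul 1 = 1 ⊗ 1;
  comulM : {morph comul : a b / a * b};
  counit1 : counit 1 = 1;
  counitM : {morph counit : a b / a * b};
  comulA : forall h,
    tassoc (tmap comul id (comul h)) = tmap id comul (comul h);
  comulel : forall h, tlift (fun a b => counit a *: b) (comul h) = h;
  comuler : forall h, tlift (fun a b => counit b *: a) (comul h) = h;
  antipodel : forall h, tlift (fun a b => antipode a * b) (comul h) = counit h *: 1;
  antipoder : forall h, tlift (fun a b => a * antipode b) (comul h) = counit h *: 1
}.

#[short(type="hopfAlgType")]
HB.structure Definition HopfAlgebra (k : comNzRingType) :=
  {H of isHopfAlgebra k H & GRing.Algebra k H}.

Notation "\tsum_ ( a ⊗ b '<-' t ) E" := (tlift (fun a b => E) t)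
  (at level 41, a name, b name, t at level 200, E at level 41) : ring_scope.

Definition teval (k : comNzRingType) (U V : lmodType k) (f : U -> V -> k) :
  U ⊗ V -> k := @tlift k U V k^o f.

Notation "\teval_ ( a ⊗ b '<-' t ) E" := (teval (fun a b => E) t)
  (at level 41, a name, b name, t at level 200, E at level 41) : ring_scope.

Section TensorHopf.
Variables (k : comNzRingType) (H K : hopfAlgType k).

Let lcoH : linear (@comul k H). Proof. exact: comul_linear. Qed.
Let lcoK : linear (@comul k K). Proof. exact: comul_linear. Qed.
Let lcuH : linear (@counit k H : H -> k^o). Proof. exact: counit_linear. Qed.
Let lcuK : linear (@counit k K : K -> k^o). Proof. exact: counit_linear. Qed.
Let laH : linear (@antipode k H). Proof. exact: antipode_linear. Qed.
Let laK : linear (@antipode k K). Proof. exact: antipode_linear. Qed.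

Definition tcounit (t : H ⊗ K) : k := \teval_(a ⊗ b <- t) (counit a * counit b).

Lemma tcounit_linear : scalar tcounit.
Proof.
apply: (tlift_linear (W := k^o)); split=> x /=.
  by apply: (linear_mulr (A := k^o)).
by apply: (linear_mull (A := k^o)).
Qed.

Lemma tcounit_pure a b : tcounit (a ⊗ b) = counit a * counit b.
Proof.
rewrite /tcounit /teval (tlift_pure (W := k^o)) //; split=> x /=.
  by apply: (linear_mulr (A := k^o)).
by apply: (linear_mull (A := k^o)).
Qed.

Lemma tensor_oner_neq0 : (1 : H ⊗ K) != 0.
Proof.
apply/eqP => /(congr1 tcounit); rewrite tcounit_pure !counit1 mulr1.
have /= := scalable_linear tcounit_linear 0 0; rewrite scale0r mul0r => ->.
by move/eqP; rewrite oner_eq0.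
Qed.

HB.instance Definition _ :=
  GRing.PzSemiRing_isNonZero.Build (H ⊗ K)%type tensor_oner_neq0.
HB.instance Definition _ := GRing.Lmodule_isLalgebra.Build k (H ⊗ K)%type
  (@tscaleAl k H K).
HB.instance Definition _ := GRing.Lalgebra_isAlgebra.Build k (H ⊗ K)%type
  (@tscaleAr k H K).

Definition tmid (U V : lmodType k) (x : U ⊗ U) (y : V ⊗ V) : (U ⊗ V) ⊗ (U ⊗ V) :=
  \tsum_(a ⊗ a' <- x) \tsum_(b ⊗ b' <- y) (a ⊗ b) ⊗ (a' ⊗ b').

(* The coproduct is a ⊗ b |-> \sum (a_1 ⊗ b_1) ⊗ (a_2 ⊗ b_2). *)
Definition tcomul (t : H ⊗ K) : (H ⊗ K) ⊗ (H ⊗ K) :=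
  \tsum_(a ⊗ b <- t) tmid (comul a) (comul b).

Definition tantipode : H ⊗ K -> H ⊗ K := tmap (@antipode k H) (@antipode k K).

Lemma tmid_bilinear (U V : lmodType k) : bilinear_for *:%R *:%R (@tmid U V).
Proof.
split=> [y|x]; rewrite /tmid; last by lin.
by apply: tlift_linear; lin.
Qed.

Lemma tmid_linearl (U V : lmodType k) y : linear (fun x => @tmid U V x y).
Proof. exact: (tmid_bilinear U V).1. Qed.
Lemma tmid_linearr (U V : lmodType k) x : linear (@tmid U V x).
Proof. exact: (tmid_bilinear U V).2. Qed.

Lemma tmid_pure (U V : lmodType k) (a a' : U) (b b' : V) :
  tmid (a ⊗ a') (b ⊗ b') = (a ⊗ b) ⊗ (a' ⊗ b').
Proof. by rewrite /tmid tlift_pure; [rewrite tlift_pure|]; lin. Qed.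

Lemma tcomul_linear : linear tcomul.
Proof.
apply: tlift_linear; split=> x /=.
  exact: (linear_comp (@tmid_linearl _ _ _) lcoH).
exact: (linear_comp (@tmid_linearr _ _ _) lcoK).
Qed.

Lemma tcomul_pure a b : tcomul (a ⊗ b) = tmid (comul a) (comul b).
Proof.
rewrite /tcomul tlift_pure //; split=> x /=.
  exact: (linear_comp (@tmid_linearl _ _ _) lcoH).
exact: (linear_comp (@tmid_linearr _ _ _) lcoK).
Qed.

Lemma tantipode_linear : linear tantipode.
Proof. exact: tmap_linear. Qed.

Lemma tantipode_pure a b : tantipode (a ⊗ b) = antipode a ⊗ antipode b.
Proof. exact: tmap_pure. Qed.

Lemma tcomul1 : tcomul (1 : H ⊗ K) = 1 ⊗ 1.
Proof. by rewrite tcomul_pure !comul1 tmid_pure. Qed.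

Lemma tmidM (x x' : H ⊗ H) (y y' : K ⊗ K) :
  tmid (x * x') (y * y') = tmid x y * tmid x' y'.
Proof.
pose L := @tmul_linearl k (H ⊗ K)%type (H ⊗ K)%type.
pose R := @tmul_linearr k (H ⊗ K)%type (H ⊗ K)%type.
move: x; apply: tensor_ext => [||a1 a2].
- exact: (linear_comp (@tmid_linearl _ _ _) (@tmul_linearl k H H _)).
- exact: (linear_comp (L _) (@tmid_linearl _ _ _)).
move: x'; apply: tensor_ext => [||a1' a2'].
- exact: (linear_comp (@tmid_linearl _ _ _) (@tmul_linearr k H H _)).
- exact: (linear_comp (R _) (@tmid_linearl _ _ _)).
move: y; apply: tensor_ext => [||b1 b2].
- exact: (linear_comp (@tmid_linearr _ _ _) (@tmul_linearl k K K _)).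
- exact: (linear_comp (L _) (@tmid_linearr _ _ _)).
move: y'; apply: tensor_ext => [||b1' b2'].
- exact: (linear_comp (@tmid_linearr _ _ _) (@tmul_linearr k K K _)).
- exact: (linear_comp (R _) (@tmid_linearr _ _ _)).
by rewrite !tmulE !tmid_pure !tmulE.
Qed.

Lemma tcomulM : {morph tcomul : s t / s * t}.
Proof.
pose L := @tmul_linearl k (H ⊗ K)%type (H ⊗ K)%type.
pose R := @tmul_linearr k (H ⊗ K)%type (H ⊗ K)%type.
move=> s t; move: s; apply: tensor_ext => [||a b].
- exact: (linear_comp tcomul_linear (@tmul_linearl k H K _)).
- exact: (linear_comp (L _) tcomul_linear).
move: t; apply: tensor_ext => [||a' b'].
- exact: (linear_comp tcomul_linear (@tmul_linearr k H K _)).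
- exact: (linear_comp (R _) tcomul_linear).
by rewrite tmulE !tcomul_pure !comulM tmidM.
Qed.

Lemma tcounit1 : tcounit (1 : H ⊗ K) = 1.
Proof. by rewrite tcounit_pure !counit1 mulr1. Qed.

Lemma tcounitM : {morph tcounit : s t / s * t}.
Proof.
move=> s t; move: s.
apply: (@tensor_ext _ _ _ k^o (fun s => tcounit (s * t))
          (fun s => tcounit s * tcounit t)) => [||a b].
- exact: (linear_comp (W := k^o) tcounit_linear (@tmul_linearl k H K _)).
- exact: (linear_mulr (A := k^o) _ tcounit_linear).
move: t; apply: (@tensor_ext _ _ _ k^o (fun t => tcounit ((a ⊗ b) * t))
          (fun t => tcounit (a ⊗ b) * tcounit t)) => [||a' b'].
- exact: (linear_comp (W := k^o) tcounit_linear (@tmul_linearr k H K _)).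
- exact: (linear_mull (A := k^o) _ tcounit_linear).
by rewrite tmulE !tcounit_pure !counitM mulrACA.
Qed.

Lemma tcomulA t :
  tassoc (tmap tcomul id (tcomul t)) = tmap id tcomul (tcomul t).
Proof.
have lid (U : lmodType k) : linear (id : U -> U) by [].
have lL : linear (tmap tcomul (id : H ⊗ K -> H ⊗ K)).
  by apply: tmap_linear => //; exact: tcomul_linear.
have lR : linear (tmap (id : H ⊗ K -> H ⊗ K) tcomul).
  by apply: tmap_linear => //; exact: tcomul_linear.
have lA := @tassoc_linear k (H ⊗ K)%type (H ⊗ K)%type (H ⊗ K)%type.
have lmH := @tmap_linear k H _ H _ comul id lcoH (lid _).
have lmK := @tmap_linear k K _ K _ comul id lcoK (lid _).
have lmH' := @tmap_linear k H _ H _ id comul (lid _) lcoH.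
have lmK' := @tmap_linear k K _ K _ id comul (lid _) lcoK.
have lAH := @tassoc_linear k H H H.
have lAK := @tassoc_linear k K K K.
pose mid3 (x : H ⊗ (H ⊗ H)) (y : K ⊗ (K ⊗ K)) :=
  \tsum_(a ⊗ x' <- x) \tsum_(b ⊗ y' <- y) (a ⊗ b) ⊗ tmid x' y'.
have ml x' := @tmid_linearl H K x'.
have mr x' := @tmid_linearr H K x'.
have m3b : bilinear_for *:%R *:%R mid3.
  split=> x; rewrite /mid3 /=; last first.
    apply: tlift_linearf => u v; apply: tlift_linear.
    by split=> z /=; lin.
  apply: tlift_linear; split=> z /=; lin.
have m3l y : linear (mid3^~ y) by exact: m3b.1.
have m3r y : linear (mid3 y) by exact: m3b.2.
have m3p a b x y : mid3 (a ⊗ x) (b ⊗ y) = (a ⊗ b) ⊗ tmid x y.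
  rewrite /mid3 tlift_pure; first by rewrite tlift_pure //; split=> z /=; lin.
  by split=> z /=; [lin | apply: tlift_linearf => u v; lin; exact: ml].
have left x y :
    tassoc (tmap tcomul id (tmid x y)) =
    mid3 (tassoc (tmap comul id x)) (tassoc (tmap comul id y)).
  move: x; apply: tensor_ext => [||a1 a2].
  - exact: (linear_comp lA (linear_comp lL (ml _))).
  - exact: (linear_comp (m3l _) (linear_comp lAH lmH)).
  move: y; apply: tensor_ext => [||b1 b2].
  - exact: (linear_comp lA (linear_comp lL (mr _))).
  - exact: (linear_comp (m3r _) (linear_comp lAK lmK)).
  rewrite tmid_pure !tmap_pure // ?tcomul_pure; last exact: tcomul_linear.
  have lp (U V : lmodType k) (v : V) := pure_linearl (U := U) v.
  move: (comul a1); apply: tensor_ext => [||a a'].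
  - exact: (linear_comp lA (linear_comp (lp _ _ _) (ml _))).
  - exact: (linear_comp (m3l _) (linear_comp lAH (lp _ _ _))).
  move: (comul b1); apply: tensor_ext => [||b b'].
  - exact: (linear_comp lA (linear_comp (lp _ _ _) (mr _))).
  - exact: (linear_comp (m3r _) (linear_comp lAK (lp _ _ _))).
  by rewrite tmid_pure !tassoc_pure m3p tmid_pure.
have right x y :
    tmap id tcomul (tmid x y) = mid3 (tmap id comul x) (tmap id comul y).
  move: x; apply: tensor_ext => [||a1 a2].
  - exact: (linear_comp lR (ml _)).
  - exact: (linear_comp (m3l _) lmH').
  move: y; apply: tensor_ext => [||b1 b2].
  - exact: (linear_comp lR (mr _)).
  - exact: (linear_comp (m3r _) lmK').
  by rewrite tmid_pure !tmap_pure // ?tcomul_pure ?m3p; last exact: tcomul_linear.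
move: t; apply: tensor_ext => [||a b].
- exact: (linear_comp lA (linear_comp lL tcomul_linear)).
- exact: (linear_comp lR tcomul_linear).
by rewrite tcomul_pure left right !comulA.
Qed.

(* The remaining axioms all compare a contraction of the coproduct with a map
   given on pure tensors. *)
Lemma tcontract (W : lmodType k) (F : H ⊗ K -> H ⊗ K -> W)
    (FH : H -> H -> H) (FK : K -> K -> K) (g : H ⊗ K -> W) (q : H ⊗ K -> W) :
  bilinear_for *:%R *:%R F -> bilinear_for *:%R *:%R FH ->
  bilinear_for *:%R *:%R FK -> linear g -> linear q ->
  (forall a a' b b', F (a ⊗ b) (a' ⊗ b') = q (FH a a' ⊗ FK b b')) ->
  (forall a b, q (tlift FH (comul a) ⊗ tlift FK (comul b)) = g (a ⊗ b)) ->
  forall t, tlift F (tcomul t) = g t.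
Proof.
move=> bF bH bK lg lq FE gE; apply: tensor_ext => // [|a b].
  exact: (linear_comp (tlift_linear bF) tcomul_linear).
rewrite tcomul_pure -gE.
have lH := tlift_linear bH; have lK := tlift_linear bK; have lF := tlift_linear bF.
move: (comul a); apply: tensor_ext => [||a1 a2].
- exact: (linear_comp lF (@tmid_linearl _ _ _)).
- exact: (linear_comp lq (linear_comp (pure_linearl (U := H) _) lH)).
move: (comul b); apply: tensor_ext => [||b1 b2].
- exact: (linear_comp lF (@tmid_linearr _ _ _)).
- exact: (linear_comp lq (linear_comp (pure_linearr (V := K) _) lK)).
by rewrite tmid_pure !tlift_pure // FE.
Qed.

Lemma bilinear_cl (A : lmodType k) (f : A -> k) :
  scalar f -> bilinear_for *:%R *:%R (fun a b : A => f a *: b).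
Proof. by move=> lf; split=> x /=; lin. Qed.

Lemma bilinear_cr (A : lmodType k) (f : A -> k) :
  scalar f -> bilinear_for *:%R *:%R (fun a b : A => f b *: a).
Proof. by move=> lf; split=> x /=; lin. Qed.

Lemma bilinear_Sl (A : algType k) (f : A -> A) :
  linear f -> bilinear_for *:%R *:%R (fun a b : A => f a * b).
Proof. by move=> lf; split=> x /=; lin. Qed.

Lemma bilinear_Sr (A : algType k) (f : A -> A) :
  linear f -> bilinear_for *:%R *:%R (fun a b : A => a * f b).
Proof. by move=> lf; split=> x /=; lin. Qed.

Lemma pureZZ (c d : k) (a : H) (b : K) : (c *: a) ⊗ (d *: b) = (c * d) *: (a ⊗ b).
Proof.
have /= -> := scalable_linear (pure_linearl (d *: b)) c a.
by have /= -> := scalable_linear (pure_linearr a) d b; rewrite scalerA.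
Qed.

Lemma tcomulel t : \tsum_(x ⊗ y <- tcomul t) tcounit x *: y = t.
Proof.
move: t; apply: (tcontract (bilinear_cl tcounit_linear)
  (bilinear_cl (@counit_linear k H)) (bilinear_cl (@counit_linear k K))
  (@linear_id _ _) (@linear_id _ _)) => [a a' b b'|a b].
  by rewrite tcounit_pure pureZZ.
by rewrite !comulel.
Qed.

Lemma tcomuler t : \tsum_(x ⊗ y <- tcomul t) tcounit y *: x = t.
Proof.
move: t; apply: (tcontract (bilinear_cr tcounit_linear)
  (bilinear_cr (@counit_linear k H)) (bilinear_cr (@counit_linear k K))
  (@linear_id _ _) (@linear_id _ _)) => [a a' b b'|a b].
  by rewrite tcounit_pure pureZZ.
by rewrite !comuler.
Qed.

Lemma tantipodel t : \tsum_(x ⊗ y <- tcomul t) tantipode x * y = tcounit t *: 1.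
Proof.
move: t; apply: (tcontract (bilinear_Sl tantipode_linear)
  (bilinear_Sl laH) (bilinear_Sl laK)
  (linear_scalel _ tcounit_linear) (@linear_id _ _)) => [a a' b b'|a b].
  by rewrite tantipode_pure tmulE.
by rewrite !antipodel pureZZ tcounit_pure.
Qed.

Lemma tantipoder t : \tsum_(x ⊗ y <- tcomul t) x * tantipode y = tcounit t *: 1.
Proof.
move: t; apply: (tcontract (bilinear_Sr tantipode_linear)
  (bilinear_Sr laH) (bilinear_Sr laK)
  (linear_scalel _ tcounit_linear) (@linear_id _ _)) => [a a' b b'|a b].
  by rewrite tantipode_pure tmulE.
by rewrite !antipoder pureZZ tcounit_pure.
Qed.

HB.instance Definition _ := isHopfAlgebra.Build k (H ⊗ K)%type
  tcomul_linear tcounit_linear tantipode_linear tcomul1 tcomulM tcounit1 tcounitM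
  tcomulA tcomulel tcomuler tantipodel tantipoder.

End TensorHopf.

Definition inverses (A : pzRingType) (x y : A) : Prop := x * y = 1 /\ y * x = 1.

Section ModularPair.
Variables (k : comNzRingType) (H : hopfAlgType k).

Definition grouplike (s : H) : Prop := comul s = s ⊗ s /\ counit s = 1.

Definition twisted_antipode (delta : H -> k) (h : H) : H :=
  \tsum_(a ⊗ b <- comul h) delta a *: antipode b.

Record modular_pair := ModularPair {
  mp_char : {lrmorphism H -> k^o};
  mp_elt : H;
  mp_grouplike : grouplike mp_elt;
  mp_char_elt : mp_char mp_elt = 1;
  mp_involution : exists2 tau : H, inverses mp_elt tau &
    forall h, let T x := tau * twisted_antipode mp_char x in T (T h) = h
}.

End ModularPair.

Section Ribbon.
Variables (k : comNzRingType) (H : hopfAlgType k).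

(* The threefold tensor product is H ⊗ (H ⊗ H). *)
Definition leg12 (t : H ⊗ H) : H ⊗ (H ⊗ H) := \tsum_(a ⊗ b <- t) a ⊗ (b ⊗ 1).
Definition leg13 (t : H ⊗ H) : H ⊗ (H ⊗ H) := \tsum_(a ⊗ b <- t) a ⊗ (1 ⊗ b).
Definition leg23 (t : H ⊗ H) : H ⊗ (H ⊗ H) := 1 ⊗ t.

Record quasitriangular (R : H ⊗ H) : Prop := {
  qt_inv : exists Q, inverses R Q;
  qt_comul : forall h, R * comul h = tflip (comul h) * R;
  qt_comull : tassoc (tmap comul id R) = leg13 R * leg23 R;
  qt_comulr : tmap id comul R = leg13 R * leg12 R
}.

Definition drinfeld (R : H ⊗ H) : H := \tsum_(a ⊗ b <- R) antipode b * a.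

Record ribbon := Ribbon {
  rib_R : H ⊗ H;
  rib_theta : H;
  rib_qt : quasitriangular rib_R;
  rib_central : forall h, rib_theta * h = h * rib_theta;
  rib_square : rib_theta ^+ 2 = drinfeld rib_R * antipode (drinfeld rib_R);
  rib_comul : exists2 Q, inverses (tflip rib_R * rib_R) Q &
    comul rib_theta = Q * (rib_theta ⊗ rib_theta);
  rib_counit : counit rib_theta = 1;
  rib_antipode : antipode rib_theta = rib_theta
}.

End Ribbon.

Section Coribbon.
Variables (k : comNzRingType).

Definition conv (H : hopfAlgType k) (f g : H -> k) (h : H) : k :=
  \teval_(a ⊗ b <- comul h) f a * g b.

Definition conv_inverses (H : hopfAlgType k) (f g : H -> k) : Prop :=
  conv f g =1 counit /\ conv g f =1 counit.

Variable (H : hopfAlgType k).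

(* Convolution of functionals on H ⊗ H refers to the tensor product coalgebra. *)
Record coquasitriangular (r : {scalar (H ⊗ H)%type}) : Prop := {
  cqt_inv : exists q : {scalar (H ⊗ H)%type}, conv_inverses r q;
  cqt_mul : forall a b,
    \tsum_(a1 ⊗ a2 <- comul a) \tsum_(b1 ⊗ b2 <- comul b) r (a1 ⊗ b1) *: (a2 * b2) =
    \tsum_(a1 ⊗ a2 <- comul a) \tsum_(b1 ⊗ b2 <- comul b) r (a2 ⊗ b2) *: (b1 * a1);
  cqt_mull : forall a b c,
    r ((a * b) ⊗ c) = \teval_(c1 ⊗ c2 <- comul c) r (a ⊗ c1) * r (b ⊗ c2);
  cqt_mulr : forall a b c,
    r (a ⊗ (b * c)) = \teval_(a1 ⊗ a2 <- comul a) r (a1 ⊗ c) * r (a2 ⊗ b)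
}.

Definition codrinfeld (r : {scalar (H ⊗ H)%type}) (h : H) : k :=
  \teval_(h1 ⊗ h2 <- comul h) r (h2 ⊗ antipode h1).

Record coribbon := Coribbon {
  cor_r : {scalar (H ⊗ H)%type};
  cor_theta : {scalar H};
  cor_cqt : coquasitriangular cor_r;
  cor_central : forall f : {scalar H}, conv cor_theta f =1 conv f cor_theta;
  cor_square : conv cor_theta cor_theta =1
    conv (codrinfeld cor_r) (codrinfeld cor_r \o antipode);
  cor_mul : exists2 q : {scalar (H ⊗ H)%type},
    conv_inverses (conv (cor_r \o @tflip k H H) cor_r) q &
    forall a b, cor_theta (a * b) =
      \teval_(a1 ⊗ a2 <- comul a) \teval_(b1 ⊗ b2 <- comul b)
        q (a1 ⊗ b1) * (cor_theta a2 * cor_theta b2);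
  cor_unit : cor_theta 1 = 1;
  cor_antipode : forall h, cor_theta (antipode h) = cor_theta h
}.

End Coribbon.

(* Hopf algebras presented as iterated tensor products of ribbon and coribbon
   algebras. *)
Inductive rc_structure (k : comNzRingType) : Type :=
| RCRibbon (H : hopfAlgType k) of ribbon H
| RCCoribbon (H : hopfAlgType k) of coribbon H
| RCTensor of rc_structure k & rc_structure k.

Fixpoint rc_alg (k : comNzRingType) (X : rc_structure k) : hopfAlgType k :=
  match X with
  | RCRibbon H _ => H
  | RCCoribbon H _ => H
  | RCTensor Y Z => (rc_alg Y ⊗ rc_alg Z)%type
  end.

Record hopf_iso (k : comNzRingType) (H K : hopfAlgType k) (f : H -> K) : Prop := {
  hopf_iso_bij : bijective f;
  hopf_iso_linear : linear f;
  hopf_iso1 : f 1 = 1;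
  hopf_isoM : {morph f : a b / a * b};
  hopf_iso_counit : forall h, counit (f h) = counit h;
  hopf_iso_comul : forall h, comul (f h) = tmap f f (comul h)
}.

Inductive rc_iso (k : comNzRingType) :
    forall X Y : rc_structure k, (rc_alg X -> rc_alg Y) -> Prop :=
| RCIsoRibbon (H K : hopfAlgType k) (s : ribbon H) (t : ribbon K) (f : H -> K) :
    hopf_iso f -> tmap f f (rib_R s) = rib_R t -> f (rib_theta s) = rib_theta t ->
    rc_iso (X := RCRibbon s) (Y := RCRibbon t) f
| RCIsoCoribbon (H K : hopfAlgType k) (s : coribbon H) (t : coribbon K)
    (f : H -> K) :
    hopf_iso f -> (forall a b, cor_r t (f a ⊗ f b) = cor_r s (a ⊗ b)) ->
    (forall h, cor_theta t (f h) = cor_theta s h) ->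
    rc_iso (X := RCCoribbon s) (Y := RCCoribbon t) f
| RCIsoTensor (X Y X' Y' : rc_structure k)
    (f : rc_alg X -> rc_alg X') (g : rc_alg Y -> rc_alg Y') :
    rc_iso f -> rc_iso g ->
    rc_iso (X := RCTensor X Y) (Y := RCTensor X' Y') (tmap f g).

Section CompactQuantumGroup.
Variables (R : realType) (H : hopfAlgType R[i]).

(* The condition star_comul, that comul (star h) is the image of comul h under
   star ⊗ star, is stated on representatives because star is antilinear. *)
Record hopf_star (star : H -> H) : Prop := {
  star_antilinear : forall (c : R[i]) (a b : H),
    star (c *: a + b) = conjc c *: star a + star b;
  starK : involutive star;
  starM : forall a b, star (a * b) = star b * star a;
  star_comul : forall h (s : seq (H * H)),
    comul h = \sum_(p <- s) p.1 ⊗ p.2 ->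
    comul (star h) = \sum_(p <- s) star p.1 ⊗ star p.2
}.

Record unitary_corep (star : H -> H) (n : nat) (v : 'M[H]_n) : Prop := {
  ucorep_comul : forall i j, comul (v i j) = \sum_l v i l ⊗ v l j;
  ucorep_counit : forall i j, counit (v i j) = (i == j)%:R;
  ucorepV : v *m (map_mx star v)^T = 1%:M;
  ucorepVl : (map_mx star v)^T *m v = 1%:M
}.

Definition unitary_coefficient (star : H -> H) (a : H) : Prop :=
  exists n (v : 'M[H]_n) i j, unitary_corep star v /\ a = v i j.

Record cqg := CQG {
  cqg_star : H -> H;
  cqg_starP : hopf_star cqg_star;
  cqg_span : forall h, exists2 s : seq (R[i] * H),
    forall p, p \in s -> unitary_coefficient cqg_star p.2 &
    h = \sum_(p <- s) p.1 *: p.2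
}.

End CompactQuantumGroup.

Definition cqg_iso (R : realType) (H K : hopfAlgType R[i]) (s : cqg H) (t : cqg K)
    (f : H -> K) : Prop :=
  hopf_iso f /\ forall h, f (cqg_star s h) = cqg_star t (f h).

(* A choice of modular pairs is canonical, i.e. determined by the given structure,
   when every isomorphism of structures transports one pair to the other. *)
Definition mp_transport (k : comNzRingType) (H K : hopfAlgType k) (f : H -> K)
    (p : modular_pair H) (q : modular_pair K) : Prop :=
  (forall h, mp_char q (f h) = mp_char p h) /\ mp_elt q = f (mp_elt p).

(* Main.v *)
Require Import Defs.
From HB Require Import structures.
From mathcomp Require Import all_boot all_order all_algebra.
From mathcomp Require Import boolp classical_sets reals.
From mathcomp Require Import complex.

Set Implicit Arguments.
Unset Strict Implicit.
Unset Printing Implicit Defensive.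

Import GRing.Theory.
Local Open Scope ring_scope.

(* In the ribbon case the pair is (epsilon, u theta^-1): u implements S^2 and
   Delta(u) R21 R = u (x) u, so u theta^-1 is group-like.  The coribbon case is
   dual: sigma = 1 and delta = (u * theta^-1) o S.  Pairs multiply under tensor
   products.
   For a compact quantum group sigma = 1 and delta is one of Woronowicz's
   characters.  The Haar functional h sends a unitary corepresentation matrix to
   the projection onto its invariant vectors.  It is faithful and has a modular automorphism sig,
   h (a x) = h (x sig a).  With f = epsilon o sig, the operators
   L a = a_1 f(a_2) and R a = f(a_1) a_2 satisfy sig = S^2 L and R = S^4 L, are
   self-adjoint for h (b^* a) and have finite-dimensional orbits, so H is spanned by
   joint eigenvectors, with positive eigenvalues.  On them S^2 R^(-1/2) = L^(-1/2),
   which is the identity delta(a_1) S^2(a_2) = a_1 delta(a_2) for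
   delta = epsilon o L^(-1/2); for a character delta, this makes the twisted
   antipode involutive. *)

(** * Multilinear maps out of tensor products *)

(** When sigma = 1, everything rests on delta(a_1) S^2(a_2) = a_1 delta(a_2). The functional u *
    theta^-1 satisfies the mirror image of this exchange, so its convolution inverse is taken; this
    is the origin of the S in the coribbon character. The compact case avoids decomposing
    corepresentations into irreducibles. For positivity of h, any element is a single matrix element
    of a large unitary corepresentation, and the eigenvalues of the resulting Gram matrix are
    quotients of sums of squares. The modular automorphism is read off from an averaged intertwiner
    between v and S^2(v). The relation R = S^4 L only gives the square of S^2 on a joint
    eigenvector; positivity of S^2 picks the root. The coproduct does not respect the chosen
    eigenvectors, so recognising L^(-1/2) as a convolution with delta needs functional calculus on
    one tensor factor. Canonicity follows from uniqueness at each stage: inverses of theta, the Haar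
    functional, its modular automorphism, and a character prescribed on eigenvectors. *)

Section Multilinear.
Variable k : comNzRingType.

(* A head constant on which the tactic mlin can match. *)
Definition lin1 (U V : lmodType k) (f : U -> V) := linear f.
Definition lin2 (U V W : lmodType k) (f : U -> V -> W) :=
  (forall v, lin1 (fun u => f u v)) /\ (forall u, lin1 (f u)).
Definition lin3 (U V W X : lmodType k) (f : U -> V -> W -> X) :=
  [/\ forall v w, lin1 (fun u => f u v w), forall u w, lin1 (fun v => f u v w)
    & forall u v, lin1 (f u v)].

Lemma lin1_id (U : lmodType k) : lin1 (fun x : U => x). Proof. by []. Qed.

Lemma lin1_comp (U V W : lmodType k) (f : V -> W) (g : U -> V) :
  lin1 f -> lin1 g -> lin1 (fun x => f (g x)).
Proof. by move=> lf lg a x y; rewrite lg lf. Qed.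

Lemma lin2_compl (U V W X : lmodType k) (f : V -> W -> X) (g : U -> V) w :
  lin2 f -> lin1 g -> lin1 (fun x => f (g x) w).
Proof. by move=> [lf _] lg; exact: (lin1_comp (lf w) lg). Qed.

Lemma lin2_compr (U V W X : lmodType k) (f : V -> W -> X) v (g : U -> W) :
  lin2 f -> lin1 g -> lin1 (fun x => f v (g x)).
Proof. by move=> [_ lf] lg; exact: (lin1_comp (lf v) lg). Qed.

Lemma lin3_comp1 (T U V W X : lmodType k) (f : U -> V -> W -> X) (g : T -> U) v w :
  lin3 f -> lin1 g -> lin1 (fun x => f (g x) v w).
Proof. by move=> [lf _ _] lg; exact: (lin1_comp (lf v w) lg). Qed.
Lemma lin3_comp2 (T U V W X : lmodType k) (f : U -> V -> W -> X) u (g : T -> V) w :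
  lin3 f -> lin1 g -> lin1 (fun x => f u (g x) w).
Proof. by move=> [_ lf _] lg; exact: (lin1_comp (lf u w) lg). Qed.
Lemma lin3_comp3 (T U V W X : lmodType k) (f : U -> V -> W -> X) u v (g : T -> W) :
  lin3 f -> lin1 g -> lin1 (fun x => f u v (g x)).
Proof. by move=> [_ _ lf] lg; exact: (lin1_comp (lf u v) lg). Qed.

Lemma lin2_mul (A : algType k) : lin2 (@GRing.mul A).
Proof.
by split=> b a x y; [rewrite mulrDl scalerAl | rewrite mulrDr scalerAr].
Qed.
Lemma lin2_kmul : @lin2 k^o k^o k^o (@GRing.mul k).
Proof.
by split=> b a x y; [rewrite mulrDl -mulrA | rewrite mulrDr mulrCA].
Qed.
Lemma lin2_scale (V : lmodType k) : @lin2 k^o V V (@GRing.scale k V).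
Proof.
by split=> b a x y; [rewrite scalerDl scalerA | rewrite scalerDr !scalerA mulrC].
Qed.
Lemma lin2_pure (U V : lmodType k) : lin2 (@pure k U V).
Proof. by split=> [v|u]; [exact: pure_linearl | exact: pure_linearr]. Qed.
Lemma lin2_tmul (A B : algType k) : lin2 (@tmul k A B).
Proof. by split=> [t|s]; [exact: tmul_linearl | exact: tmul_linearr]. Qed.
Lemma lin1_scalar (U : lmodType k) (f : {scalar U}) : @lin1 U k^o f.
Proof. exact: linearP. Qed.
Lemma lin1_linear (U V : lmodType k) (f : {linear U -> V}) : lin1 f.
Proof. exact: linearP. Qed.

Lemma lin2_bil (U V W : lmodType k) (f : U -> V -> W) :
  lin2 f <-> bilinear_for *:%R *:%R f.
Proof. by split=> -[]; split. Qed.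

Lemma lin1_tlift (U V W : lmodType k) (f : U -> V -> W) :
  lin2 f -> lin1 (tlift f).
Proof. by move/lin2_bil; exact: tlift_linear. Qed.

Lemma lin1_tliftf (U V W X : lmodType k) (F : X -> U -> V -> W) (t : U ⊗ V) :
  (forall u v, lin1 (fun x => F x u v)) -> lin1 (fun x => tlift (F x) t).
Proof. exact: tlift_linearf. Qed.

Lemma lin1_0 (U V : lmodType k) (f : U -> V) : lin1 f -> f 0 = 0.
Proof. by move=> lf; have := lf (-1) 0 0; rewrite scaler0 add0r scaleN1r addNr. Qed.
Lemma lin1D (U V : lmodType k) (f : U -> V) x y : lin1 f -> f (x + y) = f x + f y.
Proof. by move=> lf; have := lf 1 x y; rewrite !scale1r. Qed.
Lemma lin1Z (U V : lmodType k) (f : U -> V) a x : lin1 f -> f (a *: x) = a *: f x.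
Proof. by move=> lf; have := lf a x 0; rewrite (lin1_0 lf) !addr0. Qed.
Lemma lin1N (U V : lmodType k) (f : U -> V) x : lin1 f -> f (- x) = - f x.
Proof. by move=> lf; rewrite -[- x]scaleN1r lin1Z // scaleN1r. Qed.
Lemma lin1B (U V : lmodType k) (f : U -> V) x y : lin1 f -> f (x - y) = f x - f y.
Proof. by move=> lf; rewrite lin1D // lin1N. Qed.
Lemma lin1_sum (U V : lmodType k) (f : U -> V) I (s : seq I) (P : pred I) (F : I -> U) :
  lin1 f -> f (\sum_(i <- s | P i) F i) = \sum_(i <- s | P i) f (F i).
Proof.
move=> lf; elim/big_rec2: _ => [|i y z _ <-]; first exact: lin1_0.
exact: lin1D.
Qed.

Lemma lin1_comb (U V : lmodType k) (f g : U -> V) c :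
  lin1 f -> lin1 g -> lin1 (fun x => c *: f x + g x).
Proof.
move=> lf lg a x y; rewrite lf lg !scalerDr !scalerA addrACA [c * a]mulrC.
by [].
Qed.
Lemma lin1_sub (U V : lmodType k) (f g : U -> V) :
  lin1 f -> lin1 g -> lin1 (fun x => f x - g x).
Proof. by move=> lf lg a x y; rewrite lf lg opprD addrACA scalerBr. Qed.
Lemma lin1_cst0 (U V : lmodType k) : lin1 (fun _ : U => 0 : V).
Proof. by move=> a x y; rewrite scaler0 addr0. Qed.

Lemma eq_tlift (U V W : lmodType k) (f g : U -> V -> W) t :
  (forall a b, f a b = g a b) -> tlift f t = tlift g t.
Proof. by move=> e; apply: eq_bigr => p _; rewrite e. Qed.

Lemma tlift_pureE (U V W : lmodType k) (f : U -> V -> W) u v :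
  lin2 f -> tlift f (u ⊗ v) = f u v.
Proof. by move/lin2_bil=> bf; rewrite tlift_pure. Qed.

(** Each [tlift] is a finite sum over a chosen representative, so independent contractions commute
    like finite sums. *)
Lemma tlift_exchange (U V U' V' W : lmodType k) (F : U -> V -> U' -> V' -> W) t t' :
  \tsum_(a ⊗ b <- t) \tsum_(c ⊗ d <- t') F a b c d =
  \tsum_(c ⊗ d <- t') \tsum_(a ⊗ b <- t) F a b c d.
Proof. by rewrite /tlift /fsum exchange_big. Qed.

Lemma tlift_exchange2 (U V U1 V1 U' V' W : lmodType k) (f : U -> V -> U1 ⊗ V1)
    (F : U -> V -> U1 -> V1 -> U' -> V' -> W) t t' :
  \tsum_(a ⊗ b <- t) \tsum_(a1 ⊗ b1 <- f a b) \tsum_(c ⊗ d <- t') F a b a1 b1 c d =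
  \tsum_(c ⊗ d <- t') \tsum_(a ⊗ b <- t) \tsum_(a1 ⊗ b1 <- f a b) F a b a1 b1 c d.
Proof.
rewrite [RHS]tlift_exchange; apply: eq_tlift => a b.
by rewrite [RHS]tlift_exchange.
Qed.

Lemma tlift_sumf (U V W : lmodType k) I (s : seq I) (F : I -> U -> V -> W) t :
  \tsum_(a ⊗ b <- t) \sum_(i <- s) F i a b = \sum_(i <- s) \tsum_(a ⊗ b <- t) F i a b.
Proof. by rewrite /tlift /fsum exchange_big. Qed.

Lemma lin1_tliftE (U V W X : lmodType k) (f : U -> V -> W) (g : W -> X) t :
  lin1 g -> g (tlift f t) = \tsum_(a ⊗ b <- t) g (f a b).
Proof. by move=> lg; rewrite /tlift /fsum lin1_sum. Qed.

Lemma tlift_sum (U V W : lmodType k) (f : U -> V -> W) I (s : seq I) (P : pred I)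
    (F : I -> U ⊗ V) :
  lin2 f -> tlift f (\sum_(i <- s | P i) F i) = \sum_(i <- s | P i) tlift f (F i).
Proof. by move=> bf; rewrite lin1_sum //; exact: lin1_tlift. Qed.

Lemma tlift_sum_pure (U V W : lmodType k) (f : U -> V -> W) I (s : seq I) (P : pred I)
    (F : I -> U) (G : I -> V) :
  lin2 f -> tlift f (\sum_(i <- s | P i) F i ⊗ G i) = \sum_(i <- s | P i) f (F i) (G i).
Proof.
by move=> bf; rewrite tlift_sum //; apply: eq_bigr => i _; rewrite tlift_pureE.
Qed.

Lemma tlift_pure_id (U V : lmodType k) (t : U ⊗ V) : tlift (@pure k U V) t = t.
Proof. by rewrite {2}[t]tensor_sum. Qed.

Lemma tlift_comp (U V U' V' W : lmodType k) (f : U' -> V' -> W)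
    (g : U -> V -> U' ⊗ V') t :
  lin2 f -> tlift f (tlift g t) = \tsum_(a ⊗ b <- t) tlift f (g a b).
Proof. by move=> bf; rewrite lin1_tliftE //; exact: lin1_tlift. Qed.

Lemma tlift_tmap (U V U' V' W : lmodType k) (f : U' -> V' -> W)
    (g : U -> U') (h : V -> V') t : lin2 f ->
  tlift f (tmap g h t) = \tsum_(a ⊗ b <- t) f (g a) (h b).
Proof. by move=> bf; rewrite tlift_comp //; apply: eq_tlift => a b; rewrite tlift_pureE. Qed.

Lemma tlift_tflip (U V W : lmodType k) (f : V -> U -> W) (t : U ⊗ V) : lin2 f ->
  tlift f (tflip t) = \tsum_(a ⊗ b <- t) f b a.
Proof. by move=> bf; rewrite tlift_comp //; apply: eq_tlift => a b; rewrite tlift_pureE. Qed.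

Lemma tensor_ext1 (U V W : lmodType k) (f g : U ⊗ V -> W) :
  lin1 f -> lin1 g -> (forall u v, f (u ⊗ v) = g (u ⊗ v)) -> f =1 g.
Proof. exact: tensor_ext. Qed.

End Multilinear.

Arguments lin1_tliftE {k U V W X f} g {t}.
Arguments lin1Z {k U V f a x}.
Arguments lin1D {k U V f x y}.
Arguments lin1N {k U V f x}.
Arguments lin1B {k U V f x y}.
Arguments lin1_sum {k U V f I s P F}.

Ltac lin_leaf :=
  first
  [ assumption
  | exact: comul_linear | exact: antipode_linear | exact: counit_linear
  | exact: lin1_scalar | exact: lin1_linear
  | solve [auto] ].

Ltac lin2_leaf :=
  first
  [ exact: lin2_mul | exact: lin2_scale | exact: lin2_kmul | exact: lin2_pure
  | exact: lin2_tmul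
  | assumption | solve [auto] ].

(** Peels the head off the body of [fun x => ...] until a leaf is reached. Scaling and the product
    of the base ring come before the generic cases, with [k^o] supplied by hand as the module of
    scalars. *)
Ltac mlin :=
  lazymatch goal with
  | |- lin3 _ => split=> ? ? /=; mlin
  | |- lin2 _ => first [lin2_leaf | split=> ? /=; mlin]
  | |- lin1 (tlift _) => apply: lin1_tlift; mlin
  | |- lin1 (fun x => x) => exact: lin1_id
  | |- lin1 _ =>
    first
    [ lin_leaf
    | lazymatch goal with
      | |- lin1 (fun x => _) => fail
      | |- @lin1 ?k ?U ?W ?f => change (@lin1 k U W (fun x => f x)); mlin
      end
    | lazymatch goal with
      | |- @lin1 ?k ?U ?W (fun x => @tlift _ ?A ?B ?C ?F (@?g x)) =>
         apply: (@lin1_comp k U _ _ (@tlift k A B C F) g);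
         [apply: lin1_tlift; mlin | mlin]
      end
    | lazymatch goal with
      | |- @lin1 ?k ?U ?W (fun x => @tlift _ ?A ?B ?C (@?F x) ?t) =>
         apply: (@lin1_tliftf k A B C U F t) => ? ? /=; mlin
      end
    | match goal with
      | |- lin1 (fun x => @GRing.scale ?k ?V (@?g x) ?v) =>
          apply: (@lin2_compl k _ k^o V V (@GRing.scale k V) g v);
          [exact: lin2_scale | mlin]
      | |- @lin1 ?k _ _ (fun x => @GRing.mul _ (@?g x) ?v) =>
          apply: (@lin2_compl k _ k^o k^o k^o (@GRing.mul k) g v);
          [exact: lin2_kmul | mlin]
      | |- @lin1 ?k _ _ (fun x => @GRing.mul _ ?v (@?g x)) =>
          apply: (@lin2_compr k _ k^o k^o k^o (@GRing.mul k) v g);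
          [exact: lin2_kmul | mlin]
      | |- @lin1 ?k ?U ?W (fun x => ?F ?a (@?g x)) =>
          apply: (@lin2_compr k U _ _ W F a g); [lin2_leaf | mlin]
      | |- @lin1 ?k ?U ?W (fun x => ?F (@?g x) ?b) =>
          apply: (@lin2_compl k U _ _ W F g b); [lin2_leaf | mlin]
      | |- @lin1 ?k ?U ?W (fun x => ?F ?a ?b (@?g x)) =>
          apply: (@lin3_comp3 k U _ _ _ W F a b g); [lin_leaf | mlin]
      | |- @lin1 ?k ?U ?W (fun x => ?F ?a (@?g x) ?b) =>
          apply: (@lin3_comp2 k U _ _ _ W F a g b); [lin_leaf | mlin]
      | |- @lin1 ?k ?U ?W (fun x => ?F (@?g x) ?a ?b) =>
          apply: (@lin3_comp1 k U _ _ _ W F g a b); [lin_leaf | mlin]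
      | |- @lin1 ?k ?U ?W (fun x => ?f (@?g x)) =>
          apply: (@lin1_comp k U _ W f g); [lin_leaf | mlin]
      end ]
  end.

(** * Hopf algebra identities *)

Section HopfBasics.
Variables (k : comNzRingType) (H : hopfAlgType k).
Implicit Types (h : H) (W : lmodType k).

Lemma counitl W (G : H -> W) h : lin1 G ->
  \tsum_(a ⊗ b <- comul h) counit a *: G b = G h.
Proof.
move=> lG; rewrite -[in RHS](comulel h) lin1_tliftE //.
by apply: eq_tlift => a b; rewrite lin1Z.
Qed.

Lemma counitr W (G : H -> W) h : lin1 G ->
  \tsum_(a ⊗ b <- comul h) counit b *: G a = G h.
Proof.
move=> lG; rewrite -[in RHS](comuler h) lin1_tliftE //.
by apply: eq_tlift => a b; rewrite lin1Z.
Qed.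

(** Sweedler's rule: both nestings denote the same threefold coproduct h_1, h_2, h_3. Most rewrites
    below change the nesting through an explicit [F]. *)
Lemma coassoc W (F : H -> H -> H -> W) h : lin3 F ->
  \tsum_(a ⊗ c <- comul h) \tsum_(a1 ⊗ a2 <- comul a) F a1 a2 c =
  \tsum_(a ⊗ c <- comul h) \tsum_(c1 ⊗ c2 <- comul c) F a c1 c2.
Proof.
move=> lF; pose G a t := tlift (F a) t.
have lG : lin2 G by rewrite /G; mlin.
have := congr1 (tlift G) (comulA h); rewrite tlift_tmap // => <-.
rewrite /tassoc tlift_comp // tlift_tmap; last by mlin.
apply: eq_tlift => a b; rewrite tlift_comp //; apply: eq_tlift => a1 a2.
by rewrite tlift_pureE // /G tlift_pureE //; mlin.
Qed.

Lemma antipodelW W (G : H -> W) h : lin1 G ->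
  \tsum_(a ⊗ b <- comul h) G (antipode a * b) = counit h *: G 1.
Proof. by move=> lG; rewrite -lin1_tliftE // antipodel lin1Z. Qed.

Lemma antipoderW W (G : H -> W) h : lin1 G ->
  \tsum_(a ⊗ b <- comul h) G (a * antipode b) = counit h *: G 1.
Proof. by move=> lG; rewrite -lin1_tliftE // antipoder lin1Z. Qed.

(** Read from right to left, this inserts a cancelling pair S(h_1) h_2 into an expression in h; the
    variants below serve the same purpose. *)
Lemma antipodel_cancel W (G : H -> H -> W) h : lin2 G ->
  \tsum_(a ⊗ t <- comul h) \tsum_(b ⊗ c <- comul t) G (antipode a * b) c = G 1 h.
Proof.
move=> lG; rewrite -(coassoc (F := fun a b c => G (antipode a * b) c)); last by mlin.
rewrite -(counitl (G := G 1)); last by mlin.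
by apply: eq_tlift => a c; rewrite (antipodelW (G := G^~ c)) //; mlin.
Qed.

Lemma antipoder_cancel W (G : H -> H -> W) h : lin2 G ->
  \tsum_(a ⊗ t <- comul h) \tsum_(b ⊗ c <- comul t) G (a * antipode b) c = G 1 h.
Proof.
move=> lG; rewrite -(coassoc (F := fun a b c => G (a * antipode b) c)); last by mlin.
rewrite -(counitl (G := G 1)); last by mlin.
by apply: eq_tlift => a c; rewrite (antipoderW (G := G^~ c)) //; mlin.
Qed.

Lemma antipoder_cancelr W (G : H -> H -> W) h : lin2 G ->
  \tsum_(a ⊗ t <- comul h) \tsum_(b ⊗ c <- comul t) G a (b * antipode c) = G h 1.
Proof.
move=> lG; rewrite -(counitr (G := G^~ 1)); last by mlin.
by apply: eq_tlift => a c; rewrite (antipoderW (G := G a)) //; mlin.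
Qed.

(** l = l * (f * r) = (l * f) * r = r in the convolution algebra. Identities for the antipode are
    obtained by exhibiting both sides as inverses of one map. *)
Lemma convolution_inverse_unique (A : algType k) (l f r : H -> A) :
    lin1 l -> lin1 f -> lin1 r ->
    (forall h, \tsum_(a ⊗ b <- comul h) l a * f b = counit h *: 1) ->
    (forall h, \tsum_(a ⊗ b <- comul h) f a * r b = counit h *: 1) ->
  l =1 r.
Proof.
move=> ll lf lr lf1 fr1 h.
rewrite -[LHS](counitr (G := l)) //.
transitivity (\tsum_(a ⊗ c <- comul h) \tsum_(c1 ⊗ c2 <- comul c) l a * f c1 * r c2).
  apply: eq_tlift => a c; rewrite -[in LHS](mulr1 (l a)) scalerAr -fr1 (lin1_tliftE (fun x => l a * x)); last by mlin.
  by apply: eq_tlift => c1 c2; rewrite mulrA.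
rewrite -(coassoc (F := fun a b c => l a * f b * r c)); last by mlin.
rewrite -[RHS](counitl (G := r)) //; apply: eq_tlift => a c.
rewrite -[in RHS](mul1r (r c)) scalerAl -lf1 [RHS](lin1_tliftE (fun x => x * r c)) //.
by mlin.
Qed.

Lemma comul_tensorE (K : hopfAlgType k) W (F : (H ⊗ K)%type -> (H ⊗ K)%type -> W) a b :
  lin2 F -> tlift F (comul (a ⊗ b)) =
  \tsum_(a1 ⊗ a2 <- comul a) \tsum_(b1 ⊗ b2 <- comul b) F (a1 ⊗ b1) (a2 ⊗ b2).
Proof.
move=> lF; rewrite [comul _]tcomul_pure /tmid tlift_comp //; apply: eq_tlift => a1 a2.
by rewrite tlift_comp //; apply: eq_tlift => b1 b2; rewrite tlift_pureE.
Qed.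

Lemma comulMW W (F : H -> H -> W) a b : lin2 F ->
  tlift F (comul (a * b)) =
  \tsum_(a1 ⊗ a2 <- comul a) \tsum_(b1 ⊗ b2 <- comul b) F (a1 * b1) (a2 * b2).
Proof.
move=> lF; rewrite comulM -[comul a * _]/(tmul _ _) /tmul tlift_comp //.
apply: eq_tlift => a1 a2; rewrite tlift_comp //; apply: eq_tlift => b1 b2.
by rewrite tlift_pureE.
Qed.

Lemma antipode1 : antipode 1 = 1 :> H.
Proof.
have := antipodel (1 : H); rewrite comul1 tlift_pureE; last by mlin.
by rewrite mulr1 counit1 scale1r.
Qed.

Lemma counit_antipode h : counit (antipode h) = counit h.
Proof.
have lc : lin1 (@counit k H : H -> k^o) by exact: counit_linear.
have /= := congr1 (@counit k H) (antipodel h).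
rewrite (lin1Z lc) counit1 -[_ *: _]/(_ * _) mulr1 => <-.
rewrite (lin1_tliftE (X := k^o) _ lc).
rewrite -[LHS](counitr (W := k^o) (G := fun x => counit (antipode x))); last by mlin.
by apply: (@eq_tlift _ _ _ k^o) => a b; rewrite counitM mulrC.
Qed.

End HopfBasics.

Section Antipode.
Variables (k : comNzRingType) (H : hopfAlgType k).
Implicit Types (h : H) (W : lmodType k).

(** Both sides, as maps from H ⊗ H to H, are convolution inverses of the multiplication. *)
Lemma antipodeM a b : antipode (a * b) = antipode b * antipode a :> H.
Proof.
pose m := @tlift k H H H *%R.
have lm : lin1 m by rewrite /m; mlin.
pose l t := antipode (m t); pose r := @tlift k H H H (fun a b => antipode b * antipode a).
have ll : lin1 l by rewrite /l; mlin.
have lr : lin1 r by rewrite /r; mlin.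
have mE x y : m (x ⊗ y) = x * y by rewrite /m tlift_pureE //; mlin.
have rE x y : r (x ⊗ y) = antipode y * antipode x by rewrite /r tlift_pureE //; mlin.
have lcu : lin1 (fun t : (H ⊗ H)%type => counit t *: (1 : H)) by mlin.
have cuE x y : counit (x ⊗ y : (H ⊗ H)%type) = counit x * counit y by exact: tcounit_pure.
suff /(_ (a ⊗ b)) : l =1 r by rewrite /l mE rE.
apply: (@convolution_inverse_unique k (H ⊗ H)%type H l m r) => //.
  apply: tensor_ext1 => // [|x y]; first by mlin.
  rewrite comul_tensorE; last by mlin.
  rewrite cuE -counitM -antipodel comulMW; last by mlin.
  by apply: eq_tlift => x1 x2; apply: eq_tlift => y1 y2; rewrite /l !mE.
apply: tensor_ext1 => // [|x y]; first by mlin.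
rewrite comul_tensorE; last by mlin.
rewrite cuE -scalerA -[RHS]/(counit x *: (fun z => counit y *: z) 1).
rewrite -antipoderW; last by mlin.
apply: eq_tlift => x1 x2.
transitivity (\tsum_(y1 ⊗ y2 <- comul y) (x1 * (y1 * antipode y2) * antipode x2)).
  by apply: eq_tlift => y1 y2; rewrite mE rE !mulrA.
rewrite (antipoderW (G := fun z => x1 * z * antipode x2)) ?mulr1 //; mlin.
Qed.

(** Both sides, as maps from H to H ⊗ H, are convolution inverses of the coproduct. *)
Lemma comul_antipode h : comul (antipode h) =
  \tsum_(a ⊗ b <- comul h) antipode b ⊗ antipode a.
Proof.
pose l h := comul (antipode h : H).
pose r (h : H) := \tsum_(a ⊗ b <- comul h) antipode b ⊗ antipode a.
have ll : lin1 l by rewrite /l; mlin.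
have lr : lin1 r by rewrite /r; mlin.
have lc : lin1 (@comul k H) by exact: comul_linear.
have mulE (x y : (H ⊗ H)%type) : x * y = tmul x y by [].
have lm2 : lin2 (@tmul k H H).
  by split=> x; [exact: tmul_linearl | exact: tmul_linearr].
suff : l =1 r by apply.
apply: (convolution_inverse_unique ll lc lr) => {}h.
  transitivity (comul (counit h *: (1 : H))); last by rewrite (lin1Z lc) comul1.
  rewrite -antipodel (lin1_tliftE _ lc).
  by apply: eq_tlift => a b; rewrite comulM.
transitivity (\tsum_(a ⊗ c <- comul h) \tsum_(c1 ⊗ c2 <- comul c)
   \tsum_(a1 ⊗ a2 <- comul a) (a1 * antipode c2) ⊗ (a2 * antipode c1)).
  apply: eq_tlift => a c; rewrite /r mulE.
  rewrite (lin1_tliftE (tmul (comul a))); last by mlin.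
  apply: eq_tlift => c1 c2; rewrite -[in LHS](tlift_pure_id (comul a)).
  rewrite (lin1_tliftE (fun x => tmul x (antipode c2 ⊗ antipode c1))); last by mlin.
  by apply: eq_tlift => a1 a2; rewrite tmul_pure.
(* In Sweedler notation, h_1 S(h_4) ⊗ h_2 S(h_3): only the nesting changes until the inner pair h_2
   S(h_3) collapses, then the outer one. *)
transitivity (\tsum_(a ⊗ c <- comul h) \tsum_(c1 ⊗ c2 <- comul c)
   \tsum_(d1 ⊗ d2 <- comul c1) (a * antipode c2) ⊗ (d1 * antipode d2)); last first.
  transitivity (\tsum_(a ⊗ b <- comul h) ((a * antipode b) ⊗ (1 : H))).
    apply: eq_tlift => a c.
    rewrite -(counitl (G := fun z => (a * antipode z) ⊗ (1 : H))); last by mlin.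
    apply: eq_tlift => c1 c2.
    by rewrite (antipoderW (G := pure (a * antipode c2))) //; mlin.
  by rewrite (antipoderW (G := fun z => z ⊗ (1 : H))) //; mlin.
transitivity (\tsum_(a ⊗ c <- comul h) \tsum_(c1 ⊗ c2 <- comul c)
   \tsum_(d1 ⊗ d2 <- comul c2) (a * antipode d2) ⊗ (c1 * antipode d1)); last first.
  apply: eq_tlift => a c.
  by rewrite -(coassoc (F := fun x y z => (a * antipode z) ⊗ (x * antipode y))) //; mlin.
rewrite -(coassoc (F := fun a c1 c =>
   \tsum_(d1 ⊗ d2 <- comul c) ((a * antipode d2) ⊗ (c1 * antipode d1)))); last by mlin.
by apply: eq_tlift => a c; rewrite tlift_exchange.
Qed.

Lemma comul_antipodeW W (F : H -> H -> W) h : lin2 F ->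
  tlift F (comul (antipode h)) =
  \tsum_(a ⊗ b <- comul h) F (antipode b) (antipode a).
Proof.
move=> lF; rewrite comul_antipode tlift_comp //.
by apply: eq_tlift => a b; rewrite tlift_pureE.
Qed.

End Antipode.

(** Both f o S and S o f are convolution inverses of f. *)
Lemma hopf_iso_antipode (k : comNzRingType) (H K : hopfAlgType k) (f : H -> K) h :
  hopf_iso f -> f (antipode h) = antipode (f h).
Proof.
move=> hf; have lf : lin1 f by exact: hopf_iso_linear.
move: h; apply: (@convolution_inverse_unique k H K (fun h => f (antipode h)) f) => //.
- by mlin.
- by mlin.
- move=> h; rewrite -(hopf_iso1 hf) -(lin1Z lf) -antipodel (lin1_tliftE _ lf).
  by apply: eq_tlift => a b; rewrite (hopf_isoM hf).
move=> h; rewrite -(hopf_iso_counit hf) -antipoder (hopf_iso_comul hf) tlift_tmap //.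
by mlin.
Qed.

(** * Characters and modular pairs *)

Section Character.
Variables (k : comNzRingType) (H : hopfAlgType k) (d : H -> k).

Definition is_character := [/\ @lin1 _ H k^o d, d 1 = 1 & {morph d : a b / a * b}].

Hypothesis dP : is_character.

Let d_lin : scalar d. Proof. by case: dP. Qed.
Let d_mon : monoid_morphism (d : H -> k^o). Proof. by case: dP. Qed.

Definition character_of : {lrmorphism H -> k^o} :=
  HB.pack (d : H -> k^o) (GRing.isLinear.Build k H k^o *:%R d d_lin)
    (GRing.isMonoidMorphism.Build H k^o d d_mon).

Lemma character_ofE h : character_of h = d h. Proof. by []. Qed.

Lemma character_antipodel h :
  @tlift k H H k^o (fun a b => d (antipode a) * d b) (comul h) = counit h.
Proof.
case: dP => ld d1 dM; transitivity (d (counit h *: 1)).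
  rewrite -antipodel (lin1_tliftE (X := k^o) _ ld).
  by apply: (@eq_tlift _ _ _ k^o) => a b; rewrite dM.
by rewrite (lin1Z ld) d1 -[_ *: _]/(_ * _) mulr1.
Qed.

Lemma character_antipoder h :
  @tlift k H H k^o (fun a b => d a * d (antipode b)) (comul h) = counit h.
Proof.
case: dP => ld d1 dM; transitivity (d (counit h *: 1)).
  rewrite -antipoder (lin1_tliftE (X := k^o) _ ld).
  by apply: (@eq_tlift _ _ _ k^o) => a b; rewrite dM.
by rewrite (lin1Z ld) d1 -[_ *: _]/(_ * _) mulr1.
Qed.

(** Twice the twisted antipode is d(h_1) d(S(h_3)) S^2(h_2). The hypothesis turns this into d(h_2)
    d(S(h_3)) h_1, where d and d o S cancel. *)
Lemma twisted_antipode_involutive h :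
  (forall h, \tsum_(a ⊗ b <- comul h) d a *: antipode (antipode b) =
             \tsum_(a ⊗ b <- comul h) d b *: a) ->
  twisted_antipode d (twisted_antipode d h) = h.
Proof.
case: (dP) => ld d1 dM e; rewrite /twisted_antipode.
set T := fun h : H => \tsum_(a ⊗ b <- comul h) d a *: antipode b.
have lT : lin1 T by rewrite /T; mlin.
rewrite -/(T _) (lin1_tliftE T) //.
transitivity (\tsum_(a ⊗ c <- comul h) \tsum_(a1 ⊗ a2 <- comul a)
   (d a1 * d (antipode c)) *: antipode (antipode a2)).
  rewrite (coassoc (F := fun x y z => (d x * d (antipode z)) *: antipode (antipode y))).
    apply: eq_tlift => a b; rewrite (lin1Z lT) /T comul_antipodeW; last by mlin.
    rewrite (lin1_tliftE ( *:%R (d a))); last by mlin.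
    by apply: eq_tlift => c1 c2; rewrite scalerA.
  by mlin.
transitivity (\tsum_(a ⊗ c <- comul h) \tsum_(a1 ⊗ a2 <- comul a)
   (d a2 * d (antipode c)) *: a1).
  apply: eq_tlift => a c.
  transitivity (d (antipode c) *: \tsum_(a1 ⊗ a2 <- comul a) d a2 *: a1).
    rewrite -e (lin1_tliftE ( *:%R (d (antipode c)))); last by mlin.
    by apply: eq_tlift => a1 a2; rewrite scalerA mulrC.
  rewrite (lin1_tliftE ( *:%R (d (antipode c)))); last by mlin.
  by apply: eq_tlift => a1 a2; rewrite scalerA mulrC.
rewrite (coassoc (F := fun x y z => (d y * d (antipode z)) *: x)); last by mlin.
rewrite -[RHS](counitr (G := id)) //; apply: eq_tlift => a c.
rewrite -character_antipoder (lin1_tliftE (U := H) (V := H) (W := k^o) ( *:%R^~ a)) //.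
by mlin.
Qed.

Lemma grouplike1 : grouplike (1 : H).
Proof. by split; [exact: comul1 | exact: counit1]. Qed.

Section CharacterPair.
Hypothesis dS : forall h, \tsum_(a ⊗ b <- comul h) d a *: antipode (antipode b) =
  \tsum_(a ⊗ b <- comul h) d b *: a.

Lemma character_pair_char1 : character_of 1 = 1.
Proof. by case: dP. Qed.

Lemma character_pair_involution : exists2 tau : H, inverses 1 tau &
  forall h, let T x := tau * twisted_antipode character_of x in T (T h) = h.
Proof.
exists 1 => [|h]; first by split; rewrite mulr1.
by rewrite /= !mul1r; exact: twisted_antipode_involutive.
Qed.

Definition character_pair : modular_pair H :=
  ModularPair grouplike1 character_pair_char1 character_pair_involution.
End CharacterPair.
End Character.

Section TensorPair.
Variables (k : comNzRingType) (H K : hopfAlgType k).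
Variables (p : modular_pair H) (q : modular_pair K).

Definition tensor_char (t : (H ⊗ K)%type) : k :=
  \teval_(a ⊗ b <- t) mp_char p a * mp_char q b.

Lemma lin1_lrmorph (L : hopfAlgType k) (d : {lrmorphism L -> k^o}) :
  @lin1 k L k^o d.
Proof. exact: linearP. Qed.

Lemma lin1_tensor_char : @lin1 _ _ k^o tensor_char.
Proof.
by apply: (@lin1_tlift k H K k^o); have := @lin1_lrmorph; split=> ? /=; mlin.
Qed.

Lemma tensor_char_pure a b : tensor_char (a ⊗ b) = mp_char p a * mp_char q b.
Proof.
by rewrite /tensor_char /teval tlift_pureE //; have := @lin1_lrmorph; split=> ? /=; mlin.
Qed.

Lemma tensor_char_character : is_character tensor_char.
Proof.
have lt := lin1_tensor_char.
split=> //; first by rewrite [1]/(1 ⊗ 1) tensor_char_pure !rmorph1 mulr1.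
move=> s t; move: s; apply: (@tensor_ext1 _ _ _ k^o).
- rewrite /=; apply: (@lin1_comp _ _ _ k^o tensor_char) => //.
  exact: tmul_linearl.
- by mlin.
move=> a b; move: t; apply: (@tensor_ext1 _ _ _ k^o).
- rewrite /=; apply: (@lin1_comp _ _ _ k^o tensor_char) => //.
  exact: tmul_linearr.
- by mlin.
by move=> c d; rewrite tmulE !tensor_char_pure !rmorphM mulrACA.
Qed.

Lemma tensor_grouplike : grouplike (mp_elt p ⊗ mp_elt q : (H ⊗ K)%type).
Proof.
have [cp ep] := mp_grouplike p; have [cq eq] := mp_grouplike q.
split; first by rewrite [comul _]tcomul_pure cp cq tmid_pure.
by rewrite [counit _]tcounit_pure ep eq mulr1.
Qed.

Lemma tensor_char_elt : character_of tensor_char_character (mp_elt p ⊗ mp_elt q) = 1.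
Proof. by rewrite character_ofE tensor_char_pure !mp_char_elt mulr1. Qed.

Lemma tensor_twisted_antipode a b :
  twisted_antipode tensor_char (a ⊗ b : (H ⊗ K)%type) =
  twisted_antipode (mp_char p) a ⊗ twisted_antipode (mp_char q) b.
Proof.
have l := @lin1_lrmorph.
have lp := l _ (mp_char p); have lq := l _ (mp_char q).
have lt := lin1_tensor_char.
rewrite /twisted_antipode comul_tensorE; last by mlin.
rewrite (lin1_tliftE (fun x => x ⊗ _)); last by mlin.
apply: eq_tlift => a1 a2; rewrite (lin1_tliftE (pure _)); last by mlin.
apply: eq_tlift => b1 b2; rewrite tensor_char_pure [antipode _]tantipode_pure.
by rewrite pureZZ.
Qed.

Lemma tensor_involution : exists2 tau : (H ⊗ K)%type,
    inverses (mp_elt p ⊗ mp_elt q) tau &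
  forall h, let T x := tau * twisted_antipode (character_of tensor_char_character) x in
    T (T h) = h.
Proof.
have [s [s1 s2] sT] := mp_involution p; have [t [t1 t2] tT] := mp_involution q.
have lt := lin1_tensor_char.
exists (s ⊗ t) => [|h /=]; first by split; rewrite tmulE ?s1 ?s2 ?t1 ?t2.
have lT : lin1 (fun x => tmul (s ⊗ t)
    (twisted_antipode (character_of tensor_char_character) x)).
  apply: (lin1_comp (f := tmul (s ⊗ t))); first exact: tmul_linearr.
  by rewrite /twisted_antipode; mlin.
move: h; apply: (tensor_ext1 (g := id)) => [|//|a b]; first exact: (lin1_comp lT lT).
have E x y : (s ⊗ t) * twisted_antipode tensor_char (x ⊗ y : (H ⊗ K)%type) =
  (s * twisted_antipode (mp_char p) x) ⊗ (t * twisted_antipode (mp_char q) y).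
  by rewrite tensor_twisted_antipode tmulE.
by rewrite !E /= sT tT.
Qed.

Definition tensor_pair : modular_pair (H ⊗ K)%type :=
  ModularPair tensor_grouplike tensor_char_elt tensor_involution.

End TensorPair.

Lemma scalar_of (F : comNzRingType) (V : lmodType F) (f : V -> F) :
  @lin1 F V F^o f -> exists phi : {scalar V}, phi =1 f.
Proof.
move=> lf; pose phi : {scalar V} := HB.pack f (GRing.isLinear.Build F V F *%R f lf).
by exists phi.
Qed.

(** * Linear functionals separating points over a field *)

Section Separation.
Variables (F : fieldType) (V : lmodType F).

(** Zorn gives a maximal subspace avoiding x. Modulo it every vector is a multiple of x, and the
    functional reads off the factor. *)
Lemma separating_scalar (x : V) : x != 0 ->
  exists2 phi : V -> F, @lin1 F V F^o phi & phi x = 1.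
Proof.
move=> x0.
pose P (U : set V) := (forall a y z, U y -> U z -> U (a *: y + z)) /\ ~ U x.
have [G GP Gtot|U [[Ulin Ux] Umax]] := @Zorn_bigcup V P.
  split=> [a y z [A GA Ay] [B GB Bz]|[A /GP[_ nAx] //]].
  have [AB|BA] := Gtot _ _ GA GB.
    by exists B => //; apply: (GP _ GB).1 => //; exact: AB.
  by exists A => //; apply: (GP _ GA).1 => //; exact: BA.
(* The empty chain forces the empty set to satisfy [P], so [U] is not known to contain 0; it is
   added here. *)
pose U0 y := U y \/ y = 0.
have U0lin a y z : U0 y -> U0 z -> U0 (a *: y + z).
  case=> [Uy|->] [Uz|->]; rewrite ?scaler0 ?addr0 ?add0r.
  - by left; exact: Ulin.
  - left; have := Ulin (a - 1) _ _ Uy Uy; rewrite scalerBl scale1r subrK //.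
  - by left.
  - by right.
have U0x : ~ U0 x by case=> // xz; rewrite xz eqxx in x0.
have ex y : exists c, U0 (y - c *: x).
  case: (pselect (U y)) => [Uy|nUy]; first by exists 0; rewrite scale0r subr0; left.
  (* The span of [U] and y is strictly larger than [U], so by maximality it contains x; the
     coefficient of y in x is nonzero since x is not in [U0]. *)
  pose W z := exists u c, U0 u /\ z = u + c *: y.
  have [u [c [U0u xE]]] : W x.
    apply: contrapT => nWx; apply: (Umax W); last first.
      split=> // a _ _ [u [c [Uu ->]]] [v [d [Uv ->]]].
      exists (a *: u + v), (a * c + d); split; first exact: U0lin.
      by rewrite scalerDr scalerDl scalerA addrACA.
    split=> [z Uz|WU]; first by exists z, 0; rewrite scale0r addr0; split=> //; left.
    by apply: nUy; apply: WU; exists 0, 1; rewrite scale1r add0r; split=> //; right.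
  have c0 : c != 0.
    by apply/eqP => c0; apply: U0x; rewrite xE c0 scale0r addr0.
  exists c^-1; rewrite xE scalerDr scalerA mulVf // scale1r opprD addrCA subrr addr0.
  by rewrite -scaleNr -[_ *: u]addr0; apply: U0lin => //; right.
have [phi phiP] := choice ex.
have phiE c y : U0 (y - c *: x) -> phi y = c.
  move=> Uc; apply/eqP; rewrite -subr_eq0; apply/eqP; apply: contrapT => /eqP d0; apply: U0x.
  have := U0lin (-1) _ _ (phiP y) Uc; rewrite scaleN1r opprB addrA subrK -scalerBl => Ud.
  have := U0lin (phi y - c)^-1 _ 0 Ud (or_intror erefl).
  by rewrite addr0 scalerA mulVf // scale1r.
exists phi => [a y z|]; last by apply: phiE; rewrite scale1r subrr; right.
apply: phiE; have -> : (a *: (phi y : F^o) + phi z) *: x = a *: (phi y *: x) + phi z *: x.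
  by rewrite scalerDl scalerA.
have := U0lin a _ _ (phiP y) (phiP z).
by rewrite scalerBr addrACA -opprD.
Qed.

Lemma separation (x y : V) :
  (forall phi : {scalar V}, phi x = phi y) -> x = y.
Proof.
move=> e; apply/eqP; rewrite -subr_eq0; apply: contraT => /separating_scalar[f lf f1].
have [phi phiE] := scalar_of lf.
by move/eqP: f1; rewrite (lin1B lf) -!phiE e subrr eq_sym oner_eq0.
Qed.

(** A finite-rank operator fixing the list. For a new x with nonzero residue z, a functional equal
    to 1 at z is composed with the residue map; it then vanishes on the old vectors and the
    correction leaves them fixed. *)
Lemma finite_rank_identity (s : seq V) :
  exists t : seq ({scalar V} * V), forall x, x \in s -> x = \sum_(p <- t) p.1 x *: p.2.
Proof.
elim: s => [|x s [t tP]]; first by exists [::].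
pose z := x - \sum_(p <- t) p.1 x *: p.2.
case: (eqVneq z 0) => [z0|/separating_scalar[f lf f1]].
  exists t => y; rewrite inE => /orP[/eqP->|/tP //].
  by apply/eqP; rewrite -subr_eq0 -/z z0.
pose g y := f (y - \sum_(p <- t) p.1 y *: p.2).
have lg : scalar g.
  move=> a y y'; rewrite /g -[RHS]/(a *: (f _ : F^o) + _) -lf; congr f.
  rewrite scalerBr addrACA; congr (_ + _); rewrite -opprD; congr (- _).
  rewrite scaler_sumr -big_split /=; apply: eq_bigr => p _.
  by rewrite linearP scalerDl scalerA.
have [phi phiE] := scalar_of lg.
exists ((phi, z) :: t) => y; rewrite big_cons /= phiE inE.
case/orP => [/eqP->|ys]; first by rewrite /g -/z f1 scale1r subrK.
by rewrite /g -tP // subrr (lin1_0 lf) scale0r add0r.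
Qed.

End Separation.

(** * Ribbon algebras *)

Lemma tlift_tmul (k : comNzRingType) (A B : algType k) (W : lmodType k)
    (F : A -> B -> W) (s t : A ⊗ B) : lin2 F ->
  tlift F (tmul s t) = \tsum_(a ⊗ b <- s) \tsum_(c ⊗ d <- t) F (a * c) (b * d).
Proof.
move=> lF; rewrite /tmul tlift_comp //; apply: eq_tlift => a b.
by rewrite tlift_comp //; apply: eq_tlift => c d; rewrite tlift_pureE.
Qed.

Section Quasitriangular.
Variables (k : comNzRingType) (H : hopfAlgType k) (R : (H ⊗ H)%type).
Hypothesis RP : quasitriangular R.
Implicit Types (W : lmodType k) (h : H).

Lemma hexagonl W (F : H -> H -> H -> W) : lin3 F ->
  \tsum_(a ⊗ b <- R) \tsum_(a1 ⊗ a2 <- comul a) F a1 a2 b =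
  \tsum_(a ⊗ b <- R) \tsum_(c ⊗ d <- R) F a c (b * d).
Proof.
move=> lF; pose G a t := tlift (F a) t.
have lG : lin2 G by rewrite /G; mlin.
have := congr1 (tlift G) (qt_comull RP).
rewrite /tassoc tlift_comp // tlift_tmap; last by mlin.
rewrite -[leg13 R * _]/(tmul _ _) tlift_tmul // /leg13 /leg23 tlift_comp; last by mlin.
move=> E; transitivity (\tsum_(a ⊗ b <- R) tlift G (tlift (fun u v => u ⊗ (v ⊗ b)) (comul a))).
  apply: eq_tlift => a b; rewrite tlift_comp //; apply: eq_tlift => a1 a2.
  by rewrite tlift_pureE // /G tlift_pureE //; mlin.
rewrite E; apply: eq_tlift => a b; rewrite tlift_pureE; last by mlin.
rewrite tlift_pureE; last by mlin.
rewrite mulr1 /G -[_ * R]/(tmul _ _) tlift_tmul; last by mlin.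
rewrite tlift_pureE; last by mlin.
by apply: eq_tlift => c d; rewrite mul1r.
Qed.

Lemma hexagonr W (F : H -> H -> H -> W) : lin3 F ->
  \tsum_(a ⊗ b <- R) \tsum_(b1 ⊗ b2 <- comul b) F a b1 b2 =
  \tsum_(a ⊗ b <- R) \tsum_(c ⊗ d <- R) F (a * c) d b.
Proof.
move=> lF; pose G a t := tlift (F a) t.
have lG : lin2 G by rewrite /G; mlin.
have := congr1 (tlift G) (qt_comulr RP).
rewrite tlift_tmap // -[leg13 R * _]/(tmul _ _) tlift_tmul // /leg13 /leg12.
rewrite tlift_comp; last by mlin.
move=> ->; apply: eq_tlift => a b; rewrite tlift_pureE; last by mlin.
rewrite tlift_comp; last by mlin.
apply: eq_tlift => c d; rewrite tlift_pureE; last by mlin.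
rewrite -[X in G _ X]/(tmul (1 ⊗ b) (d ⊗ 1)) tmul_pure mul1r mulr1.
by rewrite /G tlift_pureE //; mlin.
Qed.

Lemma quasi_cocommutative W (F : H -> H -> W) h : lin2 F ->
  \tsum_(a ⊗ b <- R) \tsum_(h1 ⊗ h2 <- comul h) F (a * h1) (b * h2) =
  \tsum_(a ⊗ b <- R) \tsum_(h1 ⊗ h2 <- comul h) F (h2 * a) (h1 * b).
Proof.
move=> lF; have := congr1 (tlift F) (qt_comul RP h).
rewrite -[R * _]/(tmul _ _) -[_ * R]/(tmul _ _) !tlift_tmul // => ->.
rewrite tlift_tflip; last by mlin.
by rewrite tlift_exchange.
Qed.

(** The algebra map id ⊗ epsilon sends R to an invertible element, and the second hexagon makes that
    element idempotent; hence it is 1. *)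
Lemma R_counitr : \tsum_(a ⊗ b <- R) counit b *: a = 1.
Proof.
pose f (t : (H ⊗ H)%type) : H := \tsum_(a ⊗ b <- t) counit b *: a.
have lf2 : lin2 (fun a b : H => counit b *: a) by mlin.
have [Q [RQ QR]] := qt_inv RP.
have fM s t : f (s * t) = f s * f t.
  rewrite /f -[s * t]/(tmul s t) tlift_tmul // (lin1_tliftE (fun x => x * _)); last by mlin.
  apply: eq_tlift => a b; rewrite (lin1_tliftE (fun x => _ * x)); last by mlin.
  by apply: eq_tlift => c d; rewrite counitM -scalerAl -scalerAr scalerA.
have f1 : f 1 = 1 by rewrite /f [1]/(1 ⊗ 1) tlift_pureE // counit1 scale1r.
have ff : f R * f R = f R.
  rewrite -{2}[f R]/(tlift _ R).
  transitivity (\tsum_(a ⊗ b <- R) \tsum_(b1 ⊗ b2 <- comul b) counit b1 *: (counit b2 *: a)).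
    rewrite (hexagonr (F := fun a b c => counit b *: (counit c *: a))); last by mlin.
    rewrite {1}/f (lin1_tliftE (fun x => x * _)); last by mlin.
    apply: eq_tlift => a b; rewrite /f (lin1_tliftE (fun x => _ * x)); last by mlin.
    by apply: eq_tlift => c d; rewrite -scalerAl -scalerAr !scalerA mulrC.
  apply: eq_tlift => a b; rewrite (counitl (G := fun x => counit x *: a)) //.
  by mlin.
by rewrite -[LHS]/(f R) -[f R]mulr1 -f1 -RQ fM mulrA ff -fM RQ.
Qed.

(** With [R_cancelr]: (id ⊗ S)R is a two-sided inverse of R in the algebra H ⊗ H^op. Both come from
    the second hexagon and the antipode axioms. *)
Lemma R_cancell W (G : H -> H -> W) : lin2 G ->
  \tsum_(a ⊗ b <- R) \tsum_(c ⊗ d <- R) G (a * c) (antipode d * b) = G 1 1.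
Proof.
move=> lG; rewrite -(hexagonr (F := fun x y z => G x (antipode y * z))); last by mlin.
transitivity (G (\tsum_(a ⊗ b <- R) counit b *: a) 1); last by rewrite R_counitr.
rewrite (lin1_tliftE (G^~ 1)); last by mlin.
apply: eq_tlift => a b; rewrite (antipodelW (G := G a)); last by mlin.
by rewrite (lin1Z (f := G^~ 1)) //; mlin.
Qed.

Lemma R_cancelr W (G : H -> H -> W) : lin2 G ->
  \tsum_(a ⊗ b <- R) \tsum_(c ⊗ d <- R) G (a * c) (d * antipode b) = G 1 1.
Proof.
move=> lG; rewrite -(hexagonr (F := fun x y z => G x (y * antipode z))); last by mlin.
transitivity (G (\tsum_(a ⊗ b <- R) counit b *: a) 1); last by rewrite R_counitr.
rewrite (lin1_tliftE (G^~ 1)); last by mlin.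
apply: eq_tlift => a b; rewrite (antipoderW (G := G a)); last by mlin.
by rewrite (lin1Z (f := G^~ 1)) //; mlin.
Qed.

Let u := drinfeld R.

(** Contracting R Delta(h) = Delta^op(h) R with x ⊗ y |-> S(y) x brings S(h_1) and h_2 next to each
    other. *)
Lemma drinfeld_adjoint h :
  \tsum_(a ⊗ b <- comul h) antipode b * u * a = counit h *: u.
Proof.
transitivity (\tsum_(a ⊗ b <- R) \tsum_(h1 ⊗ h2 <- comul h)
    antipode (b * h2) * (a * h1)).
  rewrite tlift_exchange; apply: eq_tlift => h1 h2.
  rewrite /u /drinfeld (lin1_tliftE (fun x => antipode h2 * x * h1)); last by mlin.
  by apply: eq_tlift => a b; rewrite antipodeM !mulrA.
rewrite (quasi_cocommutative h (F := fun x y => antipode y * x)); last by mlin.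
rewrite /u /drinfeld (lin1_tliftE (fun x => counit h *: x)); last by mlin.
apply: eq_tlift => a b.
transitivity (\tsum_(h1 ⊗ h2 <- comul h) antipode b * (antipode h1 * h2) * a).
  by apply: eq_tlift => h1 h2; rewrite antipodeM !mulrA.
by rewrite (antipodelW (G := fun x => antipode b * x * a)) ?mulr1 //; mlin.
Qed.

(** Insert h_2 S(h_3): S(h_2 S(h_3)) u h_1 = S^2(h_3) S(h_2) u h_1, and [drinfeld_adjoint] absorbs
    h_1 and h_2. *)
Lemma drinfeld_antipode2 h : u * h = antipode (antipode h) * u.
Proof.
transitivity (\tsum_(a ⊗ t <- comul h) \tsum_(b ⊗ c <- comul t)
   antipode (b * antipode c) * (u * a)).
  rewrite (antipoder_cancelr (G := fun x y => antipode y * (u * x))); last by mlin.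
  by rewrite antipode1 mul1r.
rewrite -(coassoc (F := fun a b c => antipode (b * antipode c) * (u * a))); last by mlin.
rewrite -(counitl (G := fun x => antipode (antipode x) * u)); last by mlin.
apply: eq_tlift => a c; rewrite scalerAr -drinfeld_adjoint.
rewrite (lin1_tliftE (fun x => antipode (antipode c) * x)); last by mlin.
by apply: eq_tlift => a1 a2; rewrite antipodeM !mulrA.
Qed.

Let w := \tsum_(a ⊗ b <- R) b * antipode (antipode a).

(** b S^2(a) u = b u a by [drinfeld_antipode2]; expanding u leaves two copies of R that cancel by
    [R_cancelr]. *)
Lemma drinfeld_left_inverse : w * u = 1.
Proof.
rewrite -[RHS](mulr1 1) -(R_cancelr (G := fun x y => y * x)); last by mlin.
rewrite tlift_exchange (lin1_tliftE (fun x => x * u)); last by mlin.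
apply: eq_tlift => a b; rewrite -mulrA -drinfeld_antipode2 mulrA.
rewrite {1}/u /drinfeld (lin1_tliftE (fun x => b * x * a)); last by mlin.
by apply: eq_tlift => c d; rewrite !mulrA.
Qed.

Lemma comul_drinfeldW W (F : H -> H -> W) : lin2 F ->
  tlift F (comul u) = \tsum_(p ⊗ p' <- R) \tsum_(s ⊗ s' <- R)
    \tsum_(p1 ⊗ p2 <- comul p) \tsum_(s1 ⊗ s2 <- comul s)
      F (antipode p' * (p1 * s1)) (antipode s' * (p2 * s2)).
Proof.
move=> lF; have lc : lin1 (tlift F \o @comul k H) by rewrite /comp; mlin.
rewrite -[LHS]/((tlift F \o @comul k H) u) /u /drinfeld (lin1_tliftE _ lc) /=.
transitivity (\tsum_(a ⊗ b <- R) \tsum_(b1 ⊗ b2 <- comul b)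
    \tsum_(a1 ⊗ a2 <- comul a) F (antipode b2 * a1) (antipode b1 * a2)).
  apply: eq_tlift => a b; rewrite comulMW // comul_antipodeW //; mlin.
rewrite (hexagonr (F := fun a b1 b2 =>
   \tsum_(a1 ⊗ a2 <- comul a) F (antipode b2 * a1) (antipode b1 * a2))); last by mlin.
apply: eq_tlift => p p'; apply: eq_tlift => s s'; rewrite comulMW //; mlin.
Qed.

Lemma comul_drinfeld : comul u * (tflip R * R) = u ⊗ u.
Proof.
rewrite -[LHS](tlift_pure_id) -[_ * (_ * _)]/(tmul _ (tmul _ _)) tlift_tmul; last by mlin.
rewrite comul_drinfeldW; last by mlin.
(* R_21 is moved to the left of Delta(s), which becomes Delta^op(s). *)
transitivity (\tsum_(p ⊗ p' <- R) \tsum_(s ⊗ s' <- R) \tsum_(p1 ⊗ p2 <- comul p)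
  \tsum_(v ⊗ v' <- R) \tsum_(s1 ⊗ s2 <- comul s) \tsum_(t ⊗ t' <- R)
    (antipode p' * (p1 * (v' * s2) * t)) ⊗ (antipode s' * (p2 * (v * s1) * t'))).
  apply: eq_tlift => p p'; apply: eq_tlift => s s'; apply: eq_tlift => p1 p2.
  rewrite (quasi_cocommutative s (F := fun x y => \tsum_(t ⊗ t' <- R)
      (antipode p' * (p1 * y * t)) ⊗ (antipode s' * (p2 * x * t')))); last by mlin.
  rewrite [RHS]tlift_exchange; apply: eq_tlift => s1 s2.
  rewrite tlift_tmul; last by mlin.
  rewrite tlift_tflip; last by mlin.
  by apply: eq_tlift => v v'; apply: eq_tlift => t t'; rewrite !mulrA.
(* The first hexagon splits p and creates S(a') a, that is a copy of u. Moving u past v' as S^2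
   prepares c and v for cancellation by [R_cancell]. *)
transitivity (\tsum_(s ⊗ s' <- R) \tsum_(c ⊗ c' <- R) \tsum_(v ⊗ v' <- R)
   \tsum_(s1 ⊗ s2 <- comul s) \tsum_(t ⊗ t' <- R)
    (antipode (antipode v' * c') * (u * (s2 * t))) ⊗ (antipode s' * ((c * v) * (s1 * t')))).
  rewrite tlift_exchange; apply: eq_tlift => s s'.
  rewrite (hexagonl (F := fun p1 p2 p' => \tsum_(v ⊗ v' <- R) \tsum_(s1 ⊗ s2 <- comul s)
    \tsum_(t ⊗ t' <- R)
    (antipode p' * (p1 * (v' * s2) * t)) ⊗ (antipode s' * (p2 * (v * s1) * t')))); last by mlin.
  rewrite tlift_exchange; apply: eq_tlift => c c'.
  rewrite tlift_exchange; apply: eq_tlift => v v'.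
  rewrite tlift_exchange; apply: eq_tlift => s1 s2.
  rewrite tlift_exchange; apply: eq_tlift => t t'.
  rewrite antipodeM; set y := antipode s' * _.
  transitivity ((antipode c' * u * (v' * s2 * t)) ⊗ y).
    rewrite /u /drinfeld (lin1_tliftE (fun x => (antipode c' * x * (v' * s2 * t)) ⊗ y)); last by mlin.
    by apply: eq_tlift => a a'; rewrite /y antipodeM !mulrA.
  rewrite -!mulrA !(mulrA u) drinfeld_antipode2 /y !mulrA //.
pose G x y := \tsum_(s ⊗ s' <- R) \tsum_(s1 ⊗ s2 <- comul s) \tsum_(t ⊗ t' <- R)
  (antipode y * (u * (s2 * t))) ⊗ (antipode s' * (x * (s1 * t'))).
rewrite tlift_exchange; transitivity (G 1 1).
  rewrite -R_cancell; last by rewrite /G; mlin.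
  by apply: eq_tlift => c c'; rewrite tlift_exchange.
(* The same three moves for s give the second copy of u and cancel c against t. *)
rewrite /G (hexagonl (F := fun s1 s2 s' => \tsum_(t ⊗ t' <- R)
  (antipode 1 * (u * (s2 * t))) ⊗ (antipode s' * (1 * (s1 * t'))))); last by mlin.
rewrite tlift_exchange antipode1.
transitivity (\tsum_(c ⊗ c' <- R) \tsum_(t ⊗ t' <- R)
   (u * (c * t)) ⊗ (antipode (antipode t' * c') * u)); last first.
  rewrite (R_cancell (G := fun x y => (u * x) ⊗ (antipode y * u))); last by mlin.
  by rewrite antipode1 mul1r mulr1.
apply: eq_tlift => c c'; rewrite tlift_exchange; apply: eq_tlift => t t'.
rewrite antipodeM -mulrA -drinfeld_antipode2.
rewrite [in RHS]/u /drinfeld.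
rewrite (lin1_tliftE (fun x => (drinfeld R * (c * t)) ⊗ (antipode c' * (x * t')))); last by mlin.
by apply: eq_tlift => a a'; rewrite antipodeM !mul1r !mulrA.
Qed.

End Quasitriangular.

(** * The modular pair of a ribbon algebra *)

Section RibbonPair.
Variables (k : comNzRingType) (H : hopfAlgType k) (s : ribbon H).

Let R := rib_R s.
Let RP : quasitriangular R := rib_qt s.
Let th := rib_theta s.
Let u := drinfeld R.
Let w := \tsum_(a ⊗ b <- R) b * antipode (antipode a).
Let wu : w * u = 1 := drinfeld_left_inverse RP.

Lemma inverses_unique (A : pzRingType) (x y z : A) :
  inverses x y -> inverses x z -> y = z.
Proof. by move=> [xy yx] [xz zx]; rewrite -[y]mulr1 -xz mulrA yx mul1r. Qed.

(** So far u has only the left inverse w. Since theta^2 = u S(u) is central, theta^2 w S(w) = w u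
    S(u) S(w) = S(w u) = 1. *)
Lemma rib_theta_invertible : exists t, inverses th t.
Proof.
pose z := w * antipode w.
have thz : th * (th * z) = 1.
  rewrite mulrA /z -expr2 mulrA -[th ^+ 2 * w](_ : w * th ^+ 2 = _).
    rewrite /th rib_square -/u -/R mulrA wu mul1r -antipodeM.
    by rewrite wu antipode1.
  by rewrite expr2 mulrA -rib_central -mulrA -rib_central mulrA.
by exists (th * z); split; rewrite // -[LHS](rib_central s (th * z)).
Qed.

Definition rib_theta_inv : H := sval (cid rib_theta_invertible).
Let t := rib_theta_inv.

Lemma rib_theta_invP : inverses th t.
Proof. exact: svalP (cid rib_theta_invertible). Qed.

(** The invertibility of theta supplies the missing right inverse S(u) theta^-2 of u, which must
    agree with w. *)
Lemma drinfeld_inverses : inverses u w.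
Proof.
have [tht tth] := rib_theta_invP.
split=> //; pose v := antipode u * (t * t).
have uv : u * v = 1.
  rewrite /v mulrA -rib_square expr2 -/th mulrA -[th * th * t]mulrA tht mulr1.
  exact: tht.
by rewrite -[w]mulr1 -uv (mulrA w) wu mul1r uv.
Qed.

Definition rib_elt : H := u * t.

Lemma rib_elt_inverses : inverses rib_elt (th * w).
Proof.
have [tht tth] := rib_theta_invP; have [uw _] := drinfeld_inverses.
by split; rewrite /rib_elt mulrA -?[u * t * th]mulrA ?tth ?mulr1 // -(mulrA th) wu mulr1.
Qed.

Lemma comul_rib_elt : comul rib_elt = rib_elt ⊗ rib_elt.
Proof.
have [tht tth] := rib_theta_invP.
have [Q [RQ QR] cth] := rib_comul s.
have cu : comul u = (u ⊗ u) * Q.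
  by rewrite -comul_drinfeld // -mulrA RQ mulr1.
have cth2 x : (th ⊗ th) * x = x * (th ⊗ th).
  move: x; apply: (tensor_ext1 (f := fun x => tmul (th ⊗ th) x)
     (g := fun x => tmul x (th ⊗ th))) => [||a b]; [by mlin | by mlin |].
  by rewrite !tmul_pure /th !rib_central.
(* The coproducts of u and of theta carry the same factor [Q]. As theta ⊗ theta is central, [Q]
   cancels without inverting Delta(theta). *)
have e : comul rib_elt * (th ⊗ th) = u ⊗ u.
  have : comul rib_elt * comul th = (u ⊗ u) * Q.
    by rewrite -comulM /rib_elt -mulrA tth mulr1.
  rewrite /th cth -/th -(cth2 Q) mulrA => e.
  by rewrite -[LHS]mulr1 -QR mulrA e -mulrA QR mulr1.
rewrite -[LHS]mulr1 -[1]/(1 ⊗ 1) -tht -tmulE mulrA e -[_ * _]/(tmul _ _).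
by rewrite tmul_pure.
Qed.

Lemma counit_grouplike (x y : H) : comul x = x ⊗ x -> inverses x y -> counit x = 1.
Proof.
move=> cx [xy yx]; have := comulel x.
rewrite cx tlift_pureE; last by mlin.
move/(congr1 (fun z => counit (z * y))).
rewrite -scalerAl xy counit1 (lin1Z (f := @counit k H : H -> k^o)); last exact: counit_linear.
by rewrite counit1 -[_ *: _]/(_ * _) mulr1.
Qed.

Lemma rib_elt_grouplike : grouplike rib_elt.
Proof.
by split; [exact: comul_rib_elt | exact: counit_grouplike comul_rib_elt rib_elt_inverses].
Qed.

Lemma counit_is_character : is_character (@counit k H).
Proof.
by split; [exact: counit_linear | exact: counit1 | exact: counitM].
Qed.

Lemma rib_char_elt : character_of counit_is_character rib_elt = 1.
Proof. by case: rib_elt_grouplike. Qed.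

Lemma twisted_antipode_counit h : twisted_antipode (@counit k H) h = antipode h.
Proof. by rewrite /twisted_antipode (counitl (G := @antipode k H)) //; mlin. Qed.

Lemma antipode_grouplike (x y : H) : grouplike x -> inverses x y -> antipode x = y.
Proof.
move=> [cx ex] [xy yx]; have := antipodel x.
rewrite cx tlift_pureE; last by mlin.
by rewrite ex scale1r => e; rewrite -[LHS]mulr1 -xy mulrA e mul1r.
Qed.

(** The twisted antipode for the counit is S, and S(tau) = sigma, so the square is tau S^2(h) sigma;
    S^2 is conjugation by u, and theta is central. *)
Lemma rib_involution : exists2 tau : H, inverses rib_elt tau &
  forall h, let T x := tau * twisted_antipode (character_of counit_is_character) x in
    T (T h) = h.
Proof.
have [tht tth] := rib_theta_invP.
have iu := rib_elt_inverses; have gu := rib_elt_grouplike.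
exists (th * w) => [//|h /=]; rewrite !twisted_antipode_counit antipodeM.
have Stau : antipode (th * w) = rib_elt.
  have [a b] := iu.
  have : antipode (th * w) * antipode rib_elt = 1 by rewrite -antipodeM a antipode1.
  by rewrite (antipode_grouplike gu iu) => e; rewrite -[LHS]mulr1 -b mulrA e mul1r.
have [uw _] := drinfeld_inverses.
rewrite Stau /rib_elt !mulrA -(mulrA (th * w)) -(drinfeld_antipode2 RP).
rewrite mulrA -(mulrA th w) wu mulr1.
by rewrite (rib_central s) -mulrA tht mulr1.
Qed.

Definition ribbon_pair : modular_pair H :=
  ModularPair rib_elt_grouplike rib_char_elt rib_involution.

End RibbonPair.

(** * Coribbon algebras *)

Section Convolution.
Variables (k : comNzRingType) (H : hopfAlgType k).
Implicit Types (f g : H -> k).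

Lemma convE f g h :
  conv f g h = @tlift k H H k^o (fun a b => f a * g b) (comul h).
Proof. by []. Qed.

Lemma lin1_conv f g : @lin1 _ _ k^o f -> @lin1 _ _ k^o g -> @lin1 k H k^o (conv f g).
Proof.
move=> lf lg.
change (@lin1 k H k^o (fun h => @tlift k H H k^o (fun a b => f a * g b) (comul h))).
by mlin.
Qed.

Lemma eq_conv f f' g g' : f =1 f' -> g =1 g' -> conv f g =1 conv f' g'.
Proof.
by move=> ef eg h; apply: (@eq_tlift k H H k^o) => a b; rewrite ef eg.
Qed.

Lemma convA f1 f2 f3 :
  @lin1 _ _ k^o f1 -> @lin1 _ _ k^o f2 -> @lin1 _ _ k^o f3 ->
  conv f1 (conv f2 f3) =1 conv (conv f1 f2) f3.
Proof.
move=> l1 l2 l3 h; rewrite !convE.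
transitivity (@tlift k H H k^o (fun a t => @tlift k H H k^o
   (fun b c => f1 a * f2 b * f3 c) (comul t)) (comul h)).
  apply: (@eq_tlift k H H k^o) => a t.
  rewrite convE (@lin1_tliftE _ _ _ k^o k^o _ (fun x => f1 a * x)); last by mlin.
  by apply: (@eq_tlift k H H k^o) => b c; rewrite mulrA.
rewrite -(@coassoc k H k^o (fun a b c => f1 a * f2 b * f3 c)); last by mlin.
apply: (@eq_tlift k H H k^o) => a t.
by rewrite convE (@lin1_tliftE _ _ _ k^o k^o _ (fun x => x * f3 t)) //; mlin.
Qed.

Lemma conv1l f : @lin1 _ _ k^o f -> conv (@counit k H) f =1 f.
Proof. by move=> lf h; rewrite -[RHS](@counitl k H k^o f). Qed.

Lemma conv1r f : @lin1 _ _ k^o f -> conv f (@counit k H) =1 f.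
Proof.
move=> lf h; rewrite -[RHS](@counitr k H k^o f) //.
by apply: (@eq_tlift k H H k^o) => a b; rewrite mulrC.
Qed.

Lemma conv_antipode f g : @lin1 _ _ k^o f -> @lin1 _ _ k^o g ->
  conv (f \o antipode) (g \o antipode) =1 conv g f \o antipode.
Proof.
move=> lf lg h; rewrite /= [RHS]convE comul_antipodeW; last by mlin.
by apply: (@eq_tlift k H H k^o) => a b; rewrite mulrC.
Qed.

(* Convolving the hypothesis with g on both sides moves f to the other side. *)
Lemma conv_inverse_swap f g (A B : H -> H) :
  lin1 A -> lin1 B -> @lin1 _ _ k^o f -> @lin1 _ _ k^o g -> conv_inverses f g ->
  (forall h, \tsum_(a ⊗ b <- comul h) f a *: A b = \tsum_(a ⊗ b <- comul h) f b *: B a) ->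
  forall h, \tsum_(a ⊗ b <- comul h) g b *: A a = \tsum_(a ⊗ b <- comul h) g a *: B b.
Proof.
move=> lA lB lf lg [fg gf] e h.
pose X := \tsum_(a ⊗ t <- comul h) \tsum_(b ⊗ s <- comul t)
  \tsum_(c ⊗ d <- comul s) (g a * f b * g d) *: A c.
transitivity X.
  rewrite /X.
  transitivity (\tsum_(a ⊗ t <- comul h) \tsum_(b ⊗ s <- comul t)
     (g a * f b) *: \tsum_(c ⊗ d <- comul s) g d *: A c); last first.
    apply: eq_tlift => a t; apply: eq_tlift => b s.
    rewrite (lin1_tliftE ( *:%R (g a * f b))); last by mlin.
    by apply: eq_tlift => c d; rewrite scalerA.
  rewrite -(coassoc (F := fun a b s => (g a * f b) *: \tsum_(c ⊗ d <- comul s) g d *: A c));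
    last by mlin.
  rewrite -[LHS](counitl (G := fun s => \tsum_(c ⊗ d <- comul s) g d *: A c)); last by mlin.
  apply: eq_tlift => a s; rewrite -gf convE.
  by rewrite (lin1_tliftE (U := H) (V := H) (W := k^o) ( *:%R^~ _)) //; mlin.
rewrite /X; transitivity (\tsum_(a ⊗ t <- comul h) \tsum_(b ⊗ s <- comul t)
  \tsum_(b1 ⊗ b2 <- comul b) (g a * f b1 * g s) *: A b2).
  apply: eq_tlift => a t.
  by rewrite -(coassoc (F := fun b c d => (g a * f b * g d) *: A c)) //; mlin.
transitivity (\tsum_(a ⊗ t <- comul h) \tsum_(b ⊗ s <- comul t)
  \tsum_(b1 ⊗ b2 <- comul b) (g a * f b2 * g s) *: B b1).
  apply: eq_tlift => a t; apply: eq_tlift => b s.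
  transitivity ((g a * g s) *: \tsum_(b1 ⊗ b2 <- comul b) f b1 *: A b2).
    rewrite (lin1_tliftE ( *:%R (g a * g s))); last by mlin.
    by apply: eq_tlift => b1 b2; rewrite scalerA mulrAC.
  rewrite e (lin1_tliftE ( *:%R (g a * g s))); last by mlin.
  by apply: eq_tlift => b1 b2; rewrite scalerA mulrAC.
apply: eq_tlift => a t.
rewrite (coassoc (F := fun b1 b2 s => (g a * f b2 * g s) *: B b1)); last by mlin.
rewrite -(counitr (G := fun b => g a *: B b)); last by mlin.
apply: eq_tlift => b s; rewrite -fg convE.
rewrite (lin1_tliftE (U := H) (V := H) (W := k^o) ( *:%R^~ (g a *: B b))); last by mlin.
by apply: eq_tlift => c d; rewrite scalerA -mulrA mulrC.
Qed.

End Convolution.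

Section Coquasitriangular.
Variables (k : comNzRingType) (H : hopfAlgType k) (r : {scalar (H ⊗ H)%type}).
Hypothesis rP : coquasitriangular r.
Implicit Types (W : lmodType k) (a b c h : H).

Let rr a b : k := r (a ⊗ b).

Lemma lin2_r : @lin2 k H H k^o rr.
Proof. by split=> x; rewrite /rr; mlin. Qed.

Let lr := lin2_r.

Lemma cqt_mullW W a b c (w : W) : rr (a * b) c *: w =
  \tsum_(c1 ⊗ c2 <- comul c) (rr a c1 * rr b c2) *: w.
Proof.
rewrite /rr (cqt_mull rP).
by rewrite (lin1_tliftE (U := H) (V := H) (W := k^o) ( *:%R^~ w)) //; mlin.
Qed.

Lemma cqt_mulrW W a b c (w : W) : rr a (b * c) *: w =
  \tsum_(a1 ⊗ a2 <- comul a) (rr a1 c * rr a2 b) *: w.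
Proof.
rewrite /rr (cqt_mulr rP).
by rewrite (lin1_tliftE (U := H) (V := H) (W := k^o) ( *:%R^~ w)) //; mlin.
Qed.

Lemma cqt_mulW W (G : H -> W) a b : lin1 G ->
  \tsum_(a1 ⊗ a2 <- comul a) \tsum_(b1 ⊗ b2 <- comul b) rr a1 b1 *: G (a2 * b2) =
  \tsum_(a1 ⊗ a2 <- comul a) \tsum_(b1 ⊗ b2 <- comul b) rr a2 b2 *: G (b1 * a1).
Proof.
move=> lG; have := congr1 G (cqt_mul rP a b).
rewrite !(lin1_tliftE G) // => e; transitivity
  (\tsum_(a1 ⊗ a2 <- comul a) G (\tsum_(b1 ⊗ b2 <- comul b) r (a1 ⊗ b1) *: (a2 * b2))).
  apply: eq_tlift => a1 a2; rewrite (lin1_tliftE G) //.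
  by apply: eq_tlift => b1 b2; rewrite (lin1Z lG).
rewrite e; apply: eq_tlift => a1 a2; rewrite (lin1_tliftE G) //.
by apply: eq_tlift => b1 b2; rewrite (lin1Z lG).
Qed.

(** Dual of [R_counitr]: r(-, 1) is convolution invertible, and idempotent because 1 = 1 1. *)
Lemma r_unitr a : rr a 1 = counit a.
Proof.
have [q [rq _]] := cqt_inv rP.
pose f a := rr a 1; pose g a : k := q (a ⊗ 1).
have lf : @lin1 k H k^o f by rewrite /f; mlin.
have lg : @lin1 k H k^o g by rewrite /g; mlin.
have ff : conv f f =1 f.
  by move=> h; rewrite /f {3}/rr -{3}[1]mulr1 (cqt_mulr rP).
have fg : conv f g =1 @counit k H.
  move=> h; have := rq (h ⊗ 1); rewrite [counit _]tcounit_pure counit1 mulr1 => <-.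
  rewrite !convE comul_tensorE; last by mlin.
  apply: (@eq_tlift _ _ _ k^o) => x y; rewrite comul1 (@tlift_pureE _ _ _ k^o) //.
  by mlin.
rewrite -[LHS]/(f a) -fg -(@conv1r _ _ f lf a) -(eq_conv (f := f) (fun=> erefl) fg).
by rewrite convA // (eq_conv ff (g := g) (fun=> erefl)).
Qed.

Let u := codrinfeld r.

Lemma codrinfeldE h : u h = @tlift k H H k^o (fun a b => rr b (antipode a)) (comul h).
Proof. by []. Qed.

Lemma lin1_codrinfeld : @lin1 k H k^o u.
Proof.
change (@lin1 k H k^o (fun h => @tlift k H H k^o (fun a b => rr b (antipode a)) (comul h))).
by mlin.
Qed.
Let lu := lin1_codrinfeld.

Lemma codrinfeldW W h (w : W) : u h *: w = \tsum_(a ⊗ b <- comul h) rr b (antipode a) *: w.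
Proof.
by rewrite codrinfeldE (lin1_tliftE (U := H) (V := H) (W := k^o) ( *:%R^~ w)) //; mlin.
Qed.

(** Dual of [drinfeld_adjoint]: [cqt_mul] for y and S(x) reverses the product, after which S(x_2)
    y_1 collapses. *)
Lemma codrinfeld_adjoint W (G : H -> W) h : lin1 G ->
  \tsum_(a ⊗ t <- comul h) \tsum_(b ⊗ c <- comul t) u b *: G (c * antipode a) =
  u h *: G 1.
Proof.
move=> lG; transitivity (\tsum_(x ⊗ y <- comul h) \tsum_(y1 ⊗ y2 <- comul y)
    \tsum_(s1 ⊗ s2 <- comul (antipode x)) rr y1 s1 *: G (y2 * s2)).
  transitivity (\tsum_(x ⊗ y <- comul h) \tsum_(x1 ⊗ x2 <- comul x)
    \tsum_(y1 ⊗ y2 <- comul y) rr y1 (antipode x2) *: G (y2 * antipode x1)); last first.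
    apply: eq_tlift => x y; rewrite [LHS]tlift_exchange; apply: eq_tlift => y1 y2.
    by rewrite comul_antipodeW //; mlin.
  rewrite (coassoc (F := fun x1 x2 y =>
    \tsum_(y1 ⊗ y2 <- comul y) rr y1 (antipode x2) *: G (y2 * antipode x1))); last by mlin.
  apply: eq_tlift => a t.
  rewrite -(coassoc (F := fun b c d => rr c (antipode b) *: G (d * antipode a))); last by mlin.
  by apply: eq_tlift => b c; rewrite codrinfeldW.
transitivity (\tsum_(x ⊗ y <- comul h) \tsum_(x1 ⊗ x2 <- comul x)
    \tsum_(y1 ⊗ y2 <- comul y) rr y2 (antipode x1) *: G (antipode x2 * y1)).
  apply: eq_tlift => x y; rewrite cqt_mulW // [RHS]tlift_exchange; apply: eq_tlift => y1 y2.
  by rewrite comul_antipodeW //; mlin.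
rewrite (coassoc (F := fun x1 x2 y =>
    \tsum_(y1 ⊗ y2 <- comul y) rr y2 (antipode x1) *: G (antipode x2 * y1))); last by mlin.
rewrite codrinfeldW; apply: eq_tlift => a t.
by rewrite (antipodel_cancel (G := fun x y => rr y (antipode a) *: G x)) //; mlin.
Qed.

(** Dual of u h = S^2(h) u, by inserting S(S(p) a) = S(a) S^2(p) and applying
    [codrinfeld_adjoint]. *)
Lemma codrinfeld_antipode2 W (G : H -> W) h : lin1 G ->
  \tsum_(a ⊗ b <- comul h) u a *: G b =
  \tsum_(a ⊗ b <- comul h) u b *: G (antipode (antipode a)).
Proof.
move=> lG; transitivity (\tsum_(p ⊗ h' <- comul h)
   \tsum_(a ⊗ t <- comul h') \tsum_(b ⊗ c <- comul t)
     u b *: G (c * antipode a * antipode (antipode p))); last first.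
  apply: eq_tlift => p h'.
  by rewrite (codrinfeld_adjoint _ (G := fun x => G (x * antipode (antipode p))))
     ?mul1r //; mlin.
transitivity (\tsum_(p ⊗ h' <- comul h)
   \tsum_(a ⊗ t <- comul h') \tsum_(b ⊗ c <- comul t)
     u b *: G (c * antipode (antipode p * a))).
  rewrite (antipodel_cancel (G := fun x t => \tsum_(b ⊗ c <- comul t)
     u b *: G (c * antipode x))); last by mlin.
  by apply: eq_tlift => a b; rewrite antipode1 mulr1.
apply: eq_tlift => p h'; apply: eq_tlift => a t; apply: eq_tlift => b c.
by rewrite antipodeM mulrA.
Qed.

Definition codrinfeld_inv h : k :=
  @tlift k H H k^o (fun a b => rr (antipode (antipode b)) a) (comul h).
Let w := codrinfeld_inv.

Lemma lin1_codrinfeld_inv : @lin1 k H k^o w.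
Proof. by rewrite /w /codrinfeld_inv; mlin. Qed.

(** Moving u across S^2 leaves u(h_2) r(h_3, h_1). Expanded, the two values of r combine to r(h_3,
    h_1 S(h_2)), which collapses to r(h, 1). *)
Lemma codrinfeld_left_inverse : conv w u =1 @counit k H.
Proof.
move=> h; rewrite convE.
transitivity (@tlift k H H k^o (fun x y => @tlift k H H k^o (fun a b =>
    rr (antipode (antipode b)) a * u y) (comul x)) (comul h)).
  apply: (@eq_tlift _ _ _ k^o) => x y; rewrite /w /codrinfeld_inv.
  by rewrite (@lin1_tliftE k H H k^o k^o _ ( *%R^~ (u y))) //; mlin.
rewrite (@coassoc _ _ k^o (fun a b y => rr (antipode (antipode b)) a * u y)); last by mlin.
transitivity (@tlift k H H k^o (fun a t => @tlift k H H k^o (fun b c =>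
    rr c (a * antipode b) : k^o) (comul t)) (comul h)).
  apply: (@eq_tlift _ _ _ k^o) => a t.
  transitivity (@tlift k H H k^o (fun b y => u b *: (rr y a : k^o)) (comul t)).
    rewrite (@codrinfeld_antipode2 k^o (fun y => rr y a)); last by mlin.
    by apply: (@eq_tlift _ _ _ k^o) => b y; rewrite mulrC.
  transitivity (@tlift k H H k^o (fun b y => @tlift k H H k^o (fun b1 b2 =>
     rr b2 (antipode b1) * rr y a) (comul b)) (comul t)).
    by apply: (@eq_tlift _ _ _ k^o) => b y; rewrite codrinfeldW.
  rewrite (@coassoc _ _ k^o (fun b1 b2 y => rr b2 (antipode b1) * rr y a)); last by mlin.
  by apply: (@eq_tlift _ _ _ k^o) => b y; rewrite /rr (cqt_mulr rP).
rewrite (@antipoder_cancel _ _ k^o (fun x y => rr y x)); last by mlin.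
exact: r_unitr.
Qed.

(** The forms r(y, S(a)) and r(y, S^2(a)) cancel in convolution: by [cqt_mulr] their product is r(y,
    S(a_1 S(a_2))). *)
Lemma r_cancel W (G : H -> H -> W) a y : lin2 G ->
  \tsum_(a1 ⊗ t <- comul a) \tsum_(a2 ⊗ c <- comul t)
  \tsum_(y1 ⊗ s <- comul y) \tsum_(y2 ⊗ d <- comul s)
    (rr y1 (antipode a1) * rr y2 (antipode (antipode a2))) *: G c d = G a y.
Proof.
move=> lG; transitivity (\tsum_(a1 ⊗ t <- comul a) \tsum_(a2 ⊗ c <- comul t)
  \tsum_(z ⊗ d <- comul y) rr z (antipode (a1 * antipode a2)) *: G c d).
  apply: eq_tlift => a1 t; apply: eq_tlift => a2 c.
  rewrite -(coassoc (F := fun y1 y2 d =>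
    (rr y1 (antipode a1) * rr y2 (antipode (antipode a2))) *: G c d)); last by mlin.
  by apply: eq_tlift => z d; rewrite antipodeM cqt_mulrW.
rewrite (antipoder_cancel (G := fun x c =>
  \tsum_(z ⊗ d <- comul y) rr z (antipode x) *: G c d)); last by mlin.
rewrite -[RHS](counitl (G := G a)); last by mlin.
by apply: eq_tlift => z d; rewrite antipode1 r_unitr.
Qed.

Lemma r_codrinfeld W (G : H -> W) a b : lin1 G ->
  \tsum_(a1 ⊗ t <- comul a) \tsum_(a2 ⊗ c <- comul t) rr (a2 * b) (antipode a1) *: G c =
  \tsum_(a1 ⊗ t <- comul a) \tsum_(a2 ⊗ c <- comul t) (rr b (antipode a1) * u a2) *: G c.
Proof.
move=> lG; transitivity (\tsum_(a1 ⊗ t <- comul a) \tsum_(x1 ⊗ x2 <- comul a1)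
  \tsum_(a2 ⊗ c <- comul t) (rr a2 (antipode x2) * rr b (antipode x1)) *: G c).
  apply: eq_tlift => a1 t; rewrite [RHS]tlift_exchange; apply: eq_tlift => a2 c.
  by rewrite cqt_mullW comul_antipodeW //; mlin.
rewrite (coassoc (F := fun x1 x2 t => \tsum_(a2 ⊗ c <- comul t)
  (rr a2 (antipode x2) * rr b (antipode x1)) *: G c)); last by mlin.
apply: eq_tlift => x1 t.
rewrite -(coassoc (F := fun x2 a2 c =>
  (rr a2 (antipode x2) * rr b (antipode x1)) *: G c)); last by mlin.
apply: eq_tlift => z c; rewrite -scalerA codrinfeldW.
rewrite (lin1_tliftE ( *:%R (rr b (antipode x1)))); last by mlin.
by apply: eq_tlift => x2 a2; rewrite scalerA mulrC.
Qed.

(** The dual of one round in [comul_drinfeld]: [r_codrinfeld] extracts u, [codrinfeld_antipode2]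
    moves it across a_3 as S^2, and [r_cancel] removes the two remaining values of r. *)
Lemma r_codrinfeld_cancel W (G : H -> H -> W) a b : lin2 G ->
  \tsum_(a1 ⊗ t <- comul a) \tsum_(a2 ⊗ t' <- comul t) \tsum_(a3 ⊗ c <- comul t')
  \tsum_(b2 ⊗ s <- comul b) \tsum_(b3 ⊗ d <- comul s)
    (rr (a2 * b2) (antipode a1) * rr b3 a3) *: G c d =
  \tsum_(x ⊗ c <- comul a) u x *: G c b.
Proof.
move=> lG.
pose K y1 y2 d := \tsum_(a1 ⊗ t <- comul a) \tsum_(a2 ⊗ t' <- comul t)
    rr (a2 * y1) (antipode a1) *: \tsum_(a3 ⊗ c <- comul t') rr y2 a3 *: G c d.
transitivity (\tsum_(b2 ⊗ s <- comul b) \tsum_(b3 ⊗ d <- comul s) K b2 b3 d).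
  rewrite /K; under [RHS]eq_tlift => b2 s do rewrite -tlift_exchange2.
  rewrite -tlift_exchange2; apply: eq_tlift => a1 t; apply: eq_tlift => a2 t'.
  rewrite tlift_exchange; apply: eq_tlift => b2 s.
  rewrite tlift_exchange; apply: eq_tlift => b3 d.
  rewrite [RHS](lin1_tliftE ( *:%R _)); last by mlin.
  by apply: eq_tlift => a3 c; rewrite scalerA.
pose G' x y := \tsum_(z ⊗ c <- comul x) u z *: G c y.
transitivity (\tsum_(b2 ⊗ s <- comul b) \tsum_(b3 ⊗ d <- comul s)
   \tsum_(a1 ⊗ t <- comul a) \tsum_(a2 ⊗ c <- comul t)
   (rr b2 (antipode a1) * rr b3 (antipode (antipode a2))) *: G' c d); last first.
  rewrite -[RHS]/(G' a b) -r_cancel; last by rewrite /G'; mlin.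
  under eq_tlift => b2 s do rewrite -tlift_exchange2.
  rewrite -tlift_exchange2; apply: eq_tlift => a1 t; apply: eq_tlift => a2 c.
  by [].
apply: eq_tlift => b2 s; apply: eq_tlift => b3 d; rewrite /K.
rewrite (r_codrinfeld (G := fun t' => \tsum_(a3 ⊗ c <- comul t') rr b3 a3 *: G c d)); last by mlin.
apply: eq_tlift => a1 t.
transitivity (rr b2 (antipode a1) *: \tsum_(a2 ⊗ t' <- comul t)
  \tsum_(a3 ⊗ c <- comul t') (u a2 * rr b3 a3) *: G c d).
  rewrite (lin1_tliftE ( *:%R _)); last by mlin.
  apply: eq_tlift => a2 t'; rewrite -scalerA; congr (_ *: _).
  rewrite (lin1_tliftE ( *:%R _)); last by mlin.
  by apply: eq_tlift => a3 c; rewrite scalerA.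
transitivity (rr b2 (antipode a1) *: \tsum_(a2 ⊗ t' <- comul t)
  \tsum_(a3 ⊗ c <- comul t') (rr b3 (antipode (antipode a2)) * u a3) *: G c d); last first.
  rewrite (lin1_tliftE ( *:%R _)); last by mlin.
  apply: eq_tlift => a2 t'; rewrite -scalerA; congr (_ *: _); rewrite /G'.
  rewrite [RHS](lin1_tliftE ( *:%R _)); last by mlin.
  by apply: eq_tlift => a3 c; rewrite scalerA.
congr (_ *: _).
rewrite -(coassoc (F := fun a2 a3 c => (u a2 * rr b3 a3) *: G c d)); last by mlin.
rewrite -(coassoc (F := fun a2 a3 c =>
  (rr b3 (antipode (antipode a2)) * u a3) *: G c d)); last by mlin.
apply: eq_tlift => z c.
transitivity (\tsum_(a2 ⊗ a3 <- comul z) u a2 *: (rr b3 a3 *: G c d)).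
  by apply: eq_tlift => a2 a3; rewrite scalerA.
rewrite (codrinfeld_antipode2 _ (G := fun x => rr b3 x *: G c d)); last by mlin.
by apply: eq_tlift => a2 a3; rewrite scalerA mulrC.
Qed.

Let m : (H ⊗ H)%type -> H := tlift (fun a b => a * b).
Let mop : (H ⊗ H)%type -> H := tlift (fun a b => b * a).
Let r21 (t : (H ⊗ H)%type) : k := r (tflip t).
Let f3 (t : (H ⊗ H)%type) x y : k :=
  @tlift k H H k^o (fun a b => rr x (antipode a) * rr y (antipode b)) t.

Let lm : lin1 m. Proof. by rewrite /m; mlin. Qed.
Let lflip : lin1 (@tflip k H H). Proof. exact: tflip_linear. Qed.
Let lmop : lin1 mop. Proof. by rewrite /mop; mlin. Qed.
Let lr21 : @lin1 _ _ k^o r21. Proof. by rewrite /r21; mlin. Qed.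
Let lf3 : @lin3 _ _ _ _ k^o f3. Proof. by rewrite /f3; mlin. Qed.
Let mE a b : m (a ⊗ b) = a * b. Proof. by rewrite /m tlift_pureE //; mlin. Qed.
Let mopE a b : mop (a ⊗ b) = b * a. Proof. by rewrite /mop tlift_pureE //; mlin. Qed.
Let r21E a b : r21 (a ⊗ b) = rr b a. Proof. by rewrite /r21 tflip_pure. Qed.
Let f3E a b x y : f3 (a ⊗ b) x y = rr x (antipode a) * rr y (antipode b).
Proof. by rewrite /f3 (@tlift_pureE k _ _ k^o) //; mlin. Qed.

(** u(ab) is expanded through S(ab) = S(b) S(a) and [cqt_mulr]. The pair stays one element of the
    coalgebra H ⊗ H, so that coassociativity later acts on both factors at once. *)
Lemma codrinfeld_m t : u (m t) =
  @tlift k (H ⊗ H)%type (H ⊗ H)%type k^o (fun x1 s => @tlift k (H ⊗ H)%type (H ⊗ H)%type k^o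
    (fun x2 x3 => f3 x1 (m x2) (m x3)) (comul s)) (comul t).
Proof.
move: t; apply: (@tensor_ext1 _ _ _ k^o) => [||a b]; [by mlin|by mlin|].
rewrite mE codrinfeldE comulMW; last by mlin.
rewrite comul_tensorE; last by mlin.
apply: (@eq_tlift _ _ _ k^o) => a1 a2; apply: (@eq_tlift _ _ _ k^o) => b1 b2.
rewrite comul_tensorE; last by mlin.
rewrite antipodeM /rr (cqt_mulr rP) /teval (@comulMW k H k^o); last by mlin.
apply: (@eq_tlift _ _ _ k^o) => x1 x2; apply: (@eq_tlift _ _ _ k^o) => y1 y2.
by rewrite f3E !mE.
Qed.

Lemma r21_m W (G : H -> W) t : lin1 G ->
  \tsum_(x ⊗ y <- comul t) r21 y *: G (m x) =
  \tsum_(x ⊗ y <- comul t) r21 x *: G (mop y).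
Proof.
move=> lG; move: t; apply: tensor_ext1 => [||a b]; [by mlin|by mlin|].
rewrite !comul_tensorE; [|by mlin|by mlin].
rewrite tlift_exchange [RHS]tlift_exchange.
transitivity (\tsum_(b1 ⊗ b2 <- comul b) \tsum_(a1 ⊗ a2 <- comul a)
   rr b2 a2 *: G (a1 * b1)).
  by apply: eq_tlift => b1 b2; apply: eq_tlift => a1 a2; rewrite r21E mE.
rewrite -cqt_mulW //; apply: eq_tlift => b1 b2; apply: eq_tlift => a1 a2.
by rewrite r21E mopE.
Qed.

Local Notation T := (@tlift k (H ⊗ H)%type (H ⊗ H)%type k^o).

(** Dual of [comul_drinfeld]: r_21 is moved across a product by [r21_m], then [r_codrinfeld_cancel]
    is applied once for each factor. *)
Lemma codrinfeld_mul a b :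
  conv (u \o m) (conv (r \o @tflip k H H) r) (a ⊗ b) = u a * u b.
Proof.
have lrr : @lin1 _ _ k^o r by exact: lin1_scalar.
transitivity (T (fun x1 s => T (fun x2 s' => T (fun z v => T (fun x3 w =>
   f3 x1 (m x2) (mop x3) * (r21 z * r w)) (comul v)) (comul s')) (comul s))
   (comul (a ⊗ b))).
  move: (a ⊗ b) => t; rewrite convE.
  transitivity (T (fun t' t'' => T (fun x1 s => T (fun x2 x3 =>
    f3 x1 (m x2) (m x3) * conv r21 r t'') (comul s)) (comul t')) (comul t)).
    apply: (@eq_tlift _ _ _ k^o) => t' t''; rewrite /= codrinfeld_m.
    rewrite (@lin1_tliftE _ _ _ k^o k^o _ ( *%R^~ (conv r21 r t''))); last by mlin.
    apply: (@eq_tlift _ _ _ k^o) => x1 s.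
    by rewrite (@lin1_tliftE _ _ _ k^o k^o _ ( *%R^~ (conv r21 r t''))) //; mlin.
  have lV : @lin1 _ _ k^o (conv r21 r) by apply: lin1_conv.
  rewrite (@coassoc _ _ k^o (fun x1 s t'' => T (fun x2 x3 =>
    f3 x1 (m x2) (m x3) * conv r21 r t'') (comul s))); last by mlin.
  apply: (@eq_tlift _ _ _ k^o) => x1 s.
  rewrite (@coassoc _ _ k^o (fun x2 x3 t'' => f3 x1 (m x2) (m x3) * conv r21 r t''));
    last by mlin.
  apply: (@eq_tlift _ _ _ k^o) => x2 s'.
  transitivity (T (fun x3 t'' => T (fun z w => f3 x1 (m x2) (m x3) * (r21 z * r w))
     (comul t'')) (comul s')).
    apply: (@eq_tlift _ _ _ k^o) => x3 t''; rewrite convE.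
    by rewrite (@lin1_tliftE _ _ _ k^o k^o _ ( *%R (f3 x1 (m x2) (m x3)))) //; mlin.
  rewrite -(@coassoc _ _ k^o (fun x3 z w => f3 x1 (m x2) (m x3) * (r21 z * r w)));
    last by mlin.
  rewrite -(@coassoc _ _ k^o (fun z x3 w => f3 x1 (m x2) (mop x3) * (r21 z * r w)));
    last by mlin.
  apply: (@eq_tlift _ _ _ k^o) => q w'.
  pose G x : k^o := f3 x1 (m x2) x * r w'.
  have lG : lin1 G by rewrite /G; mlin.
  transitivity (T (fun x3 z => r21 z *: G (m x3)) (comul q)).
    by apply: (@eq_tlift _ _ _ k^o) => x z; rewrite /G -[_ *: _]/(_ * _) mulrCA.
  rewrite r21_m //; apply: (@eq_tlift _ _ _ k^o) => x z.
  by rewrite /G -[_ *: _]/(_ * _) mulrCA.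
(* The part left over once the first cancellation has turned a_1, a_2, a_3 and b_2, b_3 into
   u(a_1). *)
pose G (c d : H) (b1 : H) : k := @tlift k H H k^o (fun a4 a5 => @tlift k H H k^o
   (fun b4 b5 => rr (b4 * a4) (antipode b1) * rr a5 b5) (comul d)) (comul c).
transitivity (@tlift k H H k^o (fun b1 s => @tlift k H H k^o (fun x c => u x * G c s b1)
   (comul a)) (comul b)).
  rewrite comul_tensorE; last by mlin.
  rewrite tlift_exchange; apply: (@eq_tlift _ _ _ k^o) => b1 t.
  transitivity (@tlift k H H k^o (fun x c => u x *: (G c t b1 : k^o)) (comul a)); last by [].
  rewrite -(@r_codrinfeld_cancel k^o (fun c d => G c d b1)); last by rewrite /G; mlin.
  apply: (@eq_tlift _ _ _ k^o) => a1 s.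
  rewrite comul_tensorE; last by mlin.
  apply: (@eq_tlift _ _ _ k^o) => a2 s'.
  rewrite [RHS]tlift_exchange; apply: (@eq_tlift _ _ _ k^o) => b2 t'.
  rewrite comul_tensorE; last by mlin.
  apply: (@eq_tlift _ _ _ k^o) => a3 c; apply: (@eq_tlift _ _ _ k^o) => b3 d.
  rewrite comul_tensorE; last by mlin.
  rewrite [RHS](@lin1_tliftE _ _ _ k^o k^o _ ( *%R _)); last by mlin.
  apply: (@eq_tlift _ _ _ k^o) => a4 a5.
  rewrite (@lin1_tliftE _ _ _ k^o k^o _ ( *%R _)); last by mlin.
  apply: (@eq_tlift _ _ _ k^o) => b4 b5.
  rewrite f3E mE mopE r21E -/(rr _ _) -!mulrA; congr (_ * _).
  by rewrite !mulrA; congr (_ * _); rewrite mulrC.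
(* Second cancellation with a and b exchanged. The counits supply the two trailing legs that
   [r_codrinfeld_cancel] expects. *)
transitivity (@tlift k H H k^o (fun x c => u x * @tlift k H H k^o (fun y d => u y *
   (counit c * counit d)) (comul b)) (comul a)).
  rewrite tlift_exchange; apply: (@eq_tlift _ _ _ k^o) => x c.
  rewrite -(@lin1_tliftE _ _ _ k^o k^o _ ( *%R (u x))); last by mlin.
  congr (_ * _); rewrite /G.
  transitivity (@tlift k H H k^o (fun y d => u y *: (counit c * counit d : k^o)) (comul b)); last by [].
  rewrite -(@r_codrinfeld_cancel k^o (fun c d => counit d * counit c)); last by mlin.
  apply: (@eq_tlift _ _ _ k^o) => b1 t.
  rewrite tlift_exchange; apply: (@eq_tlift _ _ _ k^o) => b4 b5.
  rewrite [RHS]tlift_exchange; apply: (@eq_tlift _ _ _ k^o) => a4 a5.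
  pose E y z : k^o := rr (b4 * a4) (antipode b1) * rr z y.
  have lE : lin2 E by rewrite /E; mlin.
  rewrite -[LHS]/(E b5 a5) -(counitr (G := E^~ a5)); last by mlin.
  apply: (@eq_tlift _ _ _ k^o) => y c0.
  rewrite -(counitr (G := fun z => counit c0 *: E y z)); last by mlin.
  apply: (@eq_tlift _ _ _ k^o) => z d.
  by rewrite /E scalerA [LHS]mulrC.
transitivity (@tlift k H H k^o (fun x c => (counit c * u x) * u b) (comul a)).
  apply: (@eq_tlift _ _ _ k^o) => x c; rewrite [counit c * _]mulrC -mulrA; congr (_ * _).
  rewrite -[in RHS](@counitr _ _ k^o u b) //.
  rewrite [RHS](@lin1_tliftE _ _ _ k^o k^o _ ( *%R _)); last by mlin.
  by apply: (@eq_tlift _ _ _ k^o) => y d; rewrite -[_ *: _]/(_ * _) mulrC -mulrA.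
rewrite -(@lin1_tliftE _ _ _ k^o k^o _ ( *%R^~ (u b))); last by mlin.
by congr (_ * _); rewrite -[in RHS](@counitr _ _ k^o u a).
Qed.
End Coquasitriangular.

Lemma character_antipode (k : comNzRingType) (H : hopfAlgType k) (d : H -> k) :
  is_character d -> is_character (d \o antipode).
Proof.
move=> [ld d1 dM]; split=> [|/=|a b /=]; first by rewrite /comp; mlin.
  by rewrite antipode1.
by rewrite antipodeM dM mulrC.
Qed.

Lemma character_inverses (k : comNzRingType) (H : hopfAlgType k) (d : H -> k) :
  is_character d -> conv_inverses d (d \o antipode).
Proof.
by move=> dP; split=> h; [exact: character_antipoder | exact: character_antipodel].
Qed.

(** * The modular pair of a coribbon algebra *)

Section CoribbonPair.
Variables (F : fieldType) (H : hopfAlgType F) (s : coribbon H).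

Let r := cor_r s.
Let rP : coquasitriangular r := cor_cqt s.
Let th : H -> F := cor_theta s.
Let u := codrinfeld r.
Let w := codrinfeld_inv r.
Let lth : @lin1 _ _ F^o th. Proof. exact: lin1_scalar. Qed.
Let lu : @lin1 _ _ F^o u. Proof. exact: lin1_codrinfeld. Qed.
Let lw : @lin1 _ _ F^o w. Proof. exact: lin1_codrinfeld_inv. Qed.
Let wu : conv w u =1 @counit F H := codrinfeld_left_inverse rP.
Let lcu : @lin1 _ _ F^o (@counit F H). Proof. exact: counit_linear. Qed.

Lemma cor_centralE f : @lin1 _ _ F^o f -> conv th f =1 conv f th.
Proof.
move=> lf; have [phi e] := scalar_of lf.
by move=> h; have := cor_central s phi h; rewrite !(eq_conv (fun=> erefl) e) !(eq_conv e (fun=> erefl)).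
Qed.

(** Dual of [rib_theta_invertible]: theta^2 * w * (w o S) is the counit, because w * u is. *)
Lemma cor_theta_invertible :
  exists t : {scalar H}, conv_inverses th t.
Proof.
have lS f : @lin1 _ _ F^o f -> @lin1 _ _ F^o (f \o @antipode F H).
  by move=> lf; rewrite /comp; mlin.
have lc := @lin1_conv F H.
pose z := conv w (w \o antipode).
have lz : @lin1 _ _ F^o z by apply: lc => //; apply: lS.
have thz : conv th (conv th z) =1 @counit F H.
  move=> h; rewrite convA // /z.
  have cw : conv (conv th th) w =1 conv w (conv th th).
    move=> x; rewrite -convA // (eq_conv (f := th) (fun=> erefl) (cor_centralE lw)).
    by rewrite convA // (eq_conv (cor_centralE lw) (fun=> erefl)) -convA.
  have lthth : @lin1 _ _ F^o (conv th th) by exact: lc.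
  rewrite convA // ?(eq_conv cw (fun=> erefl)); last by apply: lS.
  rewrite -(convA lw lthth (lS _ lw)).
  have e1 : conv (conv th th) (w \o antipode) =1 u.
    move=> x; rewrite (eq_conv (cor_square s) (fun=> erefl)) -/r -/u.
    rewrite -convA //; [|exact: lS|exact: lS].
    rewrite (eq_conv (f := u) (fun=> erefl) (conv_antipode lu lw)) -[RHS]conv1r //.
    by apply: eq_conv => // y; rewrite /= wu counit_antipode.
  by rewrite (eq_conv (f := w) (fun=> erefl) e1) wu.
have lt : @lin1 _ _ F^o (conv th z) by exact: lc.
have [t tE] := scalar_of lt; exists t.
have tht : conv th t =1 @counit F H.
  by move=> h; rewrite (eq_conv (f := th) (fun=> erefl) tE) thz.
split=> // h; rewrite -cor_centralE //; exact: lin1_scalar.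
Qed.

Definition cor_theta_inv : {scalar H} := sval (cid cor_theta_invertible).
Let t : H -> F := cor_theta_inv.

Lemma cor_theta_invP : conv_inverses th t.
Proof. exact: svalP (cid cor_theta_invertible). Qed.

Let lt : @lin1 _ _ F^o t. Proof. exact: lin1_scalar. Qed.

Lemma conv_inverses_unique (f g g' : H -> F) :
  @lin1 _ _ F^o f -> @lin1 _ _ F^o g -> @lin1 _ _ F^o g' ->
  conv_inverses f g -> conv_inverses f g' -> g =1 g'.
Proof.
move=> lf lg lg' [fg gf] [fg' gf'] h.
rewrite -[LHS](conv1r lg) -(eq_conv (f := g) (fun=> erefl) fg') convA //.
by rewrite (eq_conv gf (fun=> erefl)) conv1l.
Qed.

(* Centrality of theta is only assumed against functionals; over a field these
   separate points. *)
Lemma cor_theta_invW (G : H -> H) h : lin1 G ->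
  \tsum_(a ⊗ b <- comul h) t a *: G b = \tsum_(a ⊗ b <- comul h) t b *: G a.
Proof.
move=> lG; have lid := @lin1_id F H.
have e x : \tsum_(a ⊗ b <- comul x) th a *: b = \tsum_(a ⊗ b <- comul x) th b *: a.
  apply: separation => phi; have lphi := lin1_scalar phi.
  rewrite !(lin1_tliftE (X := F^o) phi) //.
  transitivity (conv th phi x).
    by apply: (@eq_tlift _ _ _ F^o) => a b; rewrite linearZ.
  rewrite cor_centralE //.
  by apply: (@eq_tlift _ _ _ F^o) => a b; rewrite linearZ /= mulrC.
have := conv_inverse_swap lid lid lth lt cor_theta_invP e h.
move/(congr1 G); rewrite !(lin1_tliftE G) // => e'.
transitivity (\tsum_(a ⊗ b <- comul h) G (t a *: b)).
  by apply: eq_tlift => a b; rewrite (lin1Z lG).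
by rewrite -e'; apply: eq_tlift => a b; rewrite (lin1Z lG).
Qed.

(* The Drinfeld functional times theta^-1; the character of the pair is its
   composition with the antipode. *)
Definition cor_char0 : H -> F := conv u t.
Let d := cor_char0.
Let ld : @lin1 _ _ F^o d. Proof. exact: lin1_conv. Qed.

Lemma cor_char0_theta : conv d th =1 u.
Proof.
have [_ tth] := cor_theta_invP.
by move=> h; rewrite -convA // (eq_conv (f := u) (fun=> erefl) tth) conv1r.
Qed.

Let m : (H ⊗ H)%type -> H := tlift (fun a b => a * b).
Let lm : lin1 m. Proof. by rewrite /m; mlin. Qed.
Let mE a b : m (a ⊗ b) = a * b. Proof. by rewrite /m tlift_pureE //; mlin. Qed.
Let sq (f : H -> F) : (H ⊗ H)%type -> F := @tlift F H H F^o (fun a b => f a * f b).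

Lemma sqE f a b : @lin1 _ _ F^o f -> sq f (a ⊗ b) = f a * f b.
Proof. by move=> lf; rewrite /sq (@tlift_pureE _ _ _ F^o) //; mlin. Qed.

Lemma lin1_sq f : @lin1 _ _ F^o f -> @lin1 _ _ F^o (sq f).
Proof. by move=> lf; rewrite /sq; mlin. Qed.

Lemma conv_m f g x : @lin1 _ _ F^o f -> @lin1 _ _ F^o g ->
  conv (f \o m) (g \o m) x = conv f g (m x).
Proof.
move=> lf lg; move: x; apply: (@tensor_ext1 _ _ _ F^o) => [||a b].
- by apply: lin1_conv; rewrite /comp; mlin.
- by have lc := lin1_conv lf lg; mlin.
rewrite mE !convE comulMW; last by mlin.
rewrite comul_tensorE; last by rewrite /comp; mlin.
by apply: (@eq_tlift _ _ _ F^o) => a1 a2; apply: (@eq_tlift _ _ _ F^o) => b1 b2;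
  rewrite /= !mE.
Qed.

Lemma conv_sq f g x : @lin1 _ _ F^o f -> @lin1 _ _ F^o g ->
  conv (sq f) (sq g) x = sq (conv f g) x.
Proof.
move=> lf lg; have lsf := lin1_sq lf; have lsg := lin1_sq lg.
have lc := lin1_conv lf lg.
move: x; apply: (@tensor_ext1 _ _ _ F^o) => [||a b].
- exact: lin1_conv.
- exact: lin1_sq.
rewrite sqE // !convE comul_tensorE; last by mlin.
rewrite [RHS](@lin1_tliftE _ _ _ F^o F^o _ ( *%R^~ _)); last by mlin.
apply: (@eq_tlift _ _ _ F^o) => a1 a2.
rewrite (@lin1_tliftE _ _ _ F^o F^o _ ( *%R _)); last by mlin.
by apply: (@eq_tlift _ _ _ F^o) => b1 b2; rewrite !sqE // mulrACA.
Qed.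

(** [f] need not be a product of two functionals, so centrality of theta is used in one variable
    with the other frozen, first in a, then in b. *)
Lemma sq_theta_central f x : @lin1 _ _ F^o f ->
  conv (sq th) f x = conv f (sq th) x.
Proof.
move=> lf; have lsth := lin1_sq lth; move: x.
apply: (@tensor_ext1 _ _ _ F^o) => [||a b]; [exact: lin1_conv|exact: lin1_conv|].
rewrite !convE !comul_tensorE; [|by mlin|by mlin].
transitivity (@tlift F H H F^o (fun b1 b2 => th b1 * conv th (fun a => f (a ⊗ b2)) a) (comul b)).
  rewrite tlift_exchange; apply: (@eq_tlift _ _ _ F^o) => b1 b2; rewrite convE.
  rewrite [RHS](@lin1_tliftE _ _ _ F^o F^o _ ( *%R _)); last by mlin.
  by apply: (@eq_tlift _ _ _ F^o) => a1 a2; rewrite sqE // mulrA [th b1 * _]mulrC.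
transitivity (@tlift F H H F^o (fun a1 a2 => th a2 * conv th (fun b => f (a1 ⊗ b)) b) (comul a)).
  transitivity (@tlift F H H F^o (fun b1 b2 =>
     @tlift F H H F^o (fun a1 a2 => th a2 * (th b1 * f (a1 ⊗ b2))) (comul a)) (comul b)).
    apply: (@eq_tlift _ _ _ F^o) => b1 b2; rewrite cor_centralE; last by mlin.
    rewrite convE (@lin1_tliftE _ _ _ F^o F^o _ ( *%R _)); last by mlin.
    by apply: (@eq_tlift _ _ _ F^o) => a1 a2; rewrite [RHS]mulrC mulrA.
  rewrite tlift_exchange; apply: (@eq_tlift _ _ _ F^o) => a1 a2; rewrite convE.
  by rewrite [RHS](@lin1_tliftE _ _ _ F^o F^o _ ( *%R _)) //; mlin.
apply: (@eq_tlift _ _ _ F^o) => a1 a2; rewrite cor_centralE; last by mlin.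
rewrite convE (@lin1_tliftE _ _ _ F^o F^o _ ( *%R _)); last by mlin.
by apply: (@eq_tlift _ _ _ F^o) => b1 b2; rewrite sqE // mulrCA.
Qed.

(** With V = r_21 * r: u o m = (d o m) * V^-1 * (theta ⊗ theta), while (u o m) * V = u ⊗ u. As theta
    ⊗ theta is central, V cancels and d o m = d ⊗ d remains. *)
Lemma cor_char0M : {morph d : a b / a * b}.
Proof.
have [q [Vq qV] thM] := cor_mul s.
pose V : (H ⊗ H)%type -> F := conv (cor_r s \o @tflip F H H) (cor_r s).
rewrite -/V in Vq qV.
have lV : @lin1 _ _ F^o V.
  have lflip : lin1 (@tflip F H H) by exact: tflip_linear.
  have lrf : @lin1 _ _ F^o (fun x : (H ⊗ H)%type => r (tflip x)) by mlin.
  by apply: lin1_conv; [exact: lrf | exact: lin1_scalar].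
have lq : @lin1 _ _ F^o q by mlin.
have lsth := lin1_sq lth; have lst := lin1_sq lt; have lsd := lin1_sq ld.
have ldm : @lin1 _ _ F^o (d \o m) by rewrite /comp; mlin.
have lthm : @lin1 _ _ F^o (th \o m) by rewrite /comp; mlin.
have lum : @lin1 _ _ F^o (u \o m) by rewrite /comp; mlin.
have lc := @lin1_conv F (H ⊗ H)%type.
have uV : conv (u \o m) V =1 sq u.
  apply: (@tensor_ext1 _ _ _ F^o) => [||a b]; [exact: lc|exact: lin1_sq|].
  by rewrite sqE // -(codrinfeld_mul rP).
have thmE : th \o m =1 conv q (sq th).
  apply: (@tensor_ext1 _ _ _ F^o) => [||a b]; [by []|exact: lc|].
  rewrite /= mE /th thM convE comul_tensorE; last by mlin.
  apply: (@eq_tlift _ _ _ F^o) => a1 a2; apply: (@eq_tlift _ _ _ F^o) => b1 b2.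
  by rewrite sqE.
have e : conv (d \o m) (sq th) =1 sq u.
  move=> x; rewrite -uV.
  have um : u \o m =1 conv (conv (d \o m) q) (sq th).
    move=> y; rewrite -convA // -(eq_conv (f := d \o m) (fun=> erefl) thmE) conv_m //.
    by rewrite /= cor_char0_theta.
  rewrite (eq_conv um (fun=> erefl)).
  have lmq : @lin1 _ _ F^o (conv (d \o m) q) by exact: lc.
  rewrite -convA // (eq_conv (fun=> erefl) (fun y => sq_theta_central y lV)).
  rewrite convA //.
  apply: eq_conv => // {}x; rewrite -convA // -[LHS]conv1r //.
  by apply: eq_conv => // y; rewrite Vq.
have sqt : conv (sq th) (sq t) =1 @counit F (H ⊗ H)%type.
  have [tht _] := cor_theta_invP.
  have lsc := lin1_sq lcu.
  move=> x; rewrite conv_sq //; move: x.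
  have ltht := lin1_conv lth lt.
  apply: (@tensor_ext1 _ _ _ F^o) => [||a b]; [exact: lin1_sq|exact: counit_linear|].
  by rewrite sqE // !tht [RHS]tcounit_pure.
move=> a b; have : (d \o m) =1 sq d; last by move/(_ (a ⊗ b)); rewrite /= mE sqE.
move=> x; rewrite -[LHS]conv1r // -(eq_conv (f := d \o m) (fun=> erefl) sqt) convA //.
rewrite (eq_conv e (fun=> erefl)) conv_sq //.
Qed.

Lemma cor_char0_character : is_character d.
Proof.
split=> //; last exact: cor_char0M.
have [tht _] := cor_theta_invP.
have t1 : t 1 = 1.
  have := tht 1; rewrite counit1 convE comul1 (@tlift_pureE _ _ _ F^o); last by mlin.
  by rewrite /th cor_unit mul1r.
rewrite /d /cor_char0 convE comul1 (@tlift_pureE _ _ _ F^o); last by mlin.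
rewrite t1 mulr1 /u codrinfeldE comul1 (@tlift_pureE _ _ _ F^o); last first.
  by have := lin2_r r => lr; mlin.
by rewrite antipode1 (r_unitr rP) counit1.
Qed.

(** The exchange rule for u, with theta^-1 carried along by its centrality. *)
Lemma cor_char0_antipode2 h :
  \tsum_(a ⊗ b <- comul h) d a *: b =
  \tsum_(a ⊗ b <- comul h) d b *: antipode (antipode a).
Proof.
transitivity (\tsum_(a ⊗ c <- comul h) \tsum_(b ⊗ x <- comul c) (u a * t b) *: x).
  rewrite -(coassoc (F := fun a b x => (u a * t b) *: x)); last by mlin.
  apply: eq_tlift => a b.
  by rewrite /d /cor_char0 convE (lin1_tliftE (U := H) (V := H) (W := F^o) ( *:%R^~ _)) //; mlin.
transitivity (\tsum_(a ⊗ c <- comul h) \tsum_(b ⊗ x <- comul c) (u a * t x) *: b).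
  apply: eq_tlift => a c.
  have := congr1 ( *:%R (u a)) (cor_theta_invW c (@lin1_id F H)).
  rewrite !(lin1_tliftE ( *:%R (u a))); [|by mlin|by mlin].
  move=> e; transitivity (\tsum_(b ⊗ x <- comul c) u a *: (t b *: x)).
    by apply: eq_tlift => b x; rewrite scalerA.
  by rewrite e; apply: eq_tlift => b x; rewrite scalerA.
rewrite -(coassoc (F := fun a b x => (u a * t x) *: b)); last by mlin.
transitivity (\tsum_(a ⊗ c <- comul h) \tsum_(b ⊗ x <- comul a)
   (u x * t c) *: antipode (antipode b)).
  apply: eq_tlift => a c.
  transitivity (\tsum_(b ⊗ x <- comul a) u b *: (t c *: x)).
    by apply: eq_tlift => b x; rewrite scalerA.
  rewrite (codrinfeld_antipode2 rP _ (G := fun x => t c *: x)); last by mlin.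
  by apply: eq_tlift => b x; rewrite scalerA.
rewrite (coassoc (F := fun b x c => (u x * t c) *: antipode (antipode b))); last by mlin.
apply: eq_tlift => a b.
by rewrite /d /cor_char0 convE (lin1_tliftE (U := H) (V := H) (W := F^o) ( *:%R^~ _)) //; mlin.
Qed.

(** [cor_char0_antipode2] has S^2 on the wrong side for [character_pair]; passing to the convolution
    inverse d o S puts it on the other. *)
Definition coribbon_char : H -> F := d \o antipode.

Lemma coribbon_char_character : is_character coribbon_char.
Proof. exact: character_antipode cor_char0_character. Qed.

Lemma coribbon_char_antipode2 h :
  \tsum_(a ⊗ b <- comul h) coribbon_char a *: antipode (antipode b) =
  \tsum_(a ⊗ b <- comul h) coribbon_char b *: a.
Proof.
have [ldS _ _] := coribbon_char_character.
have lS2 : lin1 (fun x : H => antipode (antipode x)) by mlin.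
have := conv_inverse_swap (@lin1_id F H) lS2 ld ldS
  (character_inverses cor_char0_character) cor_char0_antipode2 h.
by move=> ->.
Qed.

Definition coribbon_pair : modular_pair H :=
  character_pair coribbon_char_character coribbon_char_antipode2.

End CoribbonPair.

(** * Invariance of the pairs under isomorphisms *)

Lemma ribbon_pair_transport (k : comNzRingType) (H K : hopfAlgType k)
    (s : ribbon H) (t : ribbon K) (f : H -> K) :
  hopf_iso f -> tmap f f (rib_R s) = rib_R t -> f (rib_theta s) = rib_theta t ->
  mp_transport f (ribbon_pair s) (ribbon_pair t).
Proof.
move=> hf fR fth; have lf : lin1 f by exact: hopf_iso_linear.
split=> [h|]; first exact: (hopf_iso_counit hf h).
rewrite /= /rib_elt (hopf_isoM hf); congr (_ * _).
  rewrite /drinfeld -fR tlift_tmap; last by mlin.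
  rewrite (lin1_tliftE f) //; apply: eq_tlift => a b.
  by rewrite (hopf_isoM hf) (hopf_iso_antipode _ hf).
apply: (inverses_unique (rib_theta_invP t)); rewrite -fth.
have [e1 e2] := rib_theta_invP s.
by split; rewrite -(hopf_isoM hf) ?e1 ?e2 (hopf_iso1 hf).
Qed.

Lemma hopf_iso_conv (k : comNzRingType) (H K : hopfAlgType k) (f : H -> K) (g g' : K -> k) h :
  hopf_iso f -> @lin1 _ _ k^o g -> @lin1 _ _ k^o g' ->
  conv g g' (f h) = conv (g \o f) (g' \o f) h.
Proof.
move=> hf lg lg'; have lf : lin1 f by exact: hopf_iso_linear.
by rewrite !convE (hopf_iso_comul hf) tlift_tmap //; mlin.
Qed.

Lemma coribbon_pair_transport (F : fieldType) (H K : hopfAlgType F)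
    (s : coribbon H) (t : coribbon K) (f : H -> K) :
  hopf_iso f -> (forall a b, cor_r t (f a ⊗ f b) = cor_r s (a ⊗ b)) ->
  (forall h, cor_theta t (f h) = cor_theta s h) ->
  mp_transport f (coribbon_pair s) (coribbon_pair t).
Proof.
move=> hf fr fth; have lf : lin1 f by exact: hopf_iso_linear.
have ls g : @lin1 F _ F^o g -> @lin1 F _ F^o (g \o f).
  by move=> lg; rewrite /comp; mlin.
split=> [h|]; last by rewrite /= (hopf_iso1 hf).
rewrite /= /coribbon_char /= -(hopf_iso_antipode _ hf); move: (antipode h) => {}h.
rewrite /cor_char0 hopf_iso_conv //; [|exact: lin1_codrinfeld|exact: lin1_scalar].
apply: eq_conv => {}h /=.
  rewrite !codrinfeldE (hopf_iso_comul hf) tlift_tmap; last first.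
    by have := lin2_r (cor_r t) => lr; mlin.
  by apply: (@eq_tlift _ _ _ F^o) => a b; rewrite -(hopf_iso_antipode _ hf) fr.
have lth := lin1_scalar (cor_theta s); have lth' := lin1_scalar (cor_theta t).
have lt' := lin1_scalar (cor_theta_inv t).
apply: (conv_inverses_unique lth (ls _ lt') _ _ (cor_theta_invP s)); first exact: lin1_scalar.
have [e1 e2] := cor_theta_invP t.
have efth : cor_theta t \o f =1 cor_theta s by [].
split=> {}h.
  rewrite -(eq_conv efth (fun=> erefl)) -(hopf_iso_conv _ hf) // e1.
  exact: hopf_iso_counit.
rewrite -(eq_conv (g := cor_theta t \o f) (fun=> erefl) efth) -(hopf_iso_conv _ hf) // e2.
exact: hopf_iso_counit.
Qed.

Lemma tensor_pair_transport (k : comNzRingType) (H K H' K' : hopfAlgType k)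
    (p : modular_pair H) (q : modular_pair K) (p' : modular_pair H')
    (q' : modular_pair K') (f : H -> H') (g : K -> K') :
  lin1 f -> lin1 g -> mp_transport f p p' -> mp_transport g q q' ->
  mp_transport (tmap f g : (H ⊗ K)%type -> (H' ⊗ K')%type)
    (tensor_pair p q) (tensor_pair p' q').
Proof.
move=> lf lg [pc pe] [qc qe]; have lt := tmap_linear lf lg.
split=> [h|/=]; last by rewrite tmap_pure // pe qe.
have l1 := lin1_tensor_char p q; have l2 := lin1_tensor_char p' q'.
move: h; apply: (@tensor_ext1 _ _ _ k^o) => [||a b] //.
  by apply: (@lin1_comp _ _ _ k^o (tensor_char p' q')).
by rewrite /= tmap_pure // !tensor_char_pure pc qc.
Qed.

Fixpoint rc_pair (F : fieldType) (X : rc_structure F) : modular_pair (rc_alg X) :=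
  match X with
  | RCRibbon _ s => ribbon_pair s
  | RCCoribbon _ s => coribbon_pair s
  | RCTensor Y Z => tensor_pair (rc_pair Y) (rc_pair Z)
  end.

Lemma rc_iso_lin1 (F : fieldType) (X Y : rc_structure F) (f : rc_alg X -> rc_alg Y) :
  rc_iso f -> lin1 f.
Proof.
elim=> [H K s t {}f hf _ _|H K s t {}f hf _ _|X1 Y1 X2 Y2 f1 g1 _ l1 _ l2];
  [exact: hopf_iso_linear|exact: hopf_iso_linear|exact: tmap_linear].
Qed.

Lemma rc_pair_transport (F : fieldType) (X Y : rc_structure F) (f : rc_alg X -> rc_alg Y) :
  rc_iso f -> mp_transport f (rc_pair X) (rc_pair Y).
Proof.
elim=> [H K s t {}f|H K s t {}f|X1 Y1 X2 Y2 f1 g1 i1 t1 i2 t2].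
- exact: ribbon_pair_transport.
- exact: coribbon_pair_transport.
- by apply: tensor_pair_transport => //; exact: rc_iso_lin1.
Qed.

(** * The Haar functional of a compact quantum group *)

Import Order.TTheory Num.Theory.

Lemma tlift_comul_corep (k : comNzRingType) (H : hopfAlgType k) (W : lmodType k)
    n (v : 'M[H]_n) (F : H -> H -> W) i j :
  (forall i j, comul (v i j) = \sum_l v i l ⊗ v l j) -> lin2 F ->
  tlift F (comul (v i j)) = \sum_l F (v i l) (v l j).
Proof. by move=> cv lF; rewrite cv tlift_sum_pure. Qed.

Section StarBasics.
Variables (R : realType) (H : hopfAlgType R[i]) (star : H -> H).
Hypothesis sP : hopf_star star.
Local Notation C := R[i].

Lemma star_lin (c : C) a b : star (c *: a + b) = Num.conj c *: star a + star b.
Proof. exact: (star_antilinear sP). Qed.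

Lemma starD a b : star (a + b) = star a + star b.
Proof. by have := star_lin 1 a b; rewrite !scale1r conjC1 scale1r. Qed.
Lemma star0 : star 0 = 0.
Proof. by apply: (addrI (star 0)); rewrite -starD !addr0. Qed.
Lemma starZ c a : star (c *: a) = Num.conj c *: star a.
Proof. by have := star_lin c a 0; rewrite star0 !addr0. Qed.
Lemma star_sum I (s : seq I) (P : pred I) (F : I -> H) :
  star (\sum_(i <- s | P i) F i) = \sum_(i <- s | P i) star (F i).
Proof. by apply: (big_morph star starD star0). Qed.
Lemma starKE a : star (star a) = a. Proof. exact: (starK sP). Qed.
Lemma star1 : star 1 = 1.
Proof. by rewrite -[LHS]mulr1 -[X in _ * X]starKE -(starM sP) mulr1 starKE. Qed.

Lemma star_comulW (W : lmodType C) (F : H -> H -> W) h : lin2 F ->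
  tlift F (comul (star h)) = \tsum_(a ⊗ b <- comul h) F (star a) (star b).
Proof.
move=> lF; rewrite (star_comul sP (tensor_sum (comul h))).
by rewrite tlift_sum_pure.
Qed.

Lemma star_tlift (F : H -> H -> H) t :
  star (tlift F t) = \tsum_(a ⊗ b <- t) star (F a b).
Proof. exact: star_sum. Qed.

Lemma lin1_conj_star (f : H -> C) : @lin1 _ _ C^o f ->
  @lin1 _ _ C^o (fun a => Num.conj (f (star a))).
Proof.
move=> lf a x y; rewrite star_lin (lin1D lf) (lin1Z lf) -[_ *: f _]/(_ * _).
by rewrite rmorphD rmorphM /= conjCK.
Qed.

Lemma lin1_star_star (f : H -> H) : lin1 f -> lin1 (fun a => star (f (star a))).
Proof.
move=> lf a x y; rewrite star_lin (lin1D lf) (lin1Z lf) starD starZ.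
by rewrite conjCK.
Qed.

(** The functional conj(epsilon(star a)) is again a left counit, and counits are unique. *)
Lemma counit_star h : counit (star h) = Num.conj (counit h).
Proof.
pose e a : C := Num.conj (counit (star a)).
have lc : @lin1 _ _ C^o (@counit C H) by exact: counit_linear.
have le : @lin1 _ _ C^o e by exact: lin1_conj_star.
suff eE : counit h = e h by rewrite eE /e conjCK.
have E a : \tsum_(x ⊗ y <- comul a) e x *: y = a.
  rewrite -[RHS]starKE -[in RHS](counitl (G := fun x => x) (star a)) //.
  rewrite star_comulW; last by mlin.
  by rewrite star_tlift; apply: eq_tlift => x y; rewrite starZ starKE.
rewrite -[in LHS](E h) (lin1_tliftE (X := C^o) _ lc) -[RHS](@counitr _ _ C^o e) //.
by apply: (@eq_tlift _ _ _ C^o) => x y; rewrite (lin1Z lc) [LHS]mulrC.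
Qed.

(** The inverse of the antipode, by [antipode_starK] and [star_antipodeK]. *)
Definition star_antipode (a : H) : H := star (antipode (star a)).
Local Notation Sinv := star_antipode.

Lemma lin1_star_antipode : lin1 Sinv.
Proof. by apply: lin1_star_star; exact: antipode_linear. Qed.

Lemma star_antipodel a : \tsum_(x ⊗ y <- comul a) (Sinv y * x) = counit a *: 1.
Proof.
rewrite -[LHS]starKE star_tlift -[counit a](conjCK) -counit_star -[1 in RHS]star1 -starZ.
congr star; rewrite -antipoder star_comulW; last by mlin.
by apply: eq_tlift => x y; rewrite (starM sP) /Sinv starKE.
Qed.

(** The identity and S o Sinv are both convolution inverses of S. *)
Lemma antipode_starK a : antipode (Sinv a) = a.
Proof.
have lS : lin1 (@antipode C H) by exact: antipode_linear.
have lSi := lin1_star_antipode.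
symmetry; move: a; apply: (@convolution_inverse_unique _ H H id (@antipode C H)
   (fun a => antipode (Sinv a))) => //; first by mlin.
  exact: antipoder.
move=> h; transitivity (antipode (counit h *: (1 : H))).
  rewrite -star_antipodel (lin1_tliftE (@antipode C H)) //.
  by apply: eq_tlift => a b; rewrite antipodeM.
by rewrite (lin1Z lS) antipode1.
Qed.

Lemma star_antipodeK a : Sinv (antipode a) = a.
Proof.
have := antipode_starK (star a); rewrite /Sinv starKE => e.
by rewrite e starKE.
Qed.

Lemma star_antipode_star a : Sinv (star a) = star (antipode a).
Proof. by rewrite /Sinv starKE. Qed.

Section Unitary.
Variables (n : nat) (v : 'M[H]_n).
Hypothesis vP : unitary_corep star v.

Lemma ucorepVE i j : \sum_k v i k * star (v j k) = (i == j)%:R.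
Proof.
have := ucorepV vP; move/matrixP => /(_ i j); rewrite !mxE => <-.
by apply: eq_bigr => l _; rewrite !mxE.
Qed.

Lemma ucorepVlE i j : \sum_k star (v k i) * v k j = (i == j)%:R.
Proof.
have := ucorepVl vP; move/matrixP => /(_ i j); rewrite !mxE => <-.
by apply: eq_bigr => l _; rewrite !mxE.
Qed.

Lemma ucorep_antipodel i j : \sum_k antipode (v i k) * v k j = (i == j)%:R.
Proof.
have := antipodel (v i j).
rewrite (tlift_comul_corep _ _ (ucorep_comul vP)); last by mlin.
by rewrite (ucorep_counit vP) => ->; case: eqP; rewrite ?scale1r ?scale0r.
Qed.

Lemma ucorep_antipoder i j : \sum_k v i k * antipode (v k j) = (i == j)%:R.
Proof.
have := antipoder (v i j).
rewrite (tlift_comul_corep _ _ (ucorep_comul vP)); last by mlin.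
by rewrite (ucorep_counit vP) => ->; case: eqP; rewrite ?scale1r ?scale0r.
Qed.

(** S(v) and the adjoint of v are both inverses of the matrix v. *)
Lemma antipode_ucorep i j : antipode (v i j) = star (v j i).
Proof.
transitivity (\sum_l antipode (v i l) * (\sum_k v l k * star (v j k))).
  under eq_bigr => l _ do rewrite ucorepVE.
  rewrite (bigD1 j) //= eqxx mulr1 big1 ?addr0 // => l /negbTE ->.
  by rewrite mulr0.
under eq_bigr => l _ do rewrite mulr_sumr.
rewrite exchange_big /=.
transitivity (\sum_k (i == k)%:R * star (v j k)).
  apply: eq_bigr => k _; rewrite -ucorep_antipodel mulr_suml.
  by apply: eq_bigr => l _; rewrite mulrA.
rewrite (bigD1 i) //= eqxx mul1r big1 ?addr0 // => l /negbTE.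
by rewrite eq_sym => ->; rewrite mul0r.
Qed.

End Unitary.
End StarBasics.

Local Open Scope sesquilinear_scope.

(** * Orthogonal projections and Hermitian forms *)

Section FrobeniusProjection.
Variables (C : numClosedFieldType) (n : nat).
Implicit Types A B N : 'M[C]_n.

Definition frobenius A B : C := \tr (A *m B ^t*).

Lemma frobeniusDl A A' B : frobenius (A + A') B = frobenius A B + frobenius A' B.
Proof. by rewrite /frobenius mulmxDl mxtraceD. Qed.

Lemma frobeniusZl c A B : frobenius (c *: A) B = c * frobenius A B.
Proof. by rewrite /frobenius -scalemxAl mxtraceZ. Qed.

Lemma frobeniusC A B : frobenius A B = (frobenius B A)^*.
Proof.
rewrite /frobenius -mxtrace_tr trmx_mul -[B in LHS]trmxCK.
rewrite /mxtrace rmorph_sum; apply: eq_bigr => i _.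
rewrite !mxE rmorph_sum; apply: eq_bigr => j _.
by rewrite !mxE rmorphM /= !conjCK.
Qed.

Lemma frobenius_eq0 A : frobenius A A = 0 -> A = 0.
Proof.
rewrite /frobenius /mxtrace => e; apply/matrixP => i j; rewrite mxE.
have p k : true -> 0 <= (A *m A^t*) k k.
  by move=> _; rewrite mxE; apply: sumr_ge0 => l _; rewrite !mxE mul_conjC_ge0.
have := psumr_eq0P p e; move/(_ i isT); rewrite mxE => ei.
have q l : true -> 0 <= A i l * A^t* l i by move=> _; rewrite !mxE mul_conjC_ge0.
have := psumr_eq0P q ei; move/(_ j isT)/eqP.
by rewrite !mxE mul_conjC_eq0 => /eqP.
Qed.

Lemma frobeniusMl N A B : frobenius (N *m A) B = frobenius A (N^t* *m B).
Proof.
rewrite /frobenius mxtrace_mulC trmx_mul map_mxM trmxCK.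
by rewrite -[RHS]mxtrace_mulC -mulmxA mxtrace_mulC -mulmxA mxtrace_mulC.
Qed.

Lemma frobeniusMr N A B : frobenius (A *m N) B = frobenius A (B *m N^t*).
Proof. by rewrite /frobenius trmx_mul map_mxM trmxCK mulmxA. Qed.

(** The middle clause puts m in the double orthogonal of X. It lets the induction turn orthogonality
    to x' = x - mx back into orthogonality to x. *)
Lemma frobenius_gram_schmidt (P : 'M[C]_n -> Prop) (X : seq 'M[C]_n) e :
    (forall c A B, P A -> P B -> P (c *: A + B)) -> P 0 -> {in X, forall x, P x} ->
  exists m, [/\ P m, forall z, {in X, forall x, frobenius z x = 0} -> frobenius z m = 0
    & {in X, forall x, frobenius (e - m) x = 0}].
Proof.
move=> Plin P0; have f0 z : frobenius z 0 = 0.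
  by rewrite /frobenius trmx0 map_mx0 mulmx0 mxtrace0.
have fDr z c A B : frobenius z (c *: A + B) = c^* * frobenius z A + frobenius z B.
  rewrite frobeniusC frobeniusDl frobeniusZl rmorphD rmorphM /=.
  by rewrite -!(frobeniusC z).
elim: X e => [|x X IH] e XP; first by exists 0; split.
have [y yX|mx [mxP mxo mxe]] := IH x; first by apply: XP; rewrite inE yX orbT.
have [y yX|me [meP meo mee]] := IH e; first by apply: XP; rewrite inE yX orbT.
have xP : P x by apply: XP; rewrite inE eqxx.
pose x' := x - mx; pose c := frobenius (e - me) x' / frobenius x' x'.
have x'P : P x' by rewrite /x' addrC -scaleN1r; apply: Plin.
have fx' z : frobenius z x' = frobenius z x - frobenius z mx.
  by rewrite /x' addrC -scaleN1r fDr rmorphN rmorph1 mulN1r addrC.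
exists (c *: x' + me); split; first exact: Plin.
  move=> z zX; have zX' : {in X, forall x, frobenius z x = 0}.
    by move=> y yX; rewrite zX // inE yX orbT.
  rewrite fDr meo // fx' mxo // subr0 zX ?inE ?eqxx //.
  by rewrite mulr0 addr0.
have fe z : frobenius (e - (c *: x' + me)) z = frobenius (e - me) z - c * frobenius x' z.
  by rewrite opprD addrCA addrC frobeniusDl -scaleNr frobeniusZl mulNr.
have eX : {in X, forall y, frobenius (e - (c *: x' + me)) y = 0}.
  by move=> y yX; rewrite fe mee // mxe // mulr0 subr0.
move=> y; rewrite inE => /orP[/eqP->|/eX //].
have : frobenius (e - (c *: x' + me)) x' = 0.
  (* If x' has norm 0 it vanishes, and there is nothing to correct. *)
  rewrite fe /c; have [e0|n0] := eqVneq (frobenius x' x') 0.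
    by rewrite (frobenius_eq0 e0) !f0 mulr0 subr0.
  by rewrite divfK // subrr.
by rewrite fx' (mxo _ eX) subr0.
Qed.

(** A subspace of maximal dimension inside the predicate [P] contains all of [P]; its basis feeds
    Gram-Schmidt. *)
Lemma frobenius_projection (P : 'M[C]_n -> Prop) e :
    (forall c A B, P A -> P B -> P (c *: A + B)) -> P 0 ->
  exists2 m, P m & forall x, P x -> frobenius (e - m) x = 0.
Proof.
move=> Plin P0.
pose Q d := `[< exists2 U : {vspace 'M[C]_n}, \dim U = d & forall x, x \in U -> P x >].
have Q0 : exists d, Q d.
  exists 0%N; apply/asboolP; exists 0%VS; rewrite ?dimv0 // => x.
  by rewrite memv0 => /eqP->.
have Qle d : Q d -> (d <= \dim {:'M[C]_n})%N.
  by move/asboolP=> [U <- _]; rewrite dimvS // subvf.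
have [d /asboolP[U dU UP] dmax] := ex_maxnP Q0 Qle.
have PU x : P x -> x \in U.
  move=> Px; apply: contraT => xU.
  have : Q (\dim (U + <[x]>)).
    apply/asboolP; exists (U + <[x]>)%VS => // y /memv_addP[a aU [b]].
    by move=> /vlineP[c ->] ->; rewrite addrC; apply: Plin => //; exact: UP.
  move/dmax; rewrite -dU (geq_leqif (dimv_leqif_sup (addvSl U <[x]>))).
  by rewrite subv_add subvv -memvE (negbTE xU).
have [|m [mP _ me]] := frobenius_gram_schmidt (X := vbasis U) e Plin P0.
  by move=> x /vbasis_mem/UP.
exists m => // x /PU xU; rewrite (coord_vbasis xU).
elim/big_ind: _ => [|y z Hy Hz|i _].
- by rewrite /frobenius trmx0 map_mx0 mulmx0 mxtrace0.
- by rewrite frobeniusC frobeniusDl rmorphD /= -!frobeniusC Hy Hz addr0.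
rewrite frobeniusC frobeniusZl rmorphM /= -frobeniusC me ?mulr0 //.
by apply: memt_nth.
Qed.

End FrobeniusProjection.

(** Spectral theorem: the rows of the diagonalising unitary are left eigenvectors, so the form is a
    combination of squared moduli with coefficients [d 0 p] that are nonnegative. *)
Lemma hermitian_form_ge0 (C : numClosedFieldType) n (N : 'M[C]_n) :
    (forall i k, N k i = (N i k)^*) ->
    (forall lam (y : 'I_n -> C), (exists k, y k != 0) ->
       (forall k, \sum_i y i * N i k = lam * y k) -> 0 <= lam) ->
  forall y : 'I_n -> C, 0 <= \sum_i \sum_k y i * (y k)^* * N i k.
Proof.
move=> Nh Nev y.
have Nn : N \is normalmx.
  apply/normalmxP; have -> // : N^t* = N.
  by apply/matrixP => i k; rewrite !mxE -Nh.
have /orthomx_spectralP := Nn.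
set P := spectralmx N; set d := spectral_diag N => NE.
have PU : P \is unitarymx by exact: spectral_unitarymx.
have Pi : P \in unitmx by exact: spectral_unit.
have PN : P *m N = diag_mx d *m P by rewrite {1}NE !mulmxA mulmxV // mul1mx.
have d0 p : 0 <= d 0 p.
  apply: (Nev _ (fun i => P p i)).
    have /unitarymxP/matrixP/(_ p p) := PU; rewrite mxE [in RHS]mxE eqxx => e.
    apply: contrapT => nz; move: e; rewrite big1 => [/eqP|k _].
      by rewrite eq_sym oner_eq0.
    by have [->|pk] := eqVneq (P p k) 0; rewrite ?mul0r //; case: nz; exists k.
  move=> k; have /matrixP/(_ p k) := PN; rewrite mxE => ->.
  rewrite mxE (bigD1 p) //= big1 ?addr0 => [|l lp].
    by rewrite mxE eqxx mulr1n.
  by rewrite mxE eq_sym (negbTE lp) mulr0n mul0r.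
pose Y : 'rV[C]_n := \row_i y i; pose Z := Y *m P^t*.
have -> : \sum_i \sum_k y i * (y k)^* * N i k = (Y *m N *m Y^t*) 0 0.
  rewrite exchange_big mxE; apply: eq_bigr => k _.
  rewrite mxE mulr_suml; apply: eq_bigr => i _.
  by rewrite !mxE mulrAC.
have -> : Y *m N *m Y^t* = Z *m diag_mx d *m Z^t*.
  rewrite NE invmx_unitary // /Z trmx_mul map_mxM trmxCK !mulmxA //.
rewrite mxE; apply: sumr_ge0 => k _; rewrite mul_mx_diag 3!mxE.
by rewrite mulrAC mulr_ge0 // !mxE mul_conjC_ge0.
Qed.

(** * Matrix coefficients and existence of the Haar functional *)

Section Haar.
Variables (R : realType) (H : hopfAlgType R[i]) (star : H -> H).
Hypothesis sP : hopf_star star.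
Local Notation C := R[i].
Local Notation unitary := (unitary_corep star).

Definition coefficient n (v : 'M[H]_n) (a : H) : Prop :=
  exists X : 'M[C]_n, a = \sum_i \sum_j X i j *: v i j.

Lemma coefficient_lin n (v : 'M[H]_n) c a b :
  coefficient v a -> coefficient v b -> coefficient v (c *: a + b).
Proof.
move=> [X ->] [Y ->]; exists (c *: X + Y).
rewrite scaler_sumr -big_split /=; apply: eq_bigr => i _.
rewrite scaler_sumr -big_split /=; apply: eq_bigr => j _.
by rewrite !mxE scalerDl scalerA.
Qed.

Lemma coefficient_entry n (v : 'M[H]_n) i j : coefficient v (v i j).
Proof.
exists (delta_mx i j); rewrite (bigD1 i) //= [X in _ + X]big1 ?addr0 => [|k nk].
  rewrite (bigD1 j) //= big1 ?addr0 => [|l nl].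
    by rewrite mxE !eqxx scale1r.
  by rewrite mxE eqxx (negbTE nl) scale0r.
by rewrite big1 // => l _; rewrite mxE (negbTE nk) scale0r.
Qed.

Lemma ucorep0 : unitary (0 : 'M[H]_0).
Proof.
by split=> [[]|[]||] //; apply/matrixP => -[].
Qed.

Lemma ucorep_block n m (v : 'M[H]_n) (w : 'M[H]_m) :
  unitary v -> unitary w -> unitary (block_mx v 0 0 w).
Proof.
move=> vP wP.
have p0l (x : H) : (0 : H) ⊗ x = 0 by exact: (lin1_0 (f := fun y => y ⊗ x)) (pure_linearl x).
have p0r (x : H) : x ⊗ (0 : H) = 0 by exact: (lin1_0 (f := pure x)) (pure_linearr x).
have c0 : comul (0 : H) = 0 by exact: lin1_0 (comul_linear (s := H)).
have e0 : counit (0 : H) = 0.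
  exact: (lin1_0 (V := C^o) (f := @counit C H)) (counit_linear (s := H)).
split=> [i j|i j||].
- case: (split_ordP i) => i' ->; case: (split_ordP j) => j' ->;
  rewrite big_split_ord /= ?block_mxEul ?block_mxEur ?block_mxEdl ?block_mxEdr.
  + rewrite (ucorep_comul vP) [X in _ = _ + X]big1 ?addr0 => [|l _].
      by apply: eq_bigr => l _; rewrite !block_mxEul.
    by rewrite block_mxEur block_mxEdl mxE p0l.
  + rewrite mxE c0 !big1 ?addr0 // => l _; first by rewrite block_mxEur block_mxEdr mxE p0l.
    by rewrite block_mxEul block_mxEur mxE p0r.
  + rewrite mxE c0 !big1 ?addr0 // => l _; first by rewrite block_mxEdr block_mxEdl mxE p0r.
    by rewrite block_mxEdl block_mxEul mxE p0l.
  + rewrite (ucorep_comul wP) [X in _ = X + _]big1 ?add0r => [|l _].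
      by apply: eq_bigr => l _; rewrite !block_mxEdr.
    by rewrite block_mxEur block_mxEdl mxE p0l.
- case: (split_ordP i) => i' ->; case: (split_ordP j) => j' ->;
  rewrite ?block_mxEul ?block_mxEur ?block_mxEdl ?block_mxEdr.
  + by rewrite (ucorep_counit vP) (inj_eq (@lshift_inj _ _)).
  + by rewrite mxE e0 eq_lrshift.
  + by rewrite mxE e0 eq_rlshift.
  + by rewrite (ucorep_counit wP) (inj_eq (@rshift_inj _ _)).
- have s0 p q : map_mx star (0 : 'M[H]_(p, q)) = 0.
    by apply/matrixP => i j; rewrite !mxE (star0 sP).
  rewrite map_block_mx tr_block_mx mulmx_block !s0 !trmx0 !mulmx0 !mul0mx !addr0 !add0r.
  by rewrite (ucorepV vP) (ucorepV wP) -scalar_mx_block.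
- have s0 p q : map_mx star (0 : 'M[H]_(p, q)) = 0.
    by apply/matrixP => i j; rewrite !mxE (star0 sP).
  rewrite map_block_mx tr_block_mx mulmx_block !s0 !trmx0 !mulmx0 !mul0mx !addr0 !add0r.
  by rewrite (ucorepVl vP) (ucorepVl wP) -scalar_mx_block.
Qed.

Lemma coefficient_blockl n m (v : 'M[H]_n) (w : 'M[H]_m) a :
  coefficient v a -> coefficient (block_mx v 0 0 w) a.
Proof.
move=> [X ->]; elim/big_ind: _ => [|b c hb hc|i _].
- exists 0; rewrite big1 // => i _; rewrite big1 // => j _.
  by rewrite mxE scale0r.
- by rewrite -[b]scale1r; exact: coefficient_lin.
elim/big_ind: _ => [|b c hb hc|j _].
- exists 0; rewrite big1 // => k _; rewrite big1 // => j _.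
  by rewrite mxE scale0r.
- by rewrite -[b]scale1r; exact: coefficient_lin.
rewrite -(block_mxEul v 0 0 w) -[_ *: _]addr0; apply: coefficient_lin.
  exact: coefficient_entry.
by exists 0; rewrite big1 // => k _; rewrite big1 // => l _; rewrite mxE scale0r.
Qed.

Lemma coefficient_blockr n m (v : 'M[H]_n) (w : 'M[H]_m) a :
  coefficient w a -> coefficient (block_mx v 0 0 w) a.
Proof.
have c0 k (u : 'M[H]_k) : coefficient u 0.
  by exists 0; rewrite big1 // => i _; rewrite big1 // => l _; rewrite mxE scale0r.
move=> [X ->]; elim/big_ind: _ => [|b c hb hc|i _]; first exact: c0.
  by rewrite -[b]scale1r; exact: coefficient_lin.
elim/big_ind: _ => [|b c hb hc|j _]; first exact: c0.
  by rewrite -[b]scale1r; exact: coefficient_lin.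
rewrite -(block_mxEdr v 0 0 w) -[_ *: _]addr0; apply: coefficient_lin => //.
exact: coefficient_entry.
Qed.

Lemma map_conv n (v : 'M[H]_n) (f g : H -> C) : unitary v ->
  @lin1 _ _ C^o f -> @lin1 _ _ C^o g ->
  map_mx (conv f g) v = map_mx f v *m map_mx g v.
Proof.
move=> vP lf lg; apply/matrixP => i j; rewrite !mxE convE.
rewrite (tlift_comul_corep _ _ (ucorep_comul vP)); last by mlin.
by apply: eq_bigr => l _; rewrite !mxE.
Qed.

(* The span of matrices phi v, phi 1 = 0, is a two-sided *-closed ideal I; the
   orthogonal projection of the identity off I is the mean. *)
Lemma corep_mean n (v : 'M[H]_n) : unitary v ->
  exists p : {scalar H}, p 1 = 1 /\ forall phi : {scalar H},
    map_mx phi v *m map_mx p v = phi 1 *: map_mx p v /\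
    map_mx p v *m map_mx phi v = phi 1 *: map_mx p v.
Proof.
move=> vP; pose I A := exists phi : {scalar H}, phi 1 = 0 /\ A = map_mx phi v.
have convS (f g : {scalar H}) : exists h : {scalar H}, h =1 conv f g.
  by apply: scalar_of; apply: lin1_conv; exact: lin1_scalar.
have conv1 (f g : {scalar H}) : conv f g 1 = f 1 * g 1.
  rewrite convE comul1 (@tlift_pureE _ _ _ C^o) //.
  by split=> x; mlin.
have mapconv (f g h : {scalar H}) : h =1 conv f g ->
    map_mx h v = map_mx f v *m map_mx g v.
  move=> hE; rewrite -map_conv //; [|exact: lin1_scalar|exact: lin1_scalar].
  by apply/matrixP => i j; rewrite !mxE hE.
have Ilin c A B : I A -> I B -> I (c *: A + B).
  move=> [f [f1 ->]] [g [g1 ->]].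
  have lh := @lin1_comb _ H C^o f g c (lin1_scalar f) (lin1_scalar g).
  have [h hE] := scalar_of lh; exists h; rewrite hE f1 g1 scaler0 addr0; split=> //.
  by apply/matrixP => i j; rewrite !mxE hE.
have I0 : I 0.
  have [h hE] := scalar_of (@lin1_cst0 _ H C^o); exists h; rewrite hE; split=> //.
  by apply/matrixP => i j; rewrite !mxE hE.
have [_ [f0 [f01 ->]] fo] := frobenius_projection 1%:M Ilin I0.
(* p = epsilon - f0, so that p(v) is the part of the identity matrix orthogonal to [I] and p(1) =
   1. *)
have lp := @lin1_comb _ H C^o f0 (@counit C H) (-1) (lin1_scalar f0) (counit_linear (s := H)).
have [p pE] := scalar_of lp; exists p.
have p1 : p 1 = 1 by rewrite pE f01 scaler0 add0r counit1.
have pv : 1%:M - map_mx f0 v = map_mx p v.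
  apply/matrixP => i j; rewrite !mxE pE (ucorep_counit vP) scaleN1r addrC.
  by rewrite eq_sym.
rewrite pv in fo.
have Istar A : I A -> I (A^t*).
  move=> [f [fz ->]]; have lf := lin1_scalar f.
  have lS : lin1 (@antipode C H) by exact: antipode_linear.
  (* Unitarity gives S(v_ij) = star v_ji, so the adjoint of f(v) is g(v) with g(a) =
     conj(f(star(S(a)))). *)
  have lg := lin1_comp (lin1_conj_star sP lf) lS.
  have [g gE] := scalar_of lg; exists g; rewrite gE antipode1 (star1 sP) fz rmorph0.
  split=> //; apply/matrixP => i j; rewrite !mxE gE (antipode_ucorep vP) (starKE sP) //.
have IM A (f : {scalar H}) : I A -> I (A *m map_mx f v) /\ I (map_mx f v *m A).
  move=> [g [g1 ->]]; split.
    have [h hE] := convS g f; exists h; rewrite hE conv1 g1 mul0r; split=> //.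
    by rewrite (mapconv _ _ _ hE).
  have [h hE] := convS f g; exists h; rewrite hE conv1 g1 mulr0; split=> //.
  by rewrite (mapconv _ _ _ hE).
(* The squared norm of A p(v) is the product of p(v) with A^* A p(v), which lies in the ideal and is
   orthogonal to p(v). *)
have Ip A : I A -> A *m map_mx p v = 0 /\ map_mx p v *m A = 0.
  move=> IA; have [f [f1 fE]] := IA; have [g [g1 gE]] := Istar _ IA; split.
    apply: frobenius_eq0; rewrite frobeniusMl; apply: fo; rewrite gE.
    by apply: (IM _ g _).2; apply: (IM _ p _).1.
  apply: frobenius_eq0; rewrite frobeniusMr; apply: fo; rewrite gE.
  by apply: (IM _ g _).1; apply: (IM _ p _).2.
split=> // phi.
(* phi - phi(1) epsilon vanishes at 1, so its matrix lies in [I] and kills p(v). *)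
have lq := @lin1_comb _ H C^o (@counit C H) phi (- phi 1) (counit_linear (s := H)) (lin1_scalar phi).
have [q qE] := scalar_of lq.
have Iq : I (map_mx q v).
  by exists q; split=> //; rewrite qE counit1 -[_ *: _]/(_ * _) mulr1 addNr.
have phiE : map_mx phi v = map_mx q v + (phi 1)%:M.
  apply/matrixP => i j; rewrite !mxE qE (ucorep_counit vP) -[_ *: _]/(_ * _).
  by rewrite addrAC mulr_natr mulNrn addNr add0r.
have [e1 e2] := Ip _ Iq.
by rewrite phiE mulmxDl mulmxDr e1 e2 !add0r mul_scalar_mx mul_mx_scalar.
Qed.

Hypothesis spanP : forall h, exists2 s : seq (C * H),
  forall p, p \in s -> unitary_coefficient star p.2 & h = \sum_(p <- s) p.1 *: p.2.

Lemma coefficient_exists a :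
  exists n (v : 'M[H]_n), unitary v /\ coefficient v a.
Proof.
have [s sP' ->] := spanP a; elim: s sP' => [|p s IH] sP'.
  exists 0%N, 0; split; first exact: ucorep0.
  by exists 0; rewrite big_nil big_ord0.
have [q qs|n [v [vP va]]] := IH; first by apply: sP'; rewrite inE qs orbT.
have [|m [w [i [j [wP pE]]]]] := sP' p; first by rewrite inE eqxx.
exists (m + n)%N, (block_mx w 0 0 v); split; first exact: ucorep_block.
rewrite big_cons; apply: coefficient_lin; last exact: coefficient_blockr.
by apply: coefficient_blockl; rewrite pE; exact: coefficient_entry.
Qed.

(** A coefficient matrix of rank one suffices once each summand has its own diagonal block, because
    the cross terms meet zero blocks. [haar_ge0] depends on this form. *)
Lemma matrix_element_exists a : exists n (v : 'M[H]_n) (y x : 'I_n -> C),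
  unitary v /\ a = \sum_i \sum_j (y i * x j) *: v i j.
Proof.
have [s sP' ->] := spanP a; elim: s sP' => [|p s IH] sP'.
  exists 0%N, 0, (fun=> 0), (fun=> 0); split; first exact: ucorep0.
  by rewrite big_nil big_ord0.
have [q qs|n [v [y [x [vP vE]]]]] := IH; first by apply: sP'; rewrite inE qs orbT.
have [|m [w [i [j [wP pE]]]]] := sP' p; first by rewrite inE eqxx.
pose y' k := match split k with inl l => p.1 *+ (l == i) | inr l => y l end.
pose x' k := match split k with inl l => (l == j)%:R | inr l => x l end.
exists (m + n)%N, (block_mx w 0 0 v), y', x'; split; first exact: ucorep_block.
rewrite big_cons vE big_split_ord /=; congr (_ + _).
  transitivity (\sum_(k < m) \sum_(l < m) ((p.1 *+ (k == i)) * (l == j)%:R) *: w k l).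
    rewrite (bigD1 i) //= [X in _ + X]big1 ?addr0 => [|k /negbTE ->]; last first.
      by rewrite big1 // => l _; rewrite mul0r scale0r.
    rewrite (bigD1 j) //= [X in _ + X]big1 ?addr0 => [|k /negbTE ->].
      by rewrite !eqxx mulr1 pE.
    by rewrite mulr0 scale0r.
  apply: eq_bigr => k _; rewrite big_split_ord /= [X in _ = _ + X]big1 ?addr0 => [|l _].
    by apply: eq_bigr => l _; rewrite block_mxEul /y' /x' !(unsplitK (inl _)).
  by rewrite block_mxEur mxE scaler0.
apply: eq_bigr => k _; rewrite big_split_ord /= [X in _ = X + _]big1 ?add0r => [|l _].
  by apply: eq_bigr => l _; rewrite block_mxEdr /y' /x' !(unsplitK (inr _)).
by rewrite block_mxEdl mxE scaler0.
Qed.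

Lemma coefficient_exists2 a b :
  exists n (v : 'M[H]_n), [/\ unitary v, coefficient v a & coefficient v b].
Proof.
have [n [v [vP va]]] := coefficient_exists a.
have [m [w [wP wb]]] := coefficient_exists b.
exists (n + m)%N, (block_mx v 0 0 w).
by split; [exact: ucorep_block|exact: coefficient_blockl|exact: coefficient_blockr].
Qed.

Lemma corep_ext (W : lmodType C) (f g : H -> W) : lin1 f -> lin1 g ->
  (forall n (v : 'M[H]_n) i j, unitary v -> f (v i j) = g (v i j)) -> f =1 g.
Proof.
move=> lf lg e a; have [n [v [vP [X ->]]]] := coefficient_exists a.
rewrite !(lin1_sum lf, lin1_sum lg); apply: eq_bigr => i _.
rewrite !(lin1_sum lf, lin1_sum lg); apply: eq_bigr => j _.
by rewrite (lin1Z lf) (lin1Z lg) e.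
Qed.

Definition is_haar (h : H -> C) : Prop := [/\ @lin1 _ _ C^o h, h 1 = 1,
  forall x, \tsum_(a ⊗ b <- comul x) h b *: a = h x *: 1 &
  forall x, \tsum_(a ⊗ b <- comul x) h a *: b = h x *: 1].

(** Both values equal (h' ⊗ h) Delta(x). *)
Lemma haar_unique h h' : is_haar h -> is_haar h' -> h =1 h'.
Proof.
move=> [lh h1 hl hr] [lh' h1' hl' hr'] x.
transitivity (h' (h x *: 1)); first by rewrite (lin1Z lh') h1' [RHS]mulr1.
rewrite -hl (lin1_tliftE (X := C^o) _ lh').
transitivity (h (h' x *: 1)); last by rewrite (lin1Z lh) h1 [LHS]mulr1.
rewrite -hr' (lin1_tliftE (X := C^o) _ lh).
apply: (@eq_tlift _ _ _ C^o) => a b.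
by rewrite (lin1Z lh) (lin1Z lh') [LHS]mulrC.
Qed.

(** Each corepresentation has its own mean. Any two functionals that are means at a agree at a, so
    the pointwise choice is linear: two elements always share a corepresentation. *)
Lemma haar_exists : exists h, is_haar h.
Proof.
pose good (p : {scalar H}) a := p 1 = 1 /\
  forall phi : {scalar H}, conv phi p a = phi 1 * p a /\ conv p phi a = phi 1 * p a.
have good_unique p q a : good p a -> good q a -> p a = q a.
  move=> [p1 pP] [q1 qP]; have [_] := pP q; have [+ _] := qP p.
  by rewrite p1 q1 !mul1r => -> ->.
have good_corep n (v : 'M[H]_n) : unitary v ->
    exists p, forall a, coefficient v a -> good p a.
  move=> vP; have [p [p1 pP]] := corep_mean vP; exists p => a [X ->]; split=> // phi.
  have lp := lin1_scalar p; have lphi := lin1_scalar phi.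
  have E i j : conv phi p (v i j) = phi 1 * p (v i j) /\ conv p phi (v i j) = phi 1 * p (v i j).
    have [/matrixP/(_ i j) e1 /matrixP/(_ i j) e2] := pP phi.
    by rewrite -!map_conv // !mxE in e1 e2.
  have lc1 := lin1_conv lphi lp; have lc2 := lin1_conv lp lphi.
  split; rewrite ?(lin1_sum lc1) ?(lin1_sum lc2) linear_sum mulr_sumr; apply: eq_bigr => i _;
  rewrite ?(lin1_sum lc1) ?(lin1_sum lc2) linear_sum mulr_sumr; apply: eq_bigr => j _;
  rewrite ?(lin1Z lc1) ?(lin1Z lc2) linearZ /= -[_ *: conv _ _ _]/(_ * _).
    by rewrite (E i j).1 mulrCA.
  by rewrite (E i j).2 mulrCA.
have good_exists a : exists p, good p a.
  have [n [v [vP va]]] := coefficient_exists a.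
  by have [p pP] := good_corep n v vP; exists p; exact: pP.
have [P PP] := choice good_exists.
pose h a := P a a.
have hE p a : good p a -> h a = p a by move=> pa; exact: good_unique (PP a) pa.
have lh : @lin1 _ _ C^o h.
  move=> c a b; have [n [v [vP va vb]]] := coefficient_exists2 a b.
  have [p pP] := good_corep n v vP.
  rewrite (hE p) ?(hE p a) ?(hE p b); try exact: pP; first by rewrite linearP.
  by apply: pP; exact: coefficient_lin.
have hcorep n (v : 'M[H]_n) i j p : (forall a, coefficient v a -> good p a) ->
  h (v i j) = p (v i j) by move=> pP; apply: hE; apply: pP; exact: coefficient_entry.
exists h; split=> //.
- have [n [v [vP va]]] := coefficient_exists 1.
  by have [p pP] := good_corep n v vP; rewrite (hE p) ?(pP _ va).1 //; exact: pP.
- apply: corep_ext => [||n v i j vP]; [by mlin | by mlin |].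
  have [p pP] := good_corep n v vP; have lp := lin1_scalar p.
  rewrite (hcorep _ _ _ _ _ pP) (tlift_comul_corep _ _ (ucorep_comul vP)); last by mlin.
  apply: separation => phi; rewrite linear_sum linearZ /=.
  have [_ /(_ phi) [e _]] := pP _ (coefficient_entry v i j).
  rewrite mulrC -e convE (tlift_comul_corep _ _ (ucorep_comul vP)); last by mlin.
  by apply: eq_bigr => l _; rewrite linearZ /= (hcorep _ _ _ _ _ pP) mulrC.
- apply: corep_ext => [||n v i j vP]; [by mlin | by mlin |].
  have [p pP] := good_corep n v vP; have lp := lin1_scalar p.
  rewrite (hcorep _ _ _ _ _ pP) (tlift_comul_corep _ _ (ucorep_comul vP)); last by mlin.
  apply: separation => phi; rewrite linear_sum linearZ /=.
  have [_ /(_ phi) [_ e]] := pP _ (coefficient_entry v i j).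
  rewrite mulrC -e convE (tlift_comul_corep _ _ (ucorep_comul vP)); last by mlin.
  by apply: eq_bigr => l _; rewrite linearZ /= (hcorep _ _ _ _ _ pP).
Qed.

End Haar.

(** * Positivity and faithfulness of the Haar functional *)

Section HaarProperties.
Variables (R : realType) (H : hopfAlgType R[i]) (star : H -> H).
Local Notation C := R[i].
Local Notation unitary := (unitary_corep star).
Hypothesis sP : hopf_star star.
Hypothesis spanP : forall h, exists2 s : seq (C * H),
  forall p, p \in s -> unitary_coefficient star p.2 & h = \sum_(p <- s) p.1 *: p.2.
Variable h : H -> C.
Hypothesis hP : is_haar h.

Local Notation Sinv := (star_antipode star).
Let lS : lin1 (@antipode C H). Proof. exact: antipode_linear. Qed.
Let lSi : lin1 Sinv. Proof. exact: lin1_star_antipode. Qed.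
Let lh : @lin1 _ _ C^o h. Proof. by case: hP. Qed.
Let h1 : h 1 = 1. Proof. by case: hP. Qed.

Lemma haar_left (W : lmodType C) (G : H -> W) x : lin1 G ->
  \tsum_(a ⊗ b <- comul x) h b *: G a = h x *: G 1.
Proof.
move=> lG; have [_ _ e _] := hP; rewrite -(lin1Z lG) -e (lin1_tliftE G) //.
by apply: eq_tlift => a b; rewrite (lin1Z lG).
Qed.

Lemma haar_right (W : lmodType C) (G : H -> W) x : lin1 G ->
  \tsum_(a ⊗ b <- comul x) h a *: G b = h x *: G 1.
Proof.
move=> lG; have [_ _ _ e] := hP; rewrite -(lin1Z lG) -e (lin1_tliftE G) //.
by apply: eq_tlift => a b; rewrite (lin1Z lG).
Qed.

(** Uniqueness of the Haar functional, applied to conj(h(star a)); [haar_antipode] is proved the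
    same way. *)
Lemma haar_star a : h (star a) = (h a)^*.
Proof.
suff e : is_haar (fun a => (h (star a))^*).
  by rewrite [RHS](congr1 Num.conj (haar_unique hP e a)) conjCK.
clear a; split; [exact: lin1_conj_star | by rewrite (star1 sP) h1 rmorph1 | |] => x.
  rewrite -[LHS](starKE sP) star_tlift //.
  transitivity (star (h (star x) *: 1)); last by rewrite (starZ sP) (star1 sP).
  rewrite -(haar_left (star x) (@lin1_id _ H)) (star_comulW sP); last by mlin.
  by congr star; apply: eq_tlift => a b; rewrite (starZ sP) conjCK.
rewrite -[LHS](starKE sP) star_tlift //.
transitivity (star (h (star x) *: 1)); last by rewrite (starZ sP) (star1 sP).
rewrite -(haar_right (star x) (@lin1_id _ H)) (star_comulW sP); last by mlin.
by congr star; apply: eq_tlift => a b; rewrite (starZ sP) conjCK.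
Qed.

Lemma haar_antipode a : h (antipode a) = h a.
Proof.
suff e : is_haar (fun a => h (antipode a)) by exact: (haar_unique e hP a).
clear a; split; [by mlin | by rewrite antipode1 h1 | |] => x.
  rewrite -[1](star_antipodeK sP) antipode1 -(haar_right (antipode x)) //.
  rewrite comul_antipodeW; last by mlin.
  by apply: eq_tlift => a b; rewrite (star_antipodeK sP).
rewrite -[1](star_antipodeK sP) antipode1 -(haar_left (antipode x)) //.
rewrite comul_antipodeW; last by mlin.
by apply: eq_tlift => a b; rewrite (star_antipodeK sP).
Qed.

(** Strong invariance: expand h(b_1 c) 1 as h(b_1 c_1) b_2 c_2, then cancel S^-1(b_3) b_2. *)
Lemma haar_strong (W : lmodType C) (G : H -> W) b c : lin1 G ->
  \tsum_(c1 ⊗ c2 <- comul c) h (b * c1) *: G c2 =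
  \tsum_(b1 ⊗ b2 <- comul b) h (b1 * c) *: G (Sinv b2).
Proof.
move=> lG; symmetry.
transitivity (\tsum_(b1 ⊗ b2 <- comul b) \tsum_(x ⊗ y <- comul b1)
  \tsum_(c1 ⊗ c2 <- comul c) h (x * c1) *: G (Sinv b2 * (y * c2))).
  apply: eq_tlift => b1 b2; rewrite -[in LHS](mulr1 (Sinv b2)).
  rewrite -(haar_right _ (G := fun z => G (Sinv b2 * z))); last by mlin.
  by rewrite comulMW //; mlin.
rewrite (coassoc (F := fun x y z => \tsum_(c1 ⊗ c2 <- comul c)
  h (x * c1) *: G (Sinv z * (y * c2)))); last by mlin.
rewrite -[RHS](counitr (G := fun x => \tsum_(c1 ⊗ c2 <- comul c) h (x * c1) *: G c2));
  last by mlin.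
apply: eq_tlift => b1 b2; rewrite tlift_exchange (lin1_tliftE ( *:%R (counit b2))); last by mlin.
apply: eq_tlift => c1 c2.
transitivity (h (b1 * c1) *: G ((\tsum_(x ⊗ y <- comul b2) (Sinv y * x)) * c2)).
  rewrite (lin1_tliftE (fun z => h (b1 * c1) *: G (z * c2))); last by mlin.
  by apply: eq_tlift => x y; rewrite mulrA.
by rewrite star_antipodel // -scalerAl mul1r (lin1Z lG) !scalerA mulrC.
Qed.

(** By [haar_strong] the coproduct of an element of the radical has its left legs in the radical.
    There epsilon vanishes, since epsilon(x) = h(S^-1(x_2) x_1), so c = epsilon(c_1) c_2 = 0. *)
Lemma haar_nondegenerate c : (forall b, h (b * c) = 0) -> c = 0.
Proof.
pose L c := forall b, h (b * c) = 0.
have LE x : L x -> exists t : seq ({scalar H} * H),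
    comul x = \sum_(q <- t) (\tsum_(a ⊗ b <- comul x) q.1 b *: a) ⊗ q.2 /\
    forall q : {scalar H} * H, L (\tsum_(a ⊗ b <- comul x) q.1 b *: a).
  move=> Lx; have [t tP] := finite_rank_identity (map snd (repr (comul x))%qT).
  exists t; split.
    rewrite [LHS]tensor_sum.
    transitivity (\sum_(p <- (repr (comul x))%qT) \sum_(q <- t) (q.1 p.2 *: p.1) ⊗ q.2).
      rewrite big_seq [RHS]big_seq; apply: eq_bigr => p ps.
      rewrite [in LHS](tP p.2); last exact: map_f.
      rewrite (lin1_sum (f := pure p.1)); last by mlin.
      apply: eq_bigr => q _; rewrite (lin1Z (f := pure p.1)); last by mlin.
      by rewrite (lin1Z (f := fun y => y ⊗ q.2)) //; mlin.
    rewrite exchange_big; apply: eq_bigr => q _.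
    by rewrite [RHS](lin1_tliftE (fun y => y ⊗ q.2)) //; mlin.
  move=> q b; have lq := lin1_scalar q.1.
  rewrite (@lin1_tliftE _ _ _ _ C^o _ (fun y => h (b * y))); last by mlin.
  transitivity (@tlift C H H C^o (fun a c => h (b * a) * q.1 c) (comul x)).
    apply: (@eq_tlift _ _ _ C^o) => a d.
    by rewrite -scalerAr (lin1Z lh) [LHS]mulrC.
  have := @haar_strong C^o q.1 b x lq; rewrite /GRing.scale /= => ->.
  rewrite /tlift /fsum big1 // => p _.
  by rewrite Lx mul0r.
have Le x : L x -> counit x = 0.
  move=> Lx; have [t [tE tL]] := LE _ Lx.
  transitivity (h (counit x *: 1)); first by rewrite (lin1Z lh) h1 [RHS]mulr1.
  rewrite -(star_antipodel sP) (lin1_tliftE (X := C^o) _ lh) tE.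
  rewrite (@tlift_sum_pure _ _ _ C^o); last by mlin.
  by rewrite big1 // => q _; exact: tL.
move=> Lc; have [t [tE tL]] := LE _ Lc.
rewrite -[LHS](counitl (G := id)) // tE tlift_sum_pure; last by mlin.
by rewrite big1 // => q _; rewrite Le ?scale0r.
Qed.

Lemma haar_nondegenerater c : (forall b, h (c * b) = 0) -> c = 0.
Proof.
move=> e; rewrite -[c](starKE sP) (_ : star c = 0) ?(star0 sP) //.
apply: haar_nondegenerate => b.
by rewrite -[b](starKE sP) -(starM sP) haar_star e rmorph0.
Qed.

Lemma sum_delta (V : lmodType C) n (F : 'I_n -> V) j :
  \sum_k (k == j)%:R *: F k = F j.
Proof.
rewrite (bigD1 j) //= eqxx scale1r big1 ?addr0 // => k /negbTE ->.
by rewrite scale0r.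
Qed.

Section Eigenvalue.
Variables (n : nat) (v : 'M[H]_n) (x : 'I_n -> C).
Hypothesis vP : unitary v.

Definition column i := \sum_j x j *: v i j.
Local Notation a := column.

Lemma comul_column (W : lmodType C) (F : H -> H -> W) i : lin2 F ->
  tlift F (comul (a i)) = \sum_s F (v i s) (a s).
Proof.
move=> lF; have lT : lin1 (fun z => tlift F (comul z)) by mlin.
rewrite /column (lin1_sum lT).
under eq_bigr => j _.
  rewrite (lin1Z lT) (tlift_comul_corep _ _ (ucorep_comul vP)) //.
  rewrite scaler_sumr; over.
rewrite exchange_big; apply: eq_bigr => s _.
rewrite (lin1_sum (f := F (v i s))); last by mlin.
by apply: eq_bigr => j _; rewrite (lin1Z (f := F (v i s))) //; mlin.
Qed.

Lemma comul_star_column (W : lmodType C) (F : H -> H -> W) i : lin2 F ->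
  tlift F (comul (star (a i))) = \sum_s F (star (v i s)) (star (a s)).
Proof.
move=> lF; have := star_comul sP (h := a i)
  (s := [seq (v i l, a l) | l <- index_enum 'I_n]).
rewrite !big_map => -> /=; first by rewrite tlift_sum_pure.
by rewrite -comul_column ?tlift_pure_id //; mlin.
Qed.

Definition gram i k := h (a i * star (a k)).
Local Notation N := gram.

Lemma gram_conj i k : N k i = (N i k)^*.
Proof. by rewrite -haar_star (starM sP) (starKE sP). Qed.

(** Invariance of h says that v N v^* = N; multiplying by v on the right shows that N commutes with
    v. *)
Lemma gram_corep i l : \sum_s N s l *: v i s = \sum_k N i k *: v k l.
Proof.
have E k : \sum_s \sum_t N s t *: (v i s * star (v k t)) = N i k *: 1.
  rewrite -(haar_left (a i * star (a k)) (@lin1_id _ H)).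
  rewrite comulMW; last by mlin.
  rewrite comul_column; last by mlin.
  by apply: eq_bigr => s _; rewrite comul_star_column //; mlin.
transitivity (\sum_k (\sum_s \sum_t N s t *: (v i s * star (v k t))) * v k l); last first.
  by apply: eq_bigr => k _; rewrite E -scalerAl mul1r.
under [RHS]eq_bigr => k _ do rewrite mulr_suml.
rewrite exchange_big; apply: eq_bigr => s _ /=.
under [RHS]eq_bigr => k _ do rewrite mulr_suml.
rewrite exchange_big /= -(sum_delta (fun t => N s t *: v i s) l).
apply: eq_bigr => t _; rewrite scalerA mulrC -scalerA.
transitivity (N s t *: (v i s * \sum_k star (v k t) * v k l)).
  rewrite (ucorepVlE vP); case: (t == l); rewrite ?scale1r ?mulr1 ?scale0r ?mulr0 //.
rewrite mulr_sumr scaler_sumr; apply: eq_bigr => k _.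
by rewrite -scalerAl mulrA.
Qed.

Variables (lam : C) (y : 'I_n -> C).
Hypothesis y_eigen : forall k, \sum_i y i * N i k = lam * y k.

Let f k := \sum_i y i *: v i k.
Let e := \sum_i y i *: a i.

Lemma eigen_corep k : \sum_j N j k *: f j = lam *: f k.
Proof.
transitivity (\sum_i y i *: \sum_j N j k *: v i j).
  rewrite /f; under eq_bigr => j _ do rewrite scaler_sumr.
  rewrite exchange_big; apply: eq_bigr => i _ /=; rewrite scaler_sumr.
  by apply: eq_bigr => j _; rewrite !scalerA mulrC.
under eq_bigr => i _ do rewrite gram_corep scaler_sumr.
rewrite exchange_big /= /f scaler_sumr; apply: eq_bigr => l _.
rewrite scalerA -y_eigen scaler_suml; apply: eq_bigr => i _.
by rewrite scalerA.
Qed.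

Lemma comul_eigen (W : lmodType C) (F : H -> H -> W) : lin2 F ->
  tlift F (comul e) = \sum_j F (f j) (a j).
Proof.
move=> lF; have lT : lin1 (fun z => tlift F (comul z)) by mlin.
rewrite /e (lin1_sum lT).
under eq_bigr => i _ do rewrite (lin1Z lT) comul_column // scaler_sumr.
rewrite exchange_big; apply: eq_bigr => j _ /=; rewrite /f.
rewrite (lin1_sum (f := fun z => F z (a j))); last by mlin.
by apply: eq_bigr => i _; rewrite (lin1Z (f := fun z => F z (a j))) //; mlin.
Qed.

(* The functionals xi_t = h (- w_rt) turn the right comodule structure into the
   unitary corepresentation w, so that sum |xi_t|^2 is an invariant form. *)
Lemma eigen_norm m (w : 'M[H]_m) r : unitary w ->
  \sum_t `|h (e * w r t)| ^+ 2 = lam * \sum_q \sum_k `|h (f k * w r q)| ^+ 2.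
Proof.
move=> wP; pose xi q z := h (z * w r q).
have lxi q : @lin1 _ _ C^o (xi q) by rewrite /xi; mlin.
(* [Z q] is (xi_q ⊗ id) Delta(e). The sum of h(Z_q star(Z_q)) is evaluated twice: by [Z2] and
   unitarity of w it is the left side, by this definition it involves N and produces lam. *)
pose Z q := \sum_j xi q (f j) *: a j.
have Z2 q : Z q = \sum_t xi t e *: star (w q t).
  transitivity (\tsum_(b ⊗ c <- comul e) xi q b *: c).
    by rewrite comul_eigen //; mlin.
  under [RHS]eq_bigr => t _.
    rewrite -(antipode_ucorep wP) -[antipode _]mul1r.
    rewrite -(haar_right (e * w r t) (G := fun z => z * antipode (w t q))); last by mlin.
    rewrite comulMW; last by mlin.
    over.
  rewrite -tlift_sumf; apply: eq_tlift => b c.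
  under [RHS]eq_bigr => t _.
    rewrite (tlift_comul_corep _ _ (ucorep_comul wP)); last by mlin.
    over.
  rewrite exchange_big /= -(sum_delta (fun k => xi k b *: c) q).
  apply: eq_bigr => k _; rewrite scalerA mulrC -scalerA.
  transitivity (xi k b *: (c * \sum_t w k t * antipode (w t q))).
    by rewrite (ucorep_antipoder wP); case: (k == q);
      rewrite ?scale1r ?mulr1 ?scale0r ?mulr0.
  rewrite mulr_sumr scaler_sumr; apply: eq_bigr => t _.
  by rewrite mulrA.
have ZZ : \sum_q Z q * star (Z q) = (\sum_t xi t e * (xi t e)^*) *: 1.
  transitivity (\sum_q \sum_t \sum_s (xi t e * (xi s e)^*) *: (star (w q t) * w q s)).
    apply: eq_bigr => q _; rewrite Z2 (star_sum sP) mulr_suml; apply: eq_bigr => t _.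
    rewrite mulr_sumr; apply: eq_bigr => s _.
    by rewrite (starZ sP) (starKE sP) -scalerAl -scalerAr scalerA.
  rewrite exchange_big /= scaler_suml; apply: eq_bigr => t _.
  rewrite exchange_big /= -(sum_delta (fun s => (xi t e * (xi s e)^*) *: (1 : H)) t).
  apply: eq_bigr => s _; rewrite -scaler_sumr (ucorepVlE wP) eq_sym.
  by case: (s == t); rewrite ?scale1r // scale0r scaler0.
transitivity (h (\sum_q Z q * star (Z q))).
  rewrite ZZ (lin1Z lh) h1 [RHS]mulr1; apply: eq_bigr => t _.
  by rewrite normCK.
rewrite (lin1_sum lh) mulr_sumr; apply: eq_bigr => q _.
transitivity (\sum_k (xi q (f k))^* * xi q (\sum_j N j k *: f j)).
  rewrite /Z (star_sum sP) mulr_suml (lin1_sum lh).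
  under eq_bigr => j _ do rewrite mulr_sumr (lin1_sum lh).
  rewrite exchange_big; apply: eq_bigr => k _ /=.
  have -> : xi q (\sum_j N j k *: f j) = \sum_j xi q (N j k *: f j).
    exact: (lin1_sum (lxi q)).
  rewrite mulr_sumr; apply: eq_bigr => j _.
  rewrite (starZ sP) -scalerAl -scalerAr !(lin1Z lh) (lin1Z (lxi q)).
  by rewrite -/(N j k) -![_ *: _]/(_ * _) mulrCA [xi q (f j) * _]mulrC.
rewrite mulr_sumr; apply: eq_bigr => k _.
by rewrite eigen_corep (lin1Z (lxi q)) -[_ *: _]/(_ * _) normCK mulrCA [_^* * _]mulrC.
Qed.

(** [eigen_norm] exhibits lam as a quotient of sums of squares. The denominator is nonzero for some
    w, because epsilon(f_k) = y_k rules out f_k = 0 and h is nondegenerate. *)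
Lemma gram_eigenvalue_ge0 : (exists k, y k != 0) -> 0 <= lam.
Proof.
case=> k yk.
have [m [w [r [q [wP neq]]]]] :
    exists m (w : 'M[H]_m) r q, unitary w /\ h (f k * w r q) != 0.
  apply: contrapT => none.
  have fk : f k = 0.
    apply: haar_nondegenerater => b; move: b.
    apply: (corep_ext sP spanP (W := C^o) (f := fun b => h (f k * b)) (g := fun=> 0)).
    - by mlin.
    - exact: lin1_cst0.
    move=> m w r q wP; apply/eqP; apply: contrapT => /negP neq.
    by apply: none; exists m, w, r, q.
  have lc : @lin1 _ _ C^o (@counit C H) by exact: counit_linear.
  have := congr1 (@counit C H) fk; rewrite (lin1_0 lc) /f (lin1_sum lc) => e0.
  have : y k = 0.
    rewrite -e0 -[LHS](sum_delta (y : 'I_n -> C^o) k); apply: eq_bigr => i _.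
    by rewrite (lin1Z lc) (ucorep_counit vP) [RHS]mulrC.
  by apply/eqP.
have := eigen_norm r wP; set S := \sum_q _ => e1.
have Spos : 0 < S.
  rewrite lt_def; apply/andP; split; last first.
    by apply: sumr_ge0 => i _; apply: sumr_ge0 => j _; rewrite exprn_ge0.
  apply/eqP => S0; move/eqP: neq; apply; apply/eqP.
  have p1 i : true -> 0 <= \sum_k `|h (f k * w r i)| ^+ 2.
    by move=> _; apply: sumr_ge0 => j _; rewrite exprn_ge0.
  have := psumr_eq0P p1 S0; move/(_ q isT) => S1.
  have p2 i : true -> 0 <= `|h (f i * w r q)| ^+ 2 by rewrite exprn_ge0.
  have := psumr_eq0P p2 S1; move/(_ k isT)/eqP.
  by rewrite expf_eq0 /= normr_eq0.
have -> : lam = (\sum_t `|h (e * w r t)| ^+ 2) / S.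
  by rewrite e1 mulfK // gt_eqF.
apply: divr_ge0; last exact: ltW.
by apply: sumr_ge0 => i _; rewrite exprn_ge0.
Qed.

End Eigenvalue.

(** Writing a as a combination of columns with the same x turns h(a star(a)) into the Hermitian form
    of their Gram matrix. *)
Lemma haar_ge0 a : 0 <= h (a * star a).
Proof.
have [n [v [y [x [vP aE]]]]] := matrix_element_exists sP spanP a.
have -> : a = \sum_i y i *: column v x i.
  rewrite aE; apply: eq_bigr => i _; rewrite /column scaler_sumr.
  by apply: eq_bigr => j _; rewrite scalerA.
pose N := \matrix_(i, k) gram v x i k.
have NE i k : N i k = gram v x i k by rewrite mxE.
have -> : h ((\sum_i y i *: column v x i) * star (\sum_i y i *: column v x i)) =
    \sum_i \sum_k y i * (y k)^* * N i k.
  rewrite (star_sum sP) mulr_suml (lin1_sum lh); apply: eq_bigr => i _.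
  rewrite mulr_sumr (lin1_sum lh); apply: eq_bigr => k _.
  by rewrite (starZ sP) -scalerAl -scalerAr !(lin1Z lh) NE; exact: mulrA.
apply: hermitian_form_ge0 => [i k|lam z zn ze]; first by rewrite !NE gram_conj.
apply: (gram_eigenvalue_ge0 vP (x := x) (y := z)) => // k.
by rewrite -ze; apply: eq_bigr => i _; rewrite NE.
Qed.

(** A Cauchy-Schwarz argument: if c = h(ab) were nonzero, some star(b) + z a would have squared norm
    -1. *)
Lemma haar_eq0 a : h (a * star a) = 0 -> a = 0.
Proof.
move=> a0; apply: haar_nondegenerater => b.
pose c := h (a * b); apply/eqP; apply: contraT => cn.
pose s := h (star b * b).
have sge : 0 <= s by rewrite /s -{2}[b](starKE sP) haar_ge0.
pose D := c * c^*.
have D0 : 0 < D by rewrite lt_def /D mul_conjC_eq0 cn mul_conjC_ge0.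
(* Chosen so that the cross terms add up to -2rD = -(s + 1). *)
pose r := (s + 1) / (2%:R * D).
have r0 : 0 <= r.
  by apply: divr_ge0; [rewrite addr_ge0 ?ler01 | rewrite mulr_ge0 ?ler0n ?ltW].
pose z := - (r * c^*).
have zc : z^* = - (r * c) by rewrite /z rmorphN rmorphM /= conjCK geC0_conj.
have := haar_ge0 (star b + z *: a).
have -> : h ((star b + z *: a) * star (star b + z *: a)) = -1.
  rewrite (starD sP) (starZ sP) (starKE sP) mulrDl !mulrDr -!scalerAl -!scalerAr.
  rewrite !(lin1D lh) !(lin1Z lh) a0 -/s -/c -(starM sP) haar_star -/c zc.
  rewrite !scaler0 addr0 -![_ *: _]/(_ * _) /z.
  have rD : r * D + r * D = s + 1.
    rewrite -mulr2n -mulr_natl mulrCA /r divfK // mulf_neq0 ?pnatr_eq0 //.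
    by rewrite gt_eqF.
  rewrite !mulNr -[r * c * _]mulrA -[r * c^* * _]mulrA [c^* * c]mulrC -/D -addrA -opprD rD opprD addrA subrr.
  by rewrite add0r.
by rewrite oppr_ge0 ler10.
Qed.

End HaarProperties.

(** * The modular automorphism *)

Section Modular.
Variables (R : realType) (H : hopfAlgType R[i]) (star : H -> H).
Local Notation C := R[i].
Local Notation unitary := (unitary_corep star).
Hypothesis sP : hopf_star star.
Hypothesis spanP : forall h, exists2 s : seq (C * H),
  forall p, p \in s -> unitary_coefficient star p.2 & h = \sum_(p <- s) p.1 *: p.2.
Variable h : H -> C.
Hypothesis hP : is_haar h.

Local Notation S := (@antipode C H).
Local Notation Sinv := (star_antipode star).
Let lS : lin1 S. Proof. exact: antipode_linear. Qed.
Let lSi : lin1 Sinv. Proof. exact: lin1_star_antipode. Qed.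
Let lh : @lin1 _ _ C^o h. Proof. by case: hP. Qed.
Let h1 : h 1 = 1. Proof. by case: hP. Qed.
Let lc : @lin1 _ _ C^o (@counit C H). Proof. exact: counit_linear. Qed.

Lemma haar_strongr (W : lmodType C) (G : H -> W) x b : lin1 G ->
  \tsum_(x1 ⊗ x2 <- comul x) h (x1 * b) *: G x2 =
  \tsum_(b1 ⊗ b2 <- comul b) h (x * b1) *: G (S b2).
Proof.
move=> lG; symmetry.
transitivity (\tsum_(b1 ⊗ b2 <- comul b) \tsum_(y ⊗ z <- comul b1)
  \tsum_(x1 ⊗ x2 <- comul x) h (x1 * y) *: G (x2 * z * S b2)).
  apply: eq_tlift => b1 b2; rewrite -[in LHS](mul1r (S b2)).
  rewrite -(haar_right hP _ (G := fun z => G (z * S b2))); last by mlin.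
  by rewrite comulMW 1?tlift_exchange //; mlin.
rewrite (coassoc (F := fun y z w => \tsum_(x1 ⊗ x2 <- comul x)
  h (x1 * y) *: G (x2 * z * S w))); last by mlin.
rewrite -[RHS](counitr (G := fun b => \tsum_(x1 ⊗ x2 <- comul x) h (x1 * b) *: G x2));
  last by mlin.
apply: eq_tlift => b1 b2; rewrite tlift_exchange (lin1_tliftE ( *:%R (counit b2))); last by mlin.
apply: eq_tlift => x1 x2.
transitivity (h (x1 * b1) *: G (x2 * (\tsum_(y ⊗ z <- comul b2) (y * S z)))).
  rewrite (lin1_tliftE (fun z => h (x1 * b1) *: G (x2 * z))); last by mlin.
  by apply: eq_tlift => y z; rewrite mulrA.
by rewrite antipoder -scalerAr mulr1 (lin1Z lG) !scalerA mulrC.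
Qed.

Section Corepresentation.
Variables (n : nat) (v : 'M[H]_n).
Hypothesis vP : unitary v.

Lemma comul_antipode_corep (W : lmodType C) (F : H -> H -> W) i j : lin2 F ->
  tlift F (comul (S (v i j))) = \sum_s F (S (v s j)) (S (v i s)).
Proof.
move=> lF; rewrite comul_antipodeW // (tlift_comul_corep _ _ (ucorep_comul vP)) //.
by mlin.
Qed.

(** Since S(v_ij) = star(v_ji), the entry is the sum over j of h(v_jk star(v_ji)): an average that
    intertwines v with S^2(v). *)
Definition qmatrix : 'M[C]_n := \matrix_(i, k) \sum_j h (v j k * S (v i j)).
Local Notation G := qmatrix.

Lemma qmatrix_intertwines i l :
  \sum_k G k l *: S (S (v i k)) = \sum_t G i t *: v t l.
Proof.
have E k : G k l *: (1 : H) = \sum_s \sum_t G s t *: (v t l * S (v k s)).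
  rewrite mxE scaler_suml.
  transitivity (\sum_j \sum_s \sum_t h (v j t * S (v s j)) *: (v t l * S (v k s))).
    apply: eq_bigr => j _; rewrite -(haar_right hP _ (@lin1_id _ H)) comulMW; last by mlin.
    rewrite (tlift_comul_corep _ _ (ucorep_comul vP)); last by mlin.
    rewrite [RHS]exchange_big; apply: eq_bigr => t _ /=.
    by rewrite comul_antipode_corep //; mlin.
  rewrite exchange_big; apply: eq_bigr => s _ /=; rewrite exchange_big; apply: eq_bigr => t _ /=.
  by rewrite mxE scaler_suml.
transitivity (\sum_k \sum_s \sum_t G s t *: (v t l * (S (v k s) * S (S (v i k))))).
  apply: eq_bigr => k _; rewrite -[in LHS](mul1r (S (S (v i k)))) scalerAl E mulr_suml.
  apply: eq_bigr => s _; rewrite mulr_suml; apply: eq_bigr => t _.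
  by rewrite -scalerAl mulrA.
rewrite exchange_big /= -(sum_delta (fun s => \sum_t G s t *: v t l) i).
apply: eq_bigr => s _; rewrite exchange_big scaler_sumr; apply: eq_bigr => t _ /=.
rewrite -scaler_sumr -mulr_sumr.
have -> : \sum_k S (v k s) * S (S (v i k)) = (s == i)%:R.
  under eq_bigr => k _ do rewrite -antipodeM.
  rewrite -(lin1_sum lS) (ucorep_antipodel vP) eq_sym.
  by case: eqP => _; rewrite ?antipode1 // (lin1_0 lS).
by case: eqP => _; rewrite ?mulr1 ?scale1r // mulr0 scaler0 scale0r.
Qed.

(** If uG = 0, the elements a_j formed with conj(u) have total squared norm 0. Faithfulness gives
    a_j = 0, and epsilon(a_j) = conj(u_j). *)
Lemma qmatrix_unit : G \in unitmx.
Proof.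
rewrite unitmxE unitfE; apply/det0P => -[u un uG].
move/eqP: un; apply; apply/rowP => j; rewrite mxE.
pose a j := \sum_k (u 0 k)^* *: v j k.
have S0 : \sum_j h (a j * star (a j)) = 0.
  transitivity (\sum_k (u 0 k)^* * (u *m G) 0 k); last first.
    by rewrite big1 // => k _; rewrite uG mxE mulr0.
  transitivity (\sum_j \sum_k \sum_i (u 0 k)^* * (u 0 i * h (v j k * S (v i j)))).
    apply: eq_bigr => l _; rewrite /a (star_sum sP) mulr_suml (lin1_sum lh).
    apply: eq_bigr => k _; rewrite mulr_sumr (lin1_sum lh); apply: eq_bigr => i _.
    rewrite (starZ sP) conjCK -scalerAl -scalerAr !(lin1Z lh) (antipode_ucorep vP).
    by [].
  rewrite exchange_big; apply: eq_bigr => k _ /=; rewrite mxE mulr_sumr exchange_big.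
  by apply: eq_bigr => i _ /=; rewrite mxE !mulr_sumr.
have p l : true -> 0 <= h (a l * star (a l)) by move=> _; exact: (haar_ge0 sP spanP hP).
have := psumr_eq0P p S0; move/(_ j isT)/(haar_eq0 sP spanP hP)/(congr1 (@counit C H)).
rewrite (lin1_0 lc) /a (lin1_sum lc) => e.
have : (u 0 j)^* = 0.
  rewrite -e -[LHS](sum_delta (fun k => (u 0 k)^* : C^o) j); apply: eq_bigr => k _.
  by rewrite (lin1Z lc) (ucorep_counit vP) eq_sym [RHS]mulrC.
by move/(congr1 Num.conj); rewrite conjCK rmorph0.
Qed.

Local Notation Gi := (invmx G).

Lemma qmatrix_inv_intertwines r l :
  \sum_b Gi r b *: S (S (v b l)) = \sum_s Gi s l *: v r s.
Proof.
have GiG i j : \sum_k Gi i k * G k j = (i == j)%:R.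
  by have /matrixP/(_ i j) := mulVmx qmatrix_unit; rewrite !mxE.
have GGi i j : \sum_k G i k * Gi k j = (i == j)%:R.
  by have /matrixP/(_ i j) := mulmxV qmatrix_unit; rewrite !mxE.
transitivity (\sum_b \sum_s \sum_k (Gi r b * (G k s * Gi s l)) *: S (S (v b k))).
  apply: eq_bigr => b _; rewrite exchange_big /= -(sum_delta (fun k => S (S (v b k))) l).
  rewrite scaler_sumr; apply: eq_bigr => k _; rewrite scalerA -GGi mulr_sumr scaler_suml.
  by [].
transitivity (\sum_b \sum_s \sum_t (Gi r b * (G b t * Gi s l)) *: v t s).
  apply: eq_bigr => b _; apply: eq_bigr => s _.
  transitivity ((Gi r b * Gi s l) *: \sum_k G k s *: S (S (v b k))).
    by rewrite scaler_sumr; apply: eq_bigr => k _; rewrite scalerA -mulrA [Gi s l * _]mulrC.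
  rewrite qmatrix_intertwines scaler_sumr; apply: eq_bigr => t _.
  by rewrite scalerA -mulrA [Gi s l * _]mulrC.
rewrite exchange_big; apply: eq_bigr => s _ /=; rewrite exchange_big /=.
rewrite -[in RHS](sum_delta (fun t => v t s) r) scaler_sumr; apply: eq_bigr => t _.
rewrite scalerA [_ * (t == r)%:R]mulrC eq_sym -GiG mulr_suml scaler_suml.
by apply: eq_bigr => b _; rewrite mulrA.
Qed.

(** Presents a scalar as a combination of products S(v_li) v_rs, the form to which the invariance
    formulas apply in [haar_modular_corep]. *)
Lemma qmatrix_inv_sum r i :
  \sum_l \sum_s Gi s l *: (S (v l i) * v r s) = Gi r i *: 1.
Proof.
transitivity (\sum_l \sum_b Gi r b *: S (S (v b l) * v l i)).
  apply: eq_bigr => l _.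
  transitivity (S (v l i) * \sum_s Gi s l *: v r s).
    by rewrite mulr_sumr; apply: eq_bigr => s _; rewrite -scalerAr.
  rewrite -qmatrix_inv_intertwines mulr_sumr; apply: eq_bigr => b _.
  by rewrite antipodeM -scalerAr.
rewrite exchange_big -[in RHS](sum_delta (fun b => Gi r b *: (1 : H)) i); apply: eq_bigr => b _ /=.
rewrite -scaler_sumr -(lin1_sum lS) (ucorep_antipodel vP).
by case: eqP => _; rewrite ?scale1r ?antipode1 // scale0r (lin1_0 lS) scaler0.
Qed.

Lemma haar_corep_left l j x :
  \sum_i h (v i j * x) *: S (v l i) = \tsum_(x1 ⊗ x2 <- comul x) h (v l j * x2) *: x1.
Proof.
transitivity (\sum_i \sum_k \tsum_(x1 ⊗ x2 <- comul x) h (v k j * x2) *: (S (v l i) * v i k * x1)).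
  apply: eq_bigr => i _; rewrite -[in LHS](mulr1 (S (v l i))).
  rewrite -(haar_left hP _ (G := fun z => S (v l i) * z)); last by mlin.
  rewrite comulMW; last by mlin.
  rewrite (tlift_comul_corep _ _ (ucorep_comul vP)); last by mlin.
  by apply: eq_bigr => k _; apply: eq_tlift => x1 x2; rewrite mulrA.
rewrite exchange_big /=; under eq_bigr => k _ do rewrite -tlift_sumf.
rewrite -tlift_sumf; apply: eq_tlift => x1 x2.
rewrite -(sum_delta (fun k => h (v k j * x2) *: x1) l); apply: eq_bigr => k _.
rewrite -scaler_sumr -mulr_suml (ucorep_antipodel vP) eq_sym.
by case: eqP => _; rewrite ?mul1r ?scale1r // mul0r scaler0 scale0r.
Qed.

Definition modular_matrix t j := \sum_l \sum_s Gi s l * h (v l j * S (v t s)).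
Local Notation B := modular_matrix.

(** The modular automorphism acts on v as the matrix product G v B. The entries of G^-1 are replaced
    through [qmatrix_inv_sum]; [haar_corep_left] and [haar_strongr] then carry x to the front. *)
Lemma haar_modular_corep i j x :
  h (v i j * x) = h (x * \sum_r \sum_t (G i r * B t j) *: v r t).
Proof.
have E r : \sum_i Gi r i * h (v i j * x) = \sum_t h (x * v r t) * B t j.
  transitivity (\sum_l \sum_s Gi s l * h ((\sum_i h (v i j * x) *: S (v l i)) * v r s)).
    transitivity (\sum_i h (\sum_l \sum_s Gi s l *: (S (v l i) * v r s)) * h (v i j * x)).
      by apply: eq_bigr => k _; rewrite qmatrix_inv_sum (lin1Z lh) h1 -[_ *: 1]/(_ * _) mulr1.
    under eq_bigr => k _ do rewrite (lin1_sum lh) mulr_suml.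
    rewrite exchange_big; apply: eq_bigr => l _ /=.
    under eq_bigr => k _ do rewrite (lin1_sum lh) mulr_suml.
    rewrite exchange_big; apply: eq_bigr => s _ /=.
    rewrite mulr_suml (lin1_sum lh) mulr_sumr; apply: eq_bigr => k _.
    by rewrite -scalerAl !(lin1Z lh) -![_ *: _]/(_ * _) -mulrA [h _ * h _]mulrC.
  transitivity (\sum_l \sum_s \sum_t Gi s l * (h (x * v r t) * h (v l j * S (v t s)))).
    apply: eq_bigr => l _; apply: eq_bigr => s _; rewrite haar_corep_left.
    rewrite -mulr_sumr; congr (_ * _).
    rewrite (@lin1_tliftE _ _ _ _ C^o _ (fun z => h (z * v r s))); last by mlin.
    transitivity (h (v l j * \tsum_(x1 ⊗ x2 <- comul x) h (x1 * v r s) *: x2)).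
      rewrite (@lin1_tliftE _ _ _ _ C^o _ (fun z => h (v l j * z))); last by mlin.
      apply: (@eq_tlift _ _ _ C^o) => x1 x2.
      by rewrite -scalerAl -scalerAr !(lin1Z lh) [LHS]mulrC.
    rewrite (haar_strongr _ _ (@lin1_id _ H)).
    rewrite (tlift_comul_corep _ _ (ucorep_comul vP)); last by mlin.
    rewrite mulr_sumr (lin1_sum lh); apply: eq_bigr => t _.
    by rewrite -scalerAr (lin1Z lh).
  under eq_bigr => l _ do rewrite exchange_big.
  rewrite exchange_big; apply: eq_bigr => t _ /=; rewrite mulr_sumr; apply: eq_bigr => l _.
  by rewrite mulr_sumr; apply: eq_bigr => s _; rewrite mulrCA.
have GGi k l : \sum_r G k r * Gi r l = (k == l)%:R.
  by have /matrixP/(_ k l) := mulmxV qmatrix_unit; rewrite !mxE.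
transitivity (\sum_r G i r * \sum_k Gi r k * h (v k j * x)).
  rewrite -[LHS](sum_delta (fun k => h (v k j * x) : C^o) i).
  under [RHS]eq_bigr => r _ do rewrite mulr_sumr.
  rewrite exchange_big; apply: eq_bigr => k _ /=.
  by rewrite eq_sym -GGi scaler_suml; apply: eq_bigr => r _; rewrite mulrA.
rewrite mulr_sumr (lin1_sum lh); apply: eq_bigr => r _.
rewrite E mulr_sumr mulr_sumr (lin1_sum lh); apply: eq_bigr => t _.
by rewrite -scalerAr (lin1Z lh) -[RHS]/(_ * _) -mulrA [B t j * _]mulrC.
Qed.

End Corepresentation.

Lemma modular_exists a : exists b, forall x, h (a * x) = h (x * b).
Proof.
have [n [v [vP [X ->]]]] := coefficient_exists sP spanP a.
exists (\sum_i \sum_j X i j *: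
  \sum_r \sum_t (qmatrix v i r * modular_matrix v t j) *: v r t) => x.
rewrite mulr_suml mulr_sumr !(lin1_sum lh); apply: eq_bigr => i _.
rewrite mulr_suml mulr_sumr !(lin1_sum lh); apply: eq_bigr => j _.
by rewrite -scalerAl -scalerAr !(lin1Z lh) (haar_modular_corep vP).
Qed.

Variable sig : H -> H.
Hypothesis sigP : forall a x, h (a * x) = h (x * sig a).

Lemma modular_unique a b : (forall x, h (a * x) = h (x * b)) -> b = sig a.
Proof.
move=> e; apply/eqP; rewrite -subr_eq0; apply/eqP.
apply: (haar_nondegenerate sP hP) => x.
by rewrite mulrBr (lin1B lh) -e sigP subrr.
Qed.

Lemma lin1_modular : lin1 sig.
Proof.
move=> c a b; symmetry; apply: modular_unique => x.
by rewrite mulrDl mulrDr -scalerAl -scalerAr !(lin1D lh) !(lin1Z lh) (sigP a) (sigP b).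
Qed.
Let lsig := lin1_modular.

Lemma modularM a b : sig (a * b) = sig a * sig b.
Proof.
symmetry; apply: modular_unique => x.
by rewrite -mulrA sigP -mulrA sigP mulrA.
Qed.

Lemma modular1 : sig 1 = 1.
Proof. by symmetry; apply: modular_unique => x; rewrite mul1r mulr1. Qed.

(** h is invariant under the algebra automorphism S^2, so conjugating sig by S^2 gives sig again by
    uniqueness. *)
Lemma modular_antipode2 a : sig (S (S a)) = S (S (sig a)).
Proof.
have E x : S (S (Sinv (Sinv x))) = x by rewrite !(antipode_starK sP).
have hSS y z : h (S (S (y * z))) = h (S (S y) * S (S z)) by rewrite !antipodeM.
symmetry; apply: modular_unique => x; set y := Sinv (Sinv x).
transitivity (h (a * y)).
  by rewrite -[in LHS](E x) -hSS !(haar_antipode sP hP).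
by rewrite sigP -[in RHS](E x) -hSS !(haar_antipode sP hP).
Qed.

Definition modular_char a : C := counit (sig a).
Local Notation f := modular_char.

Lemma lin1_modular_char : @lin1 _ _ C^o f.
Proof. by rewrite /f; mlin. Qed.
Let lf := lin1_modular_char.

(** sig(v) = G v B = S^2(v) G B by the intertwining property, and applying epsilon shows f(v) = G
    B. *)
Lemma modularE a : sig a = \tsum_(a1 ⊗ a2 <- comul a) f a2 *: S (S a1).
Proof.
move: a; apply: (corep_ext sP spanP) => [||n v i j vP]; [by []|by mlin|].
rewrite (tlift_comul_corep _ _ (ucorep_comul vP)); last by mlin.
set G := qmatrix v; set B := modular_matrix v.
have sE k l : sig (v k l) = \sum_r \sum_t (G k r * B t l) *: v r t.
  by symmetry; apply: modular_unique => x; rewrite (haar_modular_corep vP).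
have fE k l : f (v k l) = \sum_r G k r * B r l.
  rewrite /f sE (lin1_sum lc); apply: eq_bigr => r _.
  rewrite (lin1_sum lc) -[RHS](sum_delta (fun t => G k r * B t l : C^o) r).
  by apply: eq_bigr => t _; rewrite (lin1Z lc) (ucorep_counit vP) eq_sym [LHS]mulrC.
rewrite sE; transitivity (\sum_t B t j *: \sum_r G i r *: v r t).
  rewrite exchange_big; apply: eq_bigr => t _ /=; rewrite scaler_sumr.
  by apply: eq_bigr => r _; rewrite scalerA mulrC.
under eq_bigr => t _ do rewrite -(qmatrix_intertwines vP) scaler_sumr.
rewrite exchange_big; apply: eq_bigr => k _ /=; rewrite fE scaler_suml.
by apply: eq_bigr => t _; rewrite scalerA mulrC.
Qed.

Definition modular_right a := \tsum_(a1 ⊗ a2 <- comul a) f a2 *: a1.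
Definition modular_left a := \tsum_(a1 ⊗ a2 <- comul a) f a1 *: a2.
Local Notation L := modular_right.
Local Notation Rf := modular_left.

Lemma lin1_modular_right : lin1 L. Proof. by rewrite /L; mlin. Qed.
Lemma lin1_modular_left : lin1 Rf. Proof. by rewrite /Rf; mlin. Qed.
Let lL := lin1_modular_right.
Let lR := lin1_modular_left.

Lemma modular_rightE a : S (S (L a)) = sig a.
Proof.
have lSS : lin1 (fun x => S (S x)) by mlin.
rewrite modularE [LHS](lin1_tliftE _ lSS); apply: eq_tlift => a1 a2.
by rewrite (lin1Z lSS).
Qed.

Lemma comul_modular_right (W : lmodType C) (F : H -> H -> W) a : lin2 F ->
  tlift F (comul (L a)) = \tsum_(a1 ⊗ a2 <- comul a) F a1 (L a2).
Proof.
move=> lF; have lT : lin1 (fun z => tlift F (comul z)) by mlin.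
rewrite [LHS](lin1_tliftE _ lT).
transitivity (\tsum_(a1 ⊗ a2 <- comul a) \tsum_(x ⊗ y <- comul a1) f a2 *: F x y).
  apply: eq_tlift => a1 a2; rewrite (lin1Z lT) [LHS](lin1_tliftE ( *:%R (f a2))) //.
  by mlin.
rewrite (coassoc (F := fun x y z => f z *: F x y)); last by mlin.
apply: eq_tlift => a1 a2; rewrite /L [RHS](lin1_tliftE (F a1)); last by mlin.
by apply: eq_tlift => x y; rewrite (lin1Z (f := F a1)) //; mlin.
Qed.

Lemma comul_modular_left (W : lmodType C) (F : H -> H -> W) a : lin2 F ->
  tlift F (comul (Rf a)) = \tsum_(a1 ⊗ a2 <- comul a) F (Rf a1) a2.
Proof.
move=> lF; have lT : lin1 (fun z => tlift F (comul z)) by mlin.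
rewrite [LHS](lin1_tliftE _ lT).
transitivity (\tsum_(a1 ⊗ a2 <- comul a) \tsum_(x ⊗ y <- comul a2) f a1 *: F x y).
  apply: eq_tlift => a1 a2; rewrite (lin1Z lT) [LHS](lin1_tliftE ( *:%R (f a1))) //.
  by mlin.
rewrite -(coassoc (F := fun z x y => f z *: F x y)); last by mlin.
apply: eq_tlift => a1 a2; rewrite /Rf [RHS](lin1_tliftE (fun z => F z a2)); last by mlin.
by apply: eq_tlift => x y; rewrite (lin1Z (f := fun z => F z a2)) //; mlin.
Qed.

(* Compare the two strong invariance formulas on both sides of
   h (a x_1) x_2 = h (x_1 sig a) x_2. *)
Lemma modular_leftE a : Rf a = S (S (S (S (L a)))).
Proof.
pose D y := S (S (S (L y))) - Sinv (Rf y).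
have lD : lin1 D by rewrite /D; apply: lin1_sub; mlin.
suff D0 : D a = 0.
  by rewrite -[RHS](antipode_starK sP) star_antipodeK //; move/eqP: D0;
    rewrite subr_eq0 => /eqP ->; rewrite (antipode_starK sP).
have e x : \tsum_(a1 ⊗ a2 <- comul a) h (x * S (S a1)) *: D a2 = 0.
  have q1 := haar_strong sP hP a x (@lin1_id _ H).
  have q2 := haar_strongr x (sig a) (@lin1_id _ H).
  have e12 : \tsum_(x1 ⊗ x2 <- comul x) h (a * x1) *: x2 =
     \tsum_(x1 ⊗ x2 <- comul x) h (x1 * sig a) *: x2.
    by apply: eq_tlift => x1 x2; rewrite sigP.
  move: e12; rewrite q1 q2 -[sig a]modular_rightE.
  rewrite comul_antipodeW; last by mlin.
  rewrite comul_antipodeW; last by mlin.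
  rewrite comul_modular_right; last by mlin.
  have -> : \tsum_(b1 ⊗ b2 <- comul a) h (b1 * x) *: Sinv b2 =
    \tsum_(a1 ⊗ a2 <- comul a) h (x * S (S a1)) *: Sinv (Rf a2).
    transitivity (\tsum_(b1 ⊗ b2 <- comul a) \tsum_(y ⊗ z <- comul b1)
      (h (x * S (S y)) * f z) *: Sinv b2).
      apply: eq_tlift => b1 b2; rewrite sigP modularE.
      rewrite (lin1_tliftE (fun z => h (x * z) *: Sinv b2)); last by mlin.
      apply: eq_tlift => y z; rewrite -scalerAr (lin1Z lh) [_ * f z]mulrC.
      by [].
    rewrite (coassoc (F := fun y z b => (h (x * S (S y)) * f z) *: Sinv b)); last by mlin.
    apply: eq_tlift => a1 a2; rewrite /Rf [RHS](lin1_tliftE (fun z => h (x * S (S a1)) *: Sinv z)); last by mlin.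
    by apply: eq_tlift => y z; rewrite (lin1Z lSi) scalerA.
  move=> e; transitivity (\tsum_(a1 ⊗ a2 <- comul a) h (x * S (S a1)) *: S (S (S (L a2))) -
     \tsum_(a1 ⊗ a2 <- comul a) h (x * S (S a1)) *: Sinv (Rf a2)).
    rewrite /tlift /fsum -sumrB; apply: eq_bigr => p _.
    by rewrite -scalerBr.
  by rewrite e subrr.
(* Nondegeneracy of h removes h and x from [e]; epsilon, which is invariant under S, then leaves
   phi(D a). *)
apply: separation => phi; rewrite linear0; have lphi := lin1_scalar phi.
have : \tsum_(a1 ⊗ a2 <- comul a) phi (D a2) *: S (S a1) = 0.
  apply: (haar_nondegenerate sP hP) => x.
  rewrite (@lin1_tliftE _ _ _ _ C^o _ (fun z => h (x * z))); last by mlin.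
  have := congr1 phi (e x); rewrite linear0 (lin1_tliftE (X := C^o) _ lphi) => <-.
  apply: (@eq_tlift _ _ _ C^o) => a1 a2.
  by rewrite -scalerAr (lin1Z lh) (lin1Z lphi) [LHS]mulrC.
move/(congr1 (@counit C H)); rewrite (lin1_0 lc) (lin1_tliftE (X := C^o) _ lc) => <-.
rewrite -[LHS](@counitl _ _ C^o (fun z => phi (D z))); last by mlin.
apply: (@eq_tlift _ _ _ C^o) => a1 a2.
by rewrite (lin1Z lc) !counit_antipode [LHS]mulrC.
Qed.

End Modular.

(** * Diagonalizable operators and functional calculus *)

Lemma poly_interpolation (F : fieldType) (g : F -> F) (s : seq F) :
  exists q : {poly F}, {in s, forall x, q.[x] = g x}.
Proof.
elim: s => [|x s [q qP]]; first by exists 0.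
have [xs|xs] := boolP (x \in s).
  by exists q => y; rewrite inE => /orP[/eqP->|]; exact: qP.
pose p := \prod_(y <- s) ('X - y%:P).
have px : p.[x] != 0 by rewrite -/(root p x) root_prod_XsubC.
exists (q + ((g x - q.[x]) / p.[x]) *: p) => y; rewrite !hornerE inE.
case/orP => [/eqP->|ys]; first by rewrite divfK // addrC subrK.
have /eqP -> : p.[y] == 0 by rewrite -/(root p y) root_prod_XsubC.
by rewrite mulr0 addr0 qP.
Qed.

Section Eigenvectors.
Variables (F : fieldType) (V : lmodType F) (A : V -> V).
Hypothesis lA : lin1 A.

Definition eigen_seq (t : seq (F * V)) := forall p, p \in t -> A p.2 = p.1 *: p.2.

(** On the finitely many eigenvalues involved, g agrees with a polynomial, and that polynomial in A
    preserves the relation. *)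
Lemma eigen_independent (g : F -> F) (t : seq (F * V)) :
  eigen_seq t -> \sum_(p <- t) p.2 = 0 -> \sum_(p <- t) g p.1 *: p.2 = 0.
Proof.
move=> tA t0; have pw n : \sum_(p <- t) p.1 ^+ n *: p.2 = 0.
  elim: n => [|n IH].
    by under eq_bigr => p _ do rewrite scale1r.
  have := congr1 A IH; rewrite (lin1_0 lA) (lin1_sum lA) => e.
  transitivity (\sum_(p <- t) A (p.1 ^+ n *: p.2)); last exact: e.
  rewrite big_seq [RHS]big_seq; apply: eq_bigr => p pt.
  by rewrite (lin1Z lA) tA // scalerA exprSr.
have [q qP] := poly_interpolation g (map fst t).
transitivity (\sum_(p <- t) q.[p.1] *: p.2).
  rewrite big_seq [RHS]big_seq; apply: eq_bigr => p pt.
  by rewrite qP //; exact: map_f.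
under eq_bigr => p _ do rewrite horner_coef scaler_suml.
rewrite exchange_big big1 // => i _ /=.
transitivity (q`_i *: \sum_(p <- t) p.1 ^+ i *: p.2).
  by rewrite scaler_sumr; apply: eq_bigr => p _; rewrite scalerA.
by rewrite pw scaler0.
Qed.

Hypothesis A_diag : forall a, exists2 t, eigen_seq t & a = \sum_(p <- t) p.2.

(** g(A) is defined through any decomposition into eigenvectors; [eigen_independent] applied to the
    difference of two decompositions shows that the choice is immaterial. *)
Lemma functional_calculus (g : F -> F) :
  exists2 W : V -> V, lin1 W & forall l a, A a = l *: a -> W a = g l *: a.
Proof.
have ex a : exists b, exists t, [/\ eigen_seq t, a = \sum_(p <- t) p.2
    & b = \sum_(p <- t) g p.1 *: p.2].
  by have [t tA tE] := A_diag a; exists (\sum_(p <- t) g p.1 *: p.2), t.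
have [W WP] := choice ex.
have WE a t : eigen_seq t -> a = \sum_(p <- t) p.2 -> W a = \sum_(p <- t) g p.1 *: p.2.
  move=> tA tE; have [s [sA sE ->]] := WP a.
  pose t' := [seq (p.1, - p.2) | p <- t].
  have E1 : eigen_seq (s ++ t').
    move=> p; rewrite mem_cat => /orP[/sA //|/mapP[q qt ->]] /=.
    by rewrite (lin1N lA) tA // scalerN.
  have E2 : \sum_(p <- s ++ t') p.2 = 0.
    by rewrite big_cat big_map /= sumrN -sE -tE subrr.
  have := eigen_independent g E1 E2; rewrite big_cat big_map /=.
  under [X in _ + X = 0]eq_bigr => p _ do rewrite scalerN.
  by rewrite sumrN => /eqP; rewrite subr_eq0 => /eqP.
exists W => [c a b|l a la].
  have [t [tA tE ->]] := WP a; have [s [sA sE ->]] := WP b.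
  rewrite (WE _ ([seq (p.1, c *: p.2) | p <- t] ++ s)).
  - rewrite big_cat big_map /= scaler_sumr; congr (_ + _); apply: eq_bigr => p _.
    by rewrite !scalerA mulrC.
  - move=> p; rewrite mem_cat => /orP[/mapP[q qt ->]|/sA //] /=.
    by rewrite (lin1Z lA) tA // !scalerA mulrC.
  - by rewrite big_cat big_map /= -scaler_sumr -tE -sE.
rewrite (WE _ [:: (l, a)]) ?big_seq1 // => p.
by rewrite inE => /eqP->.
Qed.

Lemma lin1_foldl_eigen (s : seq F) : lin1 (fun a => foldl (fun x l => A x - l *: x) a s).
Proof.
elim: s => [|l s IH]; first exact: lin1_id.
have ls : lin1 (fun x => A x - l *: x) by apply: lin1_sub; mlin.
exact: (lin1_comp IH ls).
Qed.

End Eigenvectors.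

(* If g(A) is the functional calculus of A and 1 (x) A fixes the line through a
   tensor, then 1 (x) g(A) acts on it by g of the eigenvalue; phi stands for
   either tensor embedding. *)
Lemma functional_calculus_transfer (F : fieldType) (V U M : lmodType F) (A W : V -> V)
    (g : F -> F) (phi : U -> V -> M) (T : M -> M) (s : seq (U * V)) (l : F) :
  lin1 A -> (forall a, exists2 t, eigen_seq A t & a = \sum_(p <- t) p.2) ->
  lin1 W -> (forall l a, A a = l *: a -> W a = g l *: a) ->
  lin2 phi -> lin1 T -> (forall x z, T (phi x z) = phi x (A z)) ->
  T (\sum_(p <- s) phi p.1 p.2) = l *: \sum_(p <- s) phi p.1 p.2 ->
  \sum_(p <- s) phi p.1 (W p.2) = g l *: \sum_(p <- s) phi p.1 p.2.
Proof.
move=> lA Adiag lW WE lphi lT Tphi Tl.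
have ex a : exists t, eigen_seq A t /\ a = \sum_(p <- t) p.2.
  by have [t tA tE] := Adiag a; exists t.
have [t tP] := choice ex.
pose Q := [seq (q.1, phi p.1 q.2) | p <- s, q <- t p.2].
have phi_sum x z : phi x z = \sum_(q <- t z) phi x q.2.
  by rewrite {1}(tP z).2 (lin1_sum (f := phi x)) //; mlin.
have QT : eigen_seq T ((l, - \sum_(p <- s) phi p.1 p.2) :: Q).
  move=> q; rewrite inE => /orP[/eqP->|/allpairsPdep[p [r [ps rt ->]]]] /=.
    by rewrite (lin1N lT) Tl scalerN.
  by rewrite Tphi (tP p.2).1 // (lin1Z (f := phi p.1)) //; mlin.
have Q0 : \sum_(q <- (l, - \sum_(p <- s) phi p.1 p.2) :: Q) q.2 = 0.
  rewrite big_cons big_allpairs_dep /= addrC; apply/eqP; rewrite subr_eq0; apply/eqP.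
  by apply: eq_bigr => p _; rewrite [RHS]phi_sum.
have := eigen_independent lT g QT Q0.
rewrite big_cons big_allpairs_dep /= scalerN addrC => /eqP; rewrite subr_eq0 => /eqP <-.
apply: eq_bigr => p _.
have lp : lin1 (phi p.1) by mlin.
rewrite {1}(tP p.2).2 (lin1_sum lW) (lin1_sum lp) big_seq [RHS]big_seq.
by apply: eq_bigr => q qt; rewrite (WE q.1) ?(lin1Z lp) //; exact: (tP p.2).1.
Qed.

Section SelfAdjoint.
Variables (C : numClosedFieldType) (V : lmodType C) (ip : V -> V -> C) (A : V -> V).
Hypothesis ip_lin : forall b, @lin1 C V C^o (ip^~ b).
Hypothesis ipC : forall a b, ip b a = (ip a b)^*.
Hypothesis ip_eq0 : forall a, ip a a = 0 -> a = 0.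
Hypothesis lA : lin1 A.
Hypothesis A_self : forall a b, ip (A a) b = ip a (A b).

(** One factor A - l is peeled off at a time: dividing the eigenvectors of (A - l)a by the nonzero
    p.1 - l leaves a remainder c. The invariant subspace [U] allows a second operator to be
    diagonalised inside an eigenspace of the first. *)
Lemma self_adjoint_eigenvectors (U : V -> Prop) (s : seq C) a :
    (forall c x y, U x -> U y -> U (c *: x + y)) -> (forall x, U x -> U (A x)) ->
    U a -> foldl (fun x l => A x - l *: x) a s = 0 ->
  exists2 t, eigen_seq A t /\ (forall p, p \in t -> U p.2) & a = \sum_(p <- t) p.2.
Proof.
move=> Ulin UA; elim: s a => [|l s IH] a Ua /=.
  by move=> ->; exists [::]; rewrite ?big_nil //; split.
pose b := A a - l *: a; rewrite -/b => sb.
have Ub : U b by rewrite /b addrC -scaleNr; apply: Ulin => //; exact: UA.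
have [t [tA tU] tE] := IH b Ub sb.
pose t' := [seq (p.1, (p.1 - l)^-1 *: p.2) | p <- t & p.1 != l].
have t'A : eigen_seq A t'.
  move=> p /mapP[q]; rewrite mem_filter => /andP[_ qt] -> /=.
  by rewrite (lin1Z lA) tA // !scalerA mulrC.
have U0 : U 0 by have := Ulin (-1) _ _ Ua Ua; rewrite scaleN1r addNr.
have t'U p : p \in t' -> U p.2.
  move=> /mapP[q]; rewrite mem_filter => /andP[_ qt] -> /=.
  by rewrite -[_ *: _]addr0; apply: Ulin => //; exact: tU.
pose a' := \sum_(p <- t') p.2; pose c := a - a'.
have Ua' : U a'.
  rewrite /a' big_seq; elim/big_ind: _ => [//|x y Ux Uy|p pt]; last exact: t'U.
  by rewrite -[x]scale1r; exact: Ulin.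
have Uc : U c by rewrite /c addrC -scaleN1r; exact: Ulin.
pose b0 := \sum_(p <- t | p.1 == l) p.2.
have cE : A c - l *: c = b0.
  have a'E : A a' - l *: a' = \sum_(p <- t | p.1 != l) p.2.
    rewrite /a' (lin1_sum lA) scaler_sumr -sumrB big_map big_filter.
    rewrite big_seq_cond [RHS]big_seq_cond; apply: eq_bigr => p /andP[pt pl] /=.
    rewrite (lin1Z lA) tA // scalerA [l *: _]scalerA mulrC -scalerBl -mulrBl.
    by rewrite mulfV ?scale1r // subr_eq0.
  have sub4 (x y z w : V) : x - y - (z - w) = x - z - (y - w) by rewrite !opprB addrACA [RHS]addrACA [- y - z]addrC.
  rewrite /c (lin1B lA) scalerBr sub4 a'E -/b tE.
  by rewrite (bigID (fun p => p.1 == l)) /= addrK.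
have Ab0 : A b0 = l *: b0.
  rewrite /b0 (lin1_sum lA) scaler_sumr big_seq_cond [RHS]big_seq_cond.
  by apply: eq_bigr => p /andP[pt /eqP <-]; rewrite tA.
(* Self-adjointness excludes Jordan blocks: l is real if b0 is nonzero, and the product of b0 = (A -
   l)c with b0 equals that of c with (A - l)b0 = 0. *)
have b00 : b0 = 0.
  have ipr x m y : ip x (m *: y) = m^* * ip x y.
    by rewrite ipC (lin1Z (ip_lin x)) rmorphM /= -ipC.
  apply/eqP; apply: contraT => nb.
  have nz : ip b0 b0 != 0 by apply: contra nb => /eqP/ip_eq0 ->.
  have lr : l = l^*.
    by apply: (mulIf nz); rewrite -ipr -Ab0 -A_self Ab0 (lin1Z (ip_lin _)).
  have : ip b0 b0 = 0.
    rewrite -{1}cE (lin1B (ip_lin _)) (lin1Z (ip_lin _)) A_self Ab0 ipr -lr.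
    by rewrite -[_ *: _]/(_ * _) subrr.
  by move/eqP: nz.
exists ((l, c) :: t'); last by rewrite big_cons /= -/a' subrK.
split=> p; rewrite inE => /orP[/eqP->|pt] //=.
- by apply/eqP; rewrite -subr_eq0 cE b00.
- exact: t'A.
- exact: t'U.
Qed.

End SelfAdjoint.

(* Cayley-Hamilton for an operator acting on a finite family. *)
Lemma annihilating_seq (C : numClosedFieldType) n (P : 'M[C]_n) :
  exists s : seq C, forall (V : lmodType C) (A : V -> V) (w : 'I_n -> V), lin1 A ->
    (forall j, A (w j) = \sum_c P c j *: w c) ->
  forall j, foldl (fun x l => A x - l *: x) (w j) s = 0.
Proof.
case: n P => [|n] P; first by exists [::] => V A w _ _ [].
have [s sE] := closed_field_poly_normal (char_poly P).
exists s => V A w lA wA.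
have M j : foldl (fun x l => A x - l *: x) (w j) s =
    \sum_c (\prod_(l <- s) (P - l%:M)) c j *: w c.
  have gen (Q : 'M[C]_n.+1) :
      foldl (fun x l => A x - l *: x) (\sum_c Q c j *: w c) s =
      \sum_c (\prod_(l <- s) (P - l%:M) *m Q) c j *: w c.
    elim: s {sE} Q => [|l s IH] Q /=; first by rewrite big_nil mul1mx.
    have -> : A (\sum_c Q c j *: w c) - l *: (\sum_c Q c j *: w c) =
        \sum_c ((P - l%:M) *m Q) c j *: w c.
      rewrite (lin1_sum lA); under eq_bigr => c _ do rewrite (lin1Z lA) wA scaler_sumr.
      rewrite exchange_big scaler_sumr -sumrB; apply: eq_bigr => c _ /=.
      rewrite mulmxBl mul_scalar_mx !mxE scalerBl scaler_suml scalerA; congr (_ - _).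
      by apply: eq_bigr => d _; rewrite scalerA mulrC.
    rewrite IH big_cons; apply: eq_bigr => c _; rewrite mulmxA; congr ((_ *m _) c j *: _).
    suff : GRing.comm (P - l%:M) (\prod_(m <- s) (P - m%:M)) by move=> e; rewrite mulmxE -e.
    apply: commr_prod => m _; apply: commrB; first apply: commr_sym.
      by apply: commrB; [exact: commr_refl | exact: comm_mx_scalar].
    exact: comm_mx_scalar.
  rewrite -[w j](_ : \sum_c (1%:M : 'M[C]_n.+1) c j *: w c = _).
    by rewrite gen; apply: eq_bigr => c _; rewrite mulmx1.
  rewrite (bigD1 j) //= mxE eqxx scale1r big1 ?addr0 // => c cj.
  by rewrite mxE (negbTE cj) scale0r.
move=> j; rewrite M; have -> : \prod_(l <- s) (P - l%:M) = 0.
  have /eqP := Cayley_Hamilton P; rewrite sE.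
  have /monicP -> := char_poly_monic P; rewrite scale1r rmorph_prod /= => /eqP <-.
  by apply: eq_bigr => l _; rewrite rmorphB /= horner_mx_X horner_mx_C.
by rewrite big1 // => c _; rewrite mxE scale0r.
Qed.

(** * The Woronowicz character *)

Section WoronowiczCharacter.
Variables (R : realType) (H : hopfAlgType R[i]) (star : H -> H).
Local Notation C := R[i].
Local Notation unitary := (unitary_corep star).
Hypothesis sP : hopf_star star.
Hypothesis spanP : forall h, exists2 s : seq (C * H),
  forall p, p \in s -> unitary_coefficient star p.2 & h = \sum_(p <- s) p.1 *: p.2.
Variable h : H -> C.
Hypothesis hP : is_haar h.
Variable sig : H -> H.
Hypothesis sigP : forall a x, h (a * x) = h (x * sig a).

Local Notation S := (@antipode C H).
Local Notation Sinv := (star_antipode star).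
Local Notation f := (modular_char sig).
Local Notation L := (modular_right sig).
Local Notation Rf := (modular_left sig).
Let lS : lin1 S. Proof. exact: antipode_linear. Qed.
Let lSS : lin1 (fun x => S (S x)). Proof. by mlin. Qed.
Let lh : @lin1 _ _ C^o h. Proof. by case: hP. Qed.
Let lc : @lin1 _ _ C^o (@counit C H). Proof. exact: counit_linear. Qed.
Let lsig : lin1 sig. Proof. exact: (lin1_modular sP hP sigP). Qed.
Let lL : lin1 L. Proof. exact: (lin1_modular_right sP hP sigP). Qed.
Let lR : lin1 Rf. Proof. exact: (lin1_modular_left sP hP sigP). Qed.
Let LE a : S (S (L a)) = sig a. Proof. exact: (modular_rightE sP spanP hP sigP). Qed.
Let RE a : Rf a = S (S (S (S (L a)))). Proof. exact: (modular_leftE sP spanP hP sigP). Qed.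

Lemma antipode_inj : injective S.
Proof. exact: can_inj (star_antipodeK sP). Qed.

Lemma modular_right_antipode2 a : L (S (S a)) = S (S (L a)).
Proof.
apply: antipode_inj; apply: antipode_inj.
by rewrite LE (modular_antipode2 sP hP sigP) LE.
Qed.

Lemma modular_rightM a b : L (a * b) = L a * L b.
Proof.
apply: antipode_inj; apply: antipode_inj.
by rewrite LE (modularM sP hP sigP) !antipodeM !LE.
Qed.

Lemma modular_right1 : L 1 = 1.
Proof.
apply: antipode_inj; apply: antipode_inj.
by rewrite LE (modular1 sP hP sigP) !antipode1.
Qed.

Lemma modular_right_leftC a : L (Rf a) = Rf (L a).
Proof. by rewrite !RE !modular_right_antipode2. Qed.

Definition haar_product a b := h (star b * a).
Local Notation ip := haar_product.

Lemma haar_product_lin b : @lin1 C H C^o (ip^~ b).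
Proof. by rewrite /ip; mlin. Qed.

Lemma haar_productC a b : ip b a = (ip a b)^*.
Proof. by rewrite /ip -(haar_star sP hP) (starM sP) (starKE sP). Qed.

Lemma haar_product_ge0 a : 0 <= ip a a.
Proof. by rewrite /ip -{2}[a](starKE sP) (haar_ge0 sP spanP hP). Qed.

Lemma haar_product_eq0 a : ip a a = 0 -> a = 0.
Proof.
rewrite /ip -{2}[a](starKE sP) => /(haar_eq0 sP spanP hP) e.
by rewrite -[a](starKE sP) e (star0 sP).
Qed.

Lemma haar_product_gt0 a : a != 0 -> 0 < ip a a.
Proof.
move=> an; rewrite lt_def haar_product_ge0 andbT.
by apply: contra an => /eqP/haar_product_eq0 ->.
Qed.

Lemma antipode2_self a b : ip (S (S a)) b = ip a (S (S b)).
Proof.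
rewrite /ip -!(star_antipode_star sP) -[RHS](haar_antipode sP hP).
by rewrite -[RHS](haar_antipode sP hP) !antipodeM !(antipode_starK sP).
Qed.

Lemma modular_self a b : ip (sig a) b = ip a (sig b).
Proof.
rewrite /ip -sigP; rewrite -[RHS]conjCK -(haar_star sP hP) (starM sP) (starKE sP).
by rewrite -sigP -(haar_star sP hP) (starM sP) (starKE sP).
Qed.

(** L is sig followed by S^-2; both are self-adjoint and they commute. *)
Lemma modular_right_self a b : ip (L a) b = ip a (L b).
Proof.
have E : b = S (S (Sinv (Sinv b))) by rewrite !(antipode_starK sP).
rewrite E -antipode2_self LE modular_self modular_right_antipode2.
by rewrite -LE.
Qed.

Lemma modular_left_self a b : ip (Rf a) b = ip a (Rf b).
Proof.
by rewrite !RE !antipode2_self modular_right_self !modular_right_antipode2.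
Qed.

(** The value is the squared norm of star(S(a)). *)
Lemma antipode2_gt0 a : a != 0 -> 0 < ip (S (S a)) a.
Proof.
move=> an; have -> : ip (S (S a)) a = ip (star (S a)) (star (S a)).
  rewrite /ip (starKE sP) -(star_antipode_star sP) -[RHS](haar_antipode sP hP).
  by rewrite antipodeM (antipode_starK sP).
apply: haar_product_gt0; apply: contra an => /eqP e; apply/eqP.
by apply: antipode_inj; rewrite (lin1_0 lS) -[S a](starKE sP) e (star0 sP).
Qed.

Lemma modular_gt0 a : a != 0 -> 0 < ip (sig a) a.
Proof.
move=> an; rewrite /ip -sigP -{1}[a](starKE sP); apply: haar_product_gt0.
by apply: contra an => /eqP e; rewrite -[a](starKE sP) e (star0 sP).
Qed.

Lemma modular_right_annihilated a :
  exists s, foldl (fun x l => L x - l *: x) a s = 0.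
Proof.
have [n [v [vP [X ->]]]] := coefficient_exists sP spanP a.
have [s sE] := annihilating_seq (\matrix_(c, j) f (v c j)); exists s.
have ls := lin1_foldl_eigen lL s.
rewrite (lin1_sum ls) big1 // => i _; rewrite (lin1_sum ls) big1 // => j _.
rewrite (lin1Z ls) (sE H L (fun j => v i j)) ?scaler0 // => l.
rewrite /L (tlift_comul_corep _ _ (ucorep_comul vP)); last first.
  by have lf := lin1_modular_char sP hP sigP; mlin.
by apply: eq_bigr => c _; rewrite mxE.
Qed.

Lemma modular_left_annihilated a :
  exists s, foldl (fun x l => Rf x - l *: x) a s = 0.
Proof.
have [n [v [vP [X ->]]]] := coefficient_exists sP spanP a.
have [s sE] := annihilating_seq (\matrix_(c, i) f (v i c)); exists s.
have ls := lin1_foldl_eigen lR s.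
rewrite (lin1_sum ls) big1 // => i _; rewrite (lin1_sum ls) big1 // => j _.
rewrite (lin1Z ls) (sE H Rf (fun i => v i j)) ?scaler0 // => l.
rewrite /Rf (tlift_comul_corep _ _ (ucorep_comul vP)); last first.
  by have lf := lin1_modular_char sP hP sigP; mlin.
by apply: eq_bigr => c _; rewrite mxE.
Qed.

Definition joint_eigen (p : C * C * H) :=
  [/\ 0 < p.1.1, 0 < p.1.2, L p.2 = p.1.1 *: p.2, Rf p.2 = p.1.2 *: p.2
    & S (S p.2) = (sqrtC p.1.2 / sqrtC p.1.1) *: p.2].

(** R = S^4 L makes d an eigenvector of S^4 for q = r/l, positive because S^2 is self-adjoint. Once
    S^2 d is known to be a positive multiple of d, positivity of sig = S^2 L gives l > 0. *)
Lemma joint_eigen_pos l r d : d != 0 -> L d = l *: d -> Rf d = r *: d ->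
  joint_eigen (l, r, d).
Proof.
move=> dn Ld Rd; have ipZ c a b : ip (c *: a) b = c * ip a b by rewrite (lin1Z (haar_product_lin b)).
have dd := haar_product_gt0 dn.
have sd : sig d = l *: S (S d) by rewrite -LE Ld (lin1Z lSS).
have Sdn : S (S d) != 0.
  by apply: contra dn => /eqP e; apply/eqP; do 2 apply: antipode_inj; rewrite e !(lin1_0 lS).
have ln : l != 0.
  by apply/eqP => l0; have := modular_gt0 dn; rewrite sd ipZ l0 mul0r ltxx.
pose q := r / l.
have S4 : S (S (S (S d))) = q *: d.
  have := RE d; rewrite Rd Ld !(lin1Z lS) => e.
  by rewrite /q mulrC -scalerA e scalerA mulVf // scale1r.
have q0 : 0 < q.
  have := haar_product_gt0 Sdn; rewrite -antipode2_self S4 ipZ.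
  by rewrite pmulr_lgt0.
pose s := sqrtC q.
have s0 : 0 < s by rewrite sqrtC_gt0.
have ss : s * s = q by rewrite -expr2 sqrtCK.
have Sd : S (S d) = s *: d.
  (* The difference b = S^2 d - s d has S^2 b = -s b, which positivity of S^2 forbids unless b =
     0. *)
  apply/eqP; rewrite -subr_eq0; set b := _ - _; apply: contraT => bn.
  have Sb : S (S b) = - s *: b.
    rewrite /b (lin1B lSS) (lin1Z lSS) S4 scalerBr !scaleNr opprK scalerA ss.
    by rewrite addrC.
  have := antipode2_gt0 bn; rewrite Sb ipZ mulNr oppr_gt0.
  by rewrite pmulr_rlt0 // lt_gtF // haar_product_gt0.
have l0 : 0 < l.
  have := modular_gt0 dn; rewrite sd Sd !ipZ.
  by rewrite !pmulr_lgt0 // mulr_gt0.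
have r0 : 0 < r by rewrite -(divfK ln r) mulr_gt0.
split=> //=; rewrite Sd; congr (_ *: _); rewrite /s /q.
by rewrite rootCMr ?rootCV // ltW // invr_gt0.
Qed.

(** L is diagonalised first. R commutes with L, so it can be diagonalised inside each eigenspace of
    L. *)
Lemma joint_eigen_decomposition a : exists t : seq (C * C * H),
  (forall p, p \in t -> joint_eigen p) /\ a = \sum_(p <- t) p.2.
Proof.
have [s sa] := modular_right_annihilated a.
have [t1 [t1L _ ->]] := self_adjoint_eigenvectors haar_product_lin haar_productC
  haar_product_eq0 lL modular_right_self (U := fun _ => True)
  (fun _ _ _ _ _ => I) (fun _ _ => I) I sa.
elim: t1 t1L => [|[l b] t1 IH] t1L; first by exists [::]; rewrite !big_nil.
have [t [tP tE]] : exists t, (forall p, p \in t -> joint_eigen p) /\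
    \sum_(p <- t1) p.2 = \sum_(p <- t) p.2.
  by apply: IH => p pt; apply: t1L; rewrite inE pt orbT.
have Lb : L b = l *: b by apply: (t1L (l, b)); rewrite inE eqxx.
have [s' sb] := modular_left_annihilated b.
have [||t2 [t2R t2L] bE] := self_adjoint_eigenvectors haar_product_lin haar_productC
  haar_product_eq0 lR modular_left_self (U := fun x => L x = l *: x) _ _ Lb sb.
- by move=> c x y Lx Ly; rewrite lL Lx Ly scalerDr !scalerA mulrC.
- by move=> x Lx; rewrite modular_right_leftC Lx (lin1Z lR).
(* Zero vectors are dropped, because they carry no information on the sign of their eigenvalue. *)
exists ([seq (l, p.1, p.2) | p <- t2 & p.2 != 0] ++ t); split=> [p|].
  rewrite mem_cat => /orP[/mapP[q]|/tP //].
  rewrite mem_filter => /andP[qn qt] ->.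
  by apply: joint_eigen_pos => //; [exact: t2L | exact: t2R].
rewrite big_cons big_cat big_map big_filter /= tE bE; congr (_ + _).
rewrite (bigID (fun p => p.2 != 0)) /= [X in _ + X]big1 ?addr0 // => p.
by rewrite negbK => /eqP.
Qed.

(* Prescribing d on the eigenvectors of L determines it without any choice, so
   that isomorphisms preserve it. *)
Definition is_woronowicz (d : H -> C) := @lin1 _ _ C^o d /\
  forall a l, 0 < l -> L a = l *: a -> d a = (sqrtC l)^-1 * counit a.

Lemma woronowicz_unique d d' : is_woronowicz d -> is_woronowicz d' -> d =1 d'.
Proof.
move=> [ld dE] [ld' dE'] a; have [t [tP ->]] := joint_eigen_decomposition a.
rewrite (lin1_sum ld) (lin1_sum ld') big_seq [RHS]big_seq; apply: eq_bigr => p pt.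
by have [l0 _ Lp _ _] := tP _ pt; rewrite (dE _ p.1.1) // (dE' _ p.1.1).
Qed.

Lemma woronowicz_exists : exists d, [/\ is_woronowicz d, is_character d &
  forall h, \tsum_(a ⊗ b <- comul h) d a *: S (S b) = \tsum_(a ⊗ b <- comul h) d b *: a].
Proof.
have Ldiag a : exists2 t, eigen_seq L t & a = \sum_(p <- t) p.2.
  have [t [tP ->]] := joint_eigen_decomposition a.
  exists [seq (p.1.1, p.2) | p <- t]; last by rewrite big_map.
  by move=> _ /mapP[q qt ->]; have [] := tP _ qt.
have Rdiag a : exists2 t, eigen_seq Rf t & a = \sum_(p <- t) p.2.
  have [t [tP ->]] := joint_eigen_decomposition a.
  exists [seq (p.1.2, p.2) | p <- t]; last by rewrite big_map.
  by move=> _ /mapP[q qt ->]; have [] := tP _ qt.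
pose g (l : C) := (sqrtC l)^-1.
have [W lW WE] := functional_calculus lL Ldiag g.
have [V lV VE] := functional_calculus lR Rdiag g.
have joint_ext (M : lmodType C) (F G : H -> M) : lin1 F -> lin1 G ->
    (forall p, joint_eigen p -> F p.2 = G p.2) -> F =1 G.
  move=> lF lG e a; have [t [tP ->]] := joint_eigen_decomposition a.
  rewrite (lin1_sum lF) (lin1_sum lG) big_seq [RHS]big_seq; apply: eq_bigr => p pt.
  exact/e/tP.
have SSV a : S (S (V a)) = W a.
  move: a; apply: joint_ext => [||p [l0 r0 Lp Rp Sp]]; [by mlin|by []|].
  rewrite (VE _ _ Rp) (WE _ _ Lp) (lin1Z lSS) Sp scalerA /g mulrA mulVf ?mul1r //.
  by rewrite gt_eqF // sqrtC_gt0.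
pose d a := counit (W a).
have ld : @lin1 _ _ C^o d by rewrite /d; mlin.
have WdE a : W a = \tsum_(a1 ⊗ a2 <- comul a) d a2 *: a1.
  move: a; apply: joint_ext => [||[[l r] b] [/= l0 r0 Lb Rb Sb]]; [by []|by mlin|].
  have lT : lin1 (tmap (@id H) L) by apply: tmap_linear.
  (* For an eigenvector b of L, Delta(b) is an eigenvector of id ⊗ L, hence of id ⊗ W. Applying id ⊗
     epsilon then gives the formula for W b. *)
  have E : \sum_(p <- repr (comul b)%qT) p.1 ⊗ W p.2 = g l *: comul b.
    rewrite [in RHS](tensor_sum (comul b)).
    apply: (functional_calculus_transfer lL Ldiag lW WE (lin2_pure H H) lT).
      by move=> x z; rewrite tmap_pure.
    rewrite -tensor_sum -(lin1Z (f := @comul C H)); last exact: comul_linear.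
    by rewrite -Lb -[RHS]tlift_pure_id (comul_modular_right sP hP sigP) //; exact: lin2_pure.
  rewrite (WE _ _ Lb) -[in LHS](counitr (G := id) b) // -(lin1Z (f := tlift _)).
    by rewrite -E tlift_sum_pure //; mlin.
  by apply: lin1_tlift; mlin.
have VdE a : V a = \tsum_(a1 ⊗ a2 <- comul a) d a1 *: a2.
  (* epsilon is invariant under S^2, so the same character comes from L^(-1/2) and from R^(-1/2). *)
  have dV x : d x = counit (V x) by rewrite /d -SSV !counit_antipode.
  move: a; apply: joint_ext => [||[[l r] b] [/= l0 r0 Lb Rb Sb]]; [by []|by mlin|].
  have lT : lin1 (tmap Rf (@id H)) by apply: tmap_linear.
  have lp : lin2 (fun x z : H => z ⊗ x) by mlin.
  have E : \sum_(p <- repr (comul b)%qT) V p.1 ⊗ p.2 = g r *: comul b.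
    rewrite [in RHS](tensor_sum (comul b)).
    (* The pairs are swapped because the transfer lemma acts on the second entry, whereas R acts on
       the first tensor factor. *)
    have := functional_calculus_transfer lR Rdiag lV VE lp lT
      (s := [seq (p.2, p.1) | p <- repr (comul b)%qT]) (l := r).
    rewrite !big_map /=; apply; first by move=> x z; rewrite tmap_pure.
    rewrite -tensor_sum -(lin1Z (f := @comul C H)); last exact: comul_linear.
    by rewrite -Rb -[RHS]tlift_pure_id (comul_modular_left sP hP sigP) //; exact: lin2_pure.
  rewrite (VE _ _ Rb) -[in LHS](counitl (G := id) b) // -(lin1Z (f := tlift _)).
    rewrite -E tlift_sum_pure; last by mlin.
    by apply: eq_bigr => p _; rewrite dV.
  by apply: lin1_tlift; mlin.
exists d; split.
- split=> // a l l0 La; rewrite /d (WE _ _ La) (lin1Z lc) //.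
- split=> //; first by rewrite /d (WE 1) ?modular_right1 ?scale1r // /g sqrtC1 invr1 scale1r counit1.
  (* L is multiplicative, so eigenvalues multiply, and so do square roots of positive numbers. *)
  move=> a b; rewrite /d -counitM; congr counit; move: a.
  apply: (joint_ext) => [||p [l0 _ Lp _ _]]; [by mlin|by mlin|]; move: b.
  apply: joint_ext => [||q [m0 _ Lq _ _]]; [by mlin|by mlin|].
  rewrite (WE _ _ Lp) (WE _ _ Lq) (WE (p.1.1 * q.1.1)).
    by rewrite -scalerAl -scalerAr scalerA /g rootCMr ?invfM // ltW.
  by rewrite modular_rightM Lp Lq -scalerAl -scalerAr scalerA.
move=> x; rewrite -WdE -SSV VdE (lin1_tliftE _ lSS); apply: eq_tlift => a b.
by rewrite (lin1Z lSS).
Qed.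

End WoronowiczCharacter.

(** * The pair of a compact quantum group and its invariance *)

Section CompactPair.
Variable R : realType.
Local Notation C := R[i].

(** h, sig and d are each unique for a compact quantum group, so the property singles out one
    functional whatever witnesses are used. *)
Definition woronowicz_of (H : hopfAlgType C) (d : H -> C) : Prop :=
  exists h sig, [/\ is_haar h, forall a x, h (a * x) = h (x * sig a) & is_woronowicz sig d].

Lemma woronowicz_of_unique (H : hopfAlgType C) (s : cqg H) (d d' : H -> C) :
  woronowicz_of d -> woronowicz_of d' -> d =1 d'.
Proof.
move=> [h [sig [hP sigP dP]]] [h' [sig' [hP' sigP' dP']]].
have eh : h' = h by apply: funext => x; exact: haar_unique hP' hP x.
have es : sig' = sig.
  apply: funext => a; apply: (modular_unique (cqg_starP s) hP sigP) => x.
  by rewrite -eh sigP'.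
rewrite es in dP'.
exact: (woronowicz_unique (cqg_starP s) (@cqg_span _ _ s) hP sigP dP dP').
Qed.

Lemma woronowicz_of_exists (H : hopfAlgType C) (s : cqg H) : exists d : H -> C,
  [/\ woronowicz_of d, is_character d &
  forall h, \tsum_(a ⊗ b <- comul h) d a *: antipode (antipode b) =
            \tsum_(a ⊗ b <- comul h) d b *: a].
Proof.
have sP := cqg_starP s; have spanP := @cqg_span _ _ s.
have [h hP] := haar_exists sP spanP.
have [sig sigP] := choice (modular_exists sP spanP hP).
have [d [dW dP dS]] := woronowicz_exists sP spanP hP sigP.
by exists d; split=> //; exists h, sig.
Qed.

Definition cqg_char (H : hopfAlgType C) (s : cqg H) : H -> C :=
  projT1 (cid (woronowicz_of_exists s)).

Lemma cqg_charP (H : hopfAlgType C) (s : cqg H) :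
  [/\ woronowicz_of (cqg_char s), is_character (cqg_char s) &
  forall h, \tsum_(a ⊗ b <- comul h) cqg_char s a *: antipode (antipode b) =
            \tsum_(a ⊗ b <- comul h) cqg_char s b *: a].
Proof. exact: projT2 (cid (woronowicz_of_exists s)). Qed.

Definition cqg_pair (H : hopfAlgType C) (s : cqg H) : modular_pair H :=
  character_pair (let: And3 _ dP _ := cqg_charP s in dP)
    (let: And3 _ _ dS := cqg_charP s in dS).

Lemma is_haar_iso (H K : hopfAlgType C) (f : H -> K) (h : K -> C) :
  hopf_iso f -> is_haar h -> is_haar (h \o f).
Proof.
move=> hf [lh h1 hl hr]; have lf : lin1 f by exact: hopf_iso_linear.
have fI := bij_inj (hopf_iso_bij hf).
split=> [||x|x]; first by rewrite /comp; mlin.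
- by rewrite /= (hopf_iso1 hf).
- apply: fI; rewrite (lin1Z lf) (hopf_iso1 hf) /= -hl (hopf_iso_comul hf).
  rewrite tlift_tmap ?(lin1_tliftE f) //; last by mlin.
  by apply: eq_tlift => a b; rewrite (lin1Z lf).
- apply: fI; rewrite (lin1Z lf) (hopf_iso1 hf) /= -hr (hopf_iso_comul hf).
  rewrite tlift_tmap ?(lin1_tliftE f) //; last by mlin.
  by apply: eq_tlift => a b; rewrite (lin1Z lf).
Qed.

(** The Haar functional pulls back to h o f and the modular automorphism to its conjugate by f; f
    then maps eigenvectors of L to eigenvectors with the same eigenvalue. *)
Lemma woronowicz_of_iso (H K : hopfAlgType C) (f : H -> K) (d : K -> C)
    (t : cqg K) : hopf_iso f -> woronowicz_of d -> woronowicz_of (d \o f).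
Proof.
move=> hf [h [sig [hP sigP [ld dE]]]]; have lf : lin1 f by exact: hopf_iso_linear.
have lsig := lin1_modular (cqg_starP t) hP sigP.
have [g fK gK] := hopf_iso_bij hf.
exists (h \o f), (g \o sig \o f); split; first exact: is_haar_iso.
  by move=> a x; rewrite /= !(hopf_isoM hf) gK sigP.
split=> [|a l l0 La]; first by rewrite /comp; mlin.
rewrite /= (dE (f a) l) // ?(hopf_iso_counit hf) //.
rewrite -(lin1Z lf) -La /modular_right (hopf_iso_comul hf) tlift_tmap; last first.
  by rewrite /modular_char; have lc := @counit_linear C K; mlin.
rewrite (lin1_tliftE f) //; apply: eq_tlift => x y.
by rewrite (lin1Z lf) /modular_char /= -(hopf_iso_counit hf) gK.
Qed.

Lemma cqg_pair_transport (H K : hopfAlgType C) (s : cqg H) (t : cqg K) (f : H -> K) :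
  cqg_iso s t f -> mp_transport f (cqg_pair s) (cqg_pair t).
Proof.
move=> [hf _]; split=> [h|]; last by rewrite /= (hopf_iso1 hf).
have [sW _ _] := cqg_charP s; have [tW _ _] := cqg_charP t.
exact: (woronowicz_of_unique s (woronowicz_of_iso t hf tW) sW).
Qed.

End CompactPair.

Theorem proposition4 (R : realType) :
  (exists mp : forall X : rc_structure R[i], modular_pair (rc_alg X),
     forall (X Y : rc_structure R[i]) (f : rc_alg X -> rc_alg Y),
       rc_iso f -> mp_transport f (mp X) (mp Y)) /\
  (exists mp : forall H : hopfAlgType R[i], cqg H -> modular_pair H,
     forall (H K : hopfAlgType R[i]) (s : cqg H) (t : cqg K) (f : H -> K),
       cqg_iso s t f -> mp_transport f (mp H s) (mp K t)).
Proof.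
split; first by exists (@rc_pair R[i]); exact: rc_pair_transport.
by exists (@cqg_pair R); exact: cqg_pair_transport.
Qed.
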